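(* Let $g\in L^2(\mathbb{R}^2)$ be real-valued and let $\psi^{(\pm)}$ be the monogenic/anti-monogenic wavelets built from a real-valued admissible wavelet $\psi^{(r)}$. For all $\boldsymbol{\xi}=(a,\theta,\mathbf{b})$, $a>0$, $\theta\in[0,2\pi)$, $\mathbf{b}\in\mathbb{R}^2$, the monogenic wavelet transform annihilates the $\theta$-anti-monogenic component and the anti-monogenic wavelet transform annihilates the $\theta$-monogenic component, i.e. $w^{(\pm)}_\psi(\boldsymbol{\xi};\widetilde g^{(\mp)}_{-\theta,\theta})=0$, and $$w^{(\pm)}_\psi(\boldsymbol{\xi};g)=\tfrac12\,w^{(\pm)}_\psi\big(\boldsymbol{\xi};\widetilde g^{(\pm)}_{-\theta,\theta}\big),\qquad W^{(\pm)}_\psi(\boldsymbol{\zeta};g)=\tfrac12\,W^{(\pm)}_\psi\big(\boldsymbol{\zeta};\widetilde g^{(\pm)}_{-\theta,\theta}\big),$$ where $\boldsymbol{\zeta}=(a,\theta,\mathbf{f}_b)$. For any angle $\theta'$ not of the form $\theta+l\pi$, $l\in\mathbb{Z}$, $w^{(\pm)}_\psi(\boldsymbol{\xi};g)$ is a linear combination of $w^{(\pm)}_\psi(\boldsymbol{\xi};\widetilde g^{(+)}_{-\theta',\theta'})$ and $w^{(\pm)}_\psi(\boldsymbol{\xi};\widetilde g^{(-)}_{-\theta',\theta'})$.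
   Context: $\mathbb{H}$: quaternions with units $\mathbf{i},\mathbf{j},\mathbf{k}$, $\mathbf{i}^2=\mathbf{j}^2=\mathbf{k}^2=\mathbf{i}\mathbf{j}\mathbf{k}=-1$, conjugation $q\mapsto q^*$. $\mathbf{r}_\theta=\begin{pmatrix}\cos\theta&-\sin\theta\\ \sin\theta&\cos\theta\end{pmatrix}$, $R_\theta h(\mathbf{x})=h(\mathbf{r}_{-\theta}\mathbf{x})$. Fourier transform of a quaternion-valued function: $\int_{\mathbb{R}^2}h(\mathbf{x})e^{-2\pi\mathbf{j}\mathbf{f}^T\mathbf{x}}d^2\mathbf{x}$ (kernel on the right). Riesz transforms $\mathcal{R}_l$, $l=1,2$: Fourier multipliers $-\mathbf{j}f_l/|\mathbf{f}|$. For real $h$: $h^{(\pm)}_\theta=R_\theta h\pm[\mathbf{i}R_\theta\mathcal{R}_1h+\mathbf{j}R_\theta\mathcal{R}_2h]$. For real $g$, $\widetilde g_{-\theta}(\mathbf{x})=g(\mathbf{r}_\theta\mathbf{x})$ and $\widetilde g^{(\pm)}_{-\theta,\theta}=(\widetilde g_{-\theta})^{(\pm)}_\theta$, so that $g=\frac12[\widetilde g^{(+)}_{-\theta,\theta}+\widetilde g^{(-)}_{-\theta,\theta}]$. $\psi^{(r)}\in L^2(\mathbb{R}^2)$ is real and admissible: $\int|\psi^{(r)}|^2=1$, $0<(2\pi)^2\int|\Psi^{(r)}(\mathbf{f})|^2/|\mathbf{f}|^2d^2\mathbf{f}<\infty$. $\psi^{(\pm)}=\psi^{(r)}\pm[\mathbf{i}\mathcal{R}_1\psi^{(r)}+\mathbf{j}\mathcal{R}_2\psi^{(r)}]$,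 $\psi_{\boldsymbol{\xi}}(\mathbf{x})=\frac1a\psi(\mathbf{r}_{-\theta}(\mathbf{x}-\mathbf{b})/a)$. For $\mathbb{H}$-valued $h$, $w^{(\pm)}_\psi(\boldsymbol{\xi};h)=\int h(\mathbf{x})[\psi^{(\pm)}_{\boldsymbol{\xi}}(\mathbf{x})]^*d^2\mathbf{x}$, and $W^{(\pm)}_\psi(\boldsymbol{\zeta};h)$ is its Fourier transform in $\mathbf{b}$ at frequency $\mathbf{f}_b$, for fixed $a,\theta$. *)

(* Defs.v *)
From HB Require Import structures.
From mathcomp Require Import all_boot all_order all_algebra.
From mathcomp Require Import all_classical all_reals all_analysis.
From mathcomp Require Import ring.

Set Implicit Arguments.
Unset Strict Implicit.
Unset Printing Implicit Defensive.

Import Order.TTheory GRing.Theory Num.Theory.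
Import numFieldNormedType.Exports.

Local Open Scope classical_set_scope.
Local Open Scope ring_scope.

Record quat (R : Type) : Type :=
  Quat { qre : R; qim_i : R; qim_j : R; qim_k : R }.
Arguments qre {R}.
Arguments qim_i {R}.
Arguments qim_j {R}.
Arguments qim_k {R}.

Section QuaternionRing.
Variable R : realType.
Implicit Types p q r : quat R.

Definition quat_tuple q := (qre q, qim_i q, qim_j q, qim_k q).
Definition tuple_quat (t : R * R * R * R) :=
  let: (a, b, c, d) := t in Quat a b c d.
Lemma quat_tupleK : cancel quat_tuple tuple_quat.
Proof. by case. Qed.
HB.instance Definition _ := Choice.copy (quat R) (can_type quat_tupleK).

Definition addq p q : quat R :=
  Quat (qre p + qre q) (qim_i p + qim_i q)
       (qim_j p + qim_j q) (qim_k p + qim_k q).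
Definition oppq q : quat R :=
  Quat (- qre q) (- qim_i q) (- qim_j q) (- qim_k q).
Definition mulq p q : quat R :=
  let: Quat a1 b1 c1 d1 := p in
  let: Quat a2 b2 c2 d2 := q in
  Quat (a1 * a2 - b1 * b2 - c1 * c2 - d1 * d2)
       (a1 * b2 + b1 * a2 + c1 * d2 - d1 * c2)
       (a1 * c2 - b1 * d2 + c1 * a2 + d1 * b2)
       (a1 * d2 + b1 * c2 - c1 * b2 + d1 * a2).
Definition scaleq (a : R) q : quat R :=
  Quat (a * qre q) (a * qim_i q) (a * qim_j q) (a * qim_k q).

Fact addqA : associative addq.
Proof. by move=> p q r; congr Quat; rewrite /= addrA. Qed.
Fact addqC : commutative addq.
Proof. by move=> p q; congr Quat; rewrite /= addrC. Qed.
Fact add0q : left_id (Quat 0 0 0 0) addq.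
Proof. by move=> [a b c d]; congr Quat; rewrite /= add0r. Qed.
Fact addNq : left_inverse (Quat 0 0 0 0) oppq addq.
Proof. by move=> p; congr Quat; rewrite /= addNr. Qed.
HB.instance Definition _ :=
  GRing.isZmodule.Build (quat R) addqA addqC add0q addNq.

Fact mulqA : associative mulq.
Proof. by move=> [? ? ? ?] [? ? ? ?] [? ? ? ?]; congr Quat; ring. Qed.
Fact mul1q : left_id (Quat 1 0 0 0) mulq.
Proof. by move=> [? ? ? ?]; congr Quat; ring. Qed.
Fact mulq1 : right_id (Quat 1 0 0 0) mulq.
Proof. by move=> [? ? ? ?]; congr Quat; ring. Qed.
Fact mulqDl : left_distributive mulq addq.
Proof. by move=> [? ? ? ?] [? ? ? ?] [? ? ? ?]; congr Quat => /=; ring. Qed.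
Fact mulqDr : right_distributive mulq addq.
Proof. by move=> [? ? ? ?] [? ? ? ?] [? ? ? ?]; congr Quat => /=; ring. Qed.
Fact oneq_neq0 : Quat 1 0 0 0 != 0 :> quat R.
Proof. by apply/eqP => -[/eqP]; rewrite oner_eq0. Qed.
HB.instance Definition _ := GRing.Zmodule_isNzRing.Build (quat R)
  mulqA mul1q mulq1 mulqDl mulqDr oneq_neq0.

Fact scaleqA (a b : R) q : scaleq a (scaleq b q) = scaleq (a * b) q.
Proof. by congr Quat; rewrite /= mulrA. Qed.
Fact scale1q : left_id 1 scaleq.
Proof. by move=> [? ? ? ?]; congr Quat; rewrite /= mul1r. Qed.
Fact scaleqDr : right_distributive scaleq +%R.
Proof. by move=> a p q; congr Quat; rewrite /= mulrDr. Qed.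
Fact scaleqDl q : {morph scaleq^~ q : a b / a + b}.
Proof. by move=> a b; congr Quat; rewrite /= mulrDl. Qed.
HB.instance Definition _ := GRing.Zmodule_isLmodule.Build R (quat R)
  scaleqA scale1q scaleqDr scaleqDl.

Fact scaleqAl (a : R) p q : a *: (p * q) = (a *: p) * q.
Proof. by case: p q => [? ? ? ?] [? ? ? ?]; congr Quat => /=; ring. Qed.
HB.instance Definition _ :=
  GRing.Lmodule_isLalgebra.Build R (quat R) scaleqAl.

Fact scaleqAr (a : R) p q : a *: (p * q) = p * (a *: q).
Proof. by case: p q => [? ? ? ?] [? ? ? ?]; congr Quat => /=; ring. Qed.
HB.instance Definition _ :=
  GRing.Lalgebra_isAlgebra.Build R (quat R) scaleqAr.

Definition conjq q : quat R :=
  Quat (qre q) (- qim_i q) (- qim_j q) (- qim_k q).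
Definition sqnormq q : R :=
  qre q ^+ 2 + qim_i q ^+ 2 + qim_j q ^+ 2 + qim_k q ^+ 2.

End QuaternionRing.

Definition qi {R : realType} : quat R := Quat 0 1 0 0.
Definition qj {R : realType} : quat R := Quat 0 0 1 0.
Definition qk {R : realType} : quat R := Quat 0 0 0 1.

Lemma quat_relations (R : realType) :
  [/\ qi * qi = -1 :> quat R, qj * qj = -1 :> quat R,
      qk * qk = -1 :> quat R & qi * qj * qk = -1 :> quat R].
Proof. by split; congr Quat => /=; ring. Qed.

Notation plane R := (measurableTypeR R * measurableTypeR R)%type.
Notation leb2 := (lebesgue_measure \x lebesgue_measure)%E.

Section MonogenicWaveletTransform.
Variable R : realType.
Implicit Types (x f b : plane R) (h H : plane R -> quat R).

Definition dot2 x f : R := x.1 * f.1 + x.2 * f.2.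
Definition norm2 x : R := Num.sqrt (dot2 x x).

Definition each_part (P : (plane R -> R) -> Prop) h : Prop :=
  [/\ P (qre \o h), P (qim_i \o h), P (qim_j \o h) & P (qim_k \o h)].

Definition qintegrable h : Prop :=
  each_part (fun u => leb2.-integrable setT (EFin \o u)) h.

Definition qintegral h : quat R :=
  Quat (\int[leb2]_x qre (h x)) (\int[leb2]_x qim_i (h x))
       (\int[leb2]_x qim_j (h x)) (\int[leb2]_x qim_k (h x)).

(* e^{-2 pi j t} *)
Definition expNj (t : R) : quat R :=
  Quat (cos (2 * pi * t)) 0 (- sin (2 * pi * t)) 0.

Definition fourier_int h f : quat R :=
  qintegral (fun x => h x * expNj (dot2 f x)).

Definition partial1 (u : plane R -> R) x : R :=
  derive1 (fun t : R => u (t, x.2)) x.1.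
Definition partial2 (u : plane R -> R) x : R :=
  derive1 (fun t : R => u (x.1, t)) x.2.

Fixpoint partials (l : seq bool) (u : plane R -> R) : plane R -> R :=
  if l is i :: l' then (if i then partial2 else partial1) (partials l' u)
  else u.

(* No separate continuity clause is needed: a function all of whose iterated
   partial derivatives exist and are bounded is C^oo. *)
Definition schwartz (phi : plane R -> R) : Prop :=
  forall l : seq bool,
    (forall x, derivable (fun t : R => partials l phi (t, x.2)) x.1 1 /\
               derivable (fun t : R => partials l phi (x.1, t)) x.2 1) /\
    (forall n : nat, exists C : R,
       forall x, (1 + dot2 x x) ^+ n * `|partials l phi x| <= C).

Definition tempered (u : plane R -> R) : Prop :=
  measurable_fun setT u /\
  exists n : nat,
    leb2.-integrable setT (fun x => (u x / (1 + dot2 x x) ^+ n)%:E).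

(* H is the Fourier transform of h as a tempered distribution.  On L^2 this is
   the Plancherel transform. *)
Definition is_fourier h H : Prop :=
  [/\ each_part tempered h, each_part tempered H &
      forall phi, schwartz phi ->
        qintegral (fun f => phi f *: H f) =
        qintegral (fun x => h x * fourier_int (fun f => (phi f)%:A) x)].

(* The defining integral when it converges absolutely, and otherwise a
   representative (determined up to a null set) of the distributional
   transform. *)
Definition fourier h : plane R -> quat R :=
  if `[< qintegrable h >] then fourier_int h
  else xget (fun=> 0) [set H | is_fourier h H].

(* For a real-valued u in L^2, the real-valued L^2 function (determined up to a
   null set) whose Fourier transform is m times that of u. *)
Definition fourier_multiplier (m : plane R -> quat R) (u : plane R -> R) :
    plane R -> R :=
  xget (fun=> 0) [set v : plane R -> R | v \in Lfun leb2 2%:E /\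
    {ae leb2, forall f, fourier (fun x => (v x)%:A) f =
                        m f * fourier (fun x => (u x)%:A) f}].

Definition riesz1 : (plane R -> R) -> plane R -> R :=
  fourier_multiplier (fun f => - (f.1 / norm2 f) *: qj).
Definition riesz2 : (plane R -> R) -> plane R -> R :=
  fourier_multiplier (fun f => - (f.2 / norm2 f) *: qj).

Definition rmat (theta : R) x : plane R :=
  (cos theta * x.1 - sin theta * x.2, sin theta * x.1 + cos theta * x.2).

Definition rot (theta : R) (u : plane R -> R) x : R := u (rmat (- theta) x).

(* The superscripts (+) and (-) are encoded by true and false. *)
Definition sg (s : bool) : R := if s then 1 else -1.

Definition monogenic_at (s : bool) (theta : R) (u : plane R -> R) x : quat R :=
  (rot theta u x)%:A +
  sg s *: (qi * (rot theta (riesz1 u) x)%:A + qj * (rot theta (riesz2 u) x)%:A).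

Definition gtilde (theta : R) (g : plane R -> R) x : R := g (rmat theta x).

Definition component (s : bool) (theta : R) (g : plane R -> R) :
    plane R -> quat R :=
  monogenic_at s theta (gtilde theta g).

Definition admissible (psi : plane R -> R) : Prop :=
  [/\ psi \in Lfun leb2 2%:E,
      (\int[leb2]_x (`|psi x| ^+ 2)%:E = 1)%E &
      (0 < ((2 * pi) ^+ 2)%:E * \int[leb2]_f
         (sqnormq (fourier (fun x => (psi x)%:A) f) / norm2 f ^+ 2)%:E
       < +oo)%E].

Definition wavelet (s : bool) (psi : plane R -> R) x : quat R :=
  (psi x)%:A +
  sg s *: (qi * (riesz1 psi x)%:A + qj * (riesz2 psi x)%:A).

Definition child (a theta : R) b (psi : plane R -> quat R) x : quat R :=
  a^-1 *: psi (rmat (- theta) ((x.1 - b.1) / a, (x.2 - b.2) / a)).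

Definition wt (s : bool) (psi : plane R -> R) (a theta : R) b h : quat R :=
  qintegral (fun x => h x * conjq (child a theta b (wavelet s psi) x)).

Definition Wt (s : bool) (psi : plane R -> R) (a theta : R) f h : quat R :=
  fourier (fun b => wt s psi a theta b h) f.

End MonogenicWaveletTransform.

(* Main.v *)
Require Import Defs.
From HB Require Import structures.
From mathcomp Require Import all_boot all_order all_algebra.
From mathcomp Require Import all_classical all_reals all_analysis.
From mathcomp Require Import measurable_realfun ring lra.

Set Implicit Arguments.
Unset Strict Implicit.
Unset Printing Implicit Defensive.

Import Order.TTheory GRing.Theory Num.Theory.
Import numFieldNormedType.Exports.

Local Open Scope classical_set_scope.
Local Open Scope ring_scope.

(* For a real function, the quaternionic Fourier transform with kernel
   e^{-2 pi j t} is the even part minus [j] times the odd part of its real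
   Hartley transform [H] (kernel cas = cos + sin).  In these terms the Riesz
   transforms are u |-> H^{-1}(m_l (H u)(- .)) with m_l = f_l / |f| odd and
   homogeneous of degree 0; hence they commute with each other and with
   dilations and translations, are antisymmetric, and satisfy
   <R_1 u, R_1 w> + <R_2 u, R_2 w> = <u, w>.  After a rotation by theta, these
   identities kill each quaternion component of the pairing of an anti-monogenic
   function with a monogenic wavelet (and conversely).  The remaining claims
   follow by linearity, since g is half the sum of its two components; for the
   same reason the coefficients of the last claim are both 1/2.

   On L^2, [H] is built from the explicit transforms of indicators of boxes,
   whose inner products are computed from those of the Fejer kernel; this gives
   an isometry up to a positive constant (equal to 1, but its value does not
   matter), and boxes span a dense subspace.  The link with the distributional
   Fourier transform uses the Schwartz functions exp(- s^(2 n)), which converge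
   to indicators of intervals. *)

(** * Square-integrable functions *)

(** The Hartley form suits real [g] and [psi]: all of the analysis takes place in a real L^2 space,
    and multiplication of a quaternionic transform by -j m with [m] odd, which exchanges even and
    odd parts, becomes the real operation [twist]. The angle enters only through a change of
    variable. The component and the wavelet are the same rotation applied to functions built from
    [gtilde theta g] and from a dilated translate of [psi], so one measure-preserving substitution
    removes it; this is where the equality of the two angles is used. In the resulting pairing the
    real part vanishes by the Parseval identity, the i and j parts by antisymmetry, the k part by
    commutation. The obstacle is that [riesz1], [riesz2] and, in general, [fourier] are selected
    representatives, determined only up to null sets; transforms are therefore handled as relations
    ([HT], [RT]), and identities between them are stated on inner products or almost everywhere. *)

Section SquareIntegrable.
Context d (T : measurableType d) (R : realType) (mu : {measure set T -> \bar R}).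
Implicit Types u v w : T -> R.

Definition intg u := mu.-integrable setT (EFin \o u).

Lemma intg_meas u : intg u -> measurable_fun setT u.
Proof. by move/measurable_int/measurable_EFinP. Qed.

Lemma intg_le u v : measurable_fun setT u -> intg v ->
  (forall x, `|u x| <= v x) -> intg u.
Proof.
move=> mu_ iv uv; apply: le_integrable iv => //; first exact/measurable_EFinP.
by move=> x _ /=; rewrite lee_fin (le_trans (uv x))// ler_norm.
Qed.

Lemma intgD u v : intg u -> intg v -> intg (u + v).
Proof. by move=> iu iv; have := integrableD measurableT iu iv. Qed.

Lemma intgZ (c : R) u : intg u -> intg (c *: u).
Proof. by move=> iu; have := integrableZl measurableT c iu. Qed.

Lemma intgN u : intg u -> intg (- u).
Proof. by rewrite -scaleN1r; exact: intgZ. Qed.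

Lemma intgB u v : intg u -> intg v -> intg (u - v).
Proof. by move=> iu iv; apply: intgD => //; exact: intgN. Qed.

Lemma RintD u v : intg u -> intg v ->
  \int[mu]_x (u x + v x) = \int[mu]_x u x + \int[mu]_x v x.
Proof. exact: RintegralD. Qed.

Lemma RintB u v : intg u -> intg v ->
  \int[mu]_x (u x - v x) = \int[mu]_x u x - \int[mu]_x v x.
Proof. exact: RintegralB. Qed.

Lemma RintZ (c : R) u : intg u -> \int[mu]_x (c * u x) = c * \int[mu]_x u x.
Proof. by move=> iu; rewrite RintegralZl. Qed.

Lemma Rint_le u v : intg u -> intg v -> (forall x, u x <= v x) ->
  \int[mu]_x u x <= \int[mu]_x v x.
Proof. by move=> iu iv uv; apply: le_Rintegral. Qed.

Lemma eq_ae_Rint u v : measurable_fun setT u -> measurable_fun setT v ->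
  {ae mu, forall x, u x = v x} -> \int[mu]_x u x = \int[mu]_x v x.
Proof.
move=> mu_ mv uv; congr fine; apply: ae_eq_integral => //; try exact/measurable_EFinP.
by apply: filterS uv => x -> _.
Qed.

Lemma EFin_Rint u : intg u -> (\int[mu]_x (u x)%:E)%E = (\int[mu]_x u x)%:E.
Proof. by move=> iu; rewrite fineK//; exact: integrable_fin_num. Qed.

Definition L2 u := measurable_fun setT u /\ intg (fun x => u x ^+ 2).
Definition ip u v := \int[mu]_x (u x * v x).
Definition nrm u := Num.sqrt (ip u u).

Lemma L2_meas u : L2 u -> measurable_fun setT u. Proof. by case. Qed.

Lemma L2_mul u v : L2 u -> L2 v -> intg (fun x => u x * v x).
Proof.
move=> [mu_ iu] [mv iv]; apply: (@intg_le _ (fun x => u x ^+ 2 + v x ^+ 2)).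
- exact: measurable_funM.
- exact: (intgD iu iv).
- move=> x; rewrite normrM.
  have := real_normK (num_real (u x)); have := real_normK (num_real (v x)).
  by have := sqr_ge0 (`|u x| - `|v x|); have := sqr_ge0 (`|u x| + `|v x|); nra.
Qed.

Lemma L2D u v : L2 u -> L2 v -> L2 (u + v).
Proof.
move=> [mu_ iu] [mv iv]; split; first exact: measurable_funD.
apply: (@intg_le _ (fun x => 2 * (u x ^+ 2 + v x ^+ 2))).
- by apply: measurable_funX; exact: measurable_funD.
- exact: (intgZ 2 (intgD iu iv)).
- move=> x; rewrite ger0_norm ?sqr_ge0// fctE; have := sqr_ge0 (u x - v x).
  by nra.
Qed.

Lemma L2Z (c : R) u : L2 u -> L2 (c *: u).
Proof.
move=> [mu_ iu]; split; first exact: measurable_funM.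
have := intgZ (c ^+ 2) iu; apply: eq_integrable => // x _.
by rewrite /= fctE exprMn.
Qed.

Lemma L2N u : L2 u -> L2 (- u).
Proof. by rewrite -scaleN1r; exact: L2Z. Qed.

Lemma L2B u v : L2 u -> L2 v -> L2 (u - v).
Proof. by move=> ? ?; apply: L2D => //; exact: L2N. Qed.

Lemma L20 : L2 0.
Proof.
split; first exact: measurable_cst.
apply: eq_integrable (integrable0 mu setT) => // x _.
by rewrite /= expr2 mulr0.
Qed.

Lemma ip_sym u v : ip u v = ip v u.
Proof. by congr fine; apply: eq_integral => x _; rewrite mulrC. Qed.

Lemma ipDl u v w : L2 u -> L2 v -> L2 w -> ip (u + v) w = ip u w + ip v w.
Proof.
move=> Lu Lv Lw; rewrite /ip -RintD; try exact: L2_mul.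
by congr fine; apply: eq_integral => x _; rewrite mulrDl.
Qed.

Lemma ipZl (c : R) u w : L2 u -> L2 w -> ip (c *: u) w = c * ip u w.
Proof.
move=> Lu Lw; rewrite /ip -RintZ; last exact: L2_mul.
by congr fine; apply: eq_integral => x _; rewrite mulrA.
Qed.

Lemma ipNl u w : L2 u -> L2 w -> ip (- u) w = - ip u w.
Proof. by move=> ? ?; rewrite -scaleN1r ipZl// mulN1r. Qed.

Lemma ipBl u v w : L2 u -> L2 v -> L2 w -> ip (u - v) w = ip u w - ip v w.
Proof. by move=> Lu Lv Lw; rewrite ipDl// ?ipNl//; exact: L2N. Qed.

Lemma ipDr u v w : L2 u -> L2 v -> L2 w -> ip w (u + v) = ip w u + ip w v.
Proof. by move=> ? ? ?; rewrite ip_sym ipDl// !(ip_sym w). Qed.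

Lemma ipZr (c : R) u w : L2 u -> L2 w -> ip w (c *: u) = c * ip w u.
Proof. by move=> ? ?; rewrite ip_sym ipZl// ip_sym. Qed.

Lemma ipBr u v w : L2 u -> L2 v -> L2 w -> ip w (u - v) = ip w u - ip w v.
Proof. by move=> ? ? ?; rewrite ip_sym ipBl// !(ip_sym w). Qed.

Lemma ip_ge0 u : 0 <= ip u u.
Proof. by apply: Rintegral_ge0 => x _; rewrite -expr2 sqr_ge0. Qed.

Lemma nrm_ge0 u : 0 <= nrm u. Proof. exact: sqrtr_ge0. Qed.

Lemma nrm_sqr u : nrm u ^+ 2 = ip u u.
Proof. by rewrite sqr_sqrtr// ip_ge0. Qed.

Lemma eq_ae_ip u u' v v' : L2 u -> L2 u' -> L2 v -> L2 v' ->
  {ae mu, forall x, u x = u' x} -> {ae mu, forall x, v x = v' x} ->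
  ip u v = ip u' v'.
Proof.
move=> Lu Lu' Lv Lv' uu' vv'; apply: eq_ae_Rint.
- by apply: measurable_funM; exact: L2_meas.
- by apply: measurable_funM; exact: L2_meas.
- by apply: filterS2 uu' vv' => x -> ->.
Qed.

(** The quadratic [t |-> ip (u + t *: v) (u + t *: v)] is nonnegative, so its discriminant is not
    positive. A vanishing leading coefficient is treated apart. *)
Lemma ip_cauchy_schwarz u v : L2 u -> L2 v -> `|ip u v| <= nrm u * nrm v.
Proof.
move=> Lu Lv.
have pos (t : R) : 0 <= ip u u + 2 * t * ip u v + t ^+ 2 * ip v v.
  have := ip_ge0 (u + t *: v).
  have Lt := L2Z t Lv.
  rewrite !(ipDl, ipDr, ipZl, ipZr)//; last exact: L2D.
  by rewrite (ip_sym v u); nra.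
rewrite -ler_sqr ?nnegrE ?normr_ge0 ?mulr_ge0 ?nrm_ge0//.
rewrite real_normK ?num_real// exprMn !nrm_sqr.
have [v0|v0] := eqVneq (ip v v) 0.
  have := pos (- (ip u u + 1) * ip u v); have := pos (ip u v).
  rewrite v0 !mulr0 !addr0 => h1 h2; have := ip_ge0 u => h3.
  rewrite leNgt; apply/negP => h4.
  have h5 : 1 * ip u v ^+ 2 <= 2 * (ip u u + 1) * ip u v ^+ 2 by nra.
  have h6 : ip u u + 1 > 0 by lra.
  (* With [ip v v = 0] the quadratic is affine in [t], and this [t] gives it the value -1. *)
  have := pos (- (ip u u + 1) / (2 * ip u v)).
  have nz : ip u v != 0 by apply: contraTN h4 => /eqP ->; rewrite expr2 mulr0 ltxx.
  rewrite v0 mulr0 addr0.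
  have -> : 2 * (- (ip u u + 1) / (2 * ip u v)) * ip u v = - (ip u u + 1) by field.
  lra.
have vp : 0 < ip v v by rewrite lt_neqAle eq_sym v0 ip_ge0.
have := pos (- ip u v / ip v v).
have -> : ip u u + 2 * (- ip u v / ip v v) * ip u v
  + (- ip u v / ip v v) ^+ 2 * ip v v = ip u u - ip u v ^+ 2 / ip v v by field.
by rewrite subr_ge0 ler_pdivrMr.
Qed.

Lemma nrmD u v : L2 u -> L2 v -> nrm (u + v) <= nrm u + nrm v.
Proof.
move=> Lu Lv; rewrite -ler_sqr ?nnegrE ?addr_ge0 ?nrm_ge0// nrm_sqr.
have LD := L2D Lu Lv.
rewrite !(ipDl, ipDr)// (ip_sym v u) sqrrD !nrm_sqr.
by have := ip_cauchy_schwarz Lu Lv; have := ler_norm (ip u v); lra.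
Qed.

Lemma nrmZ (c : R) u : L2 u -> nrm (c *: u) = `|c| * nrm u.
Proof.
move=> Lu; rewrite /nrm ipZl ?ipZr//; last exact: L2Z.
by rewrite mulrA -expr2 sqrtrM ?sqr_ge0// sqrtr_sqr.
Qed.

Lemma nrmN u : L2 u -> nrm (- u) = nrm u.
Proof. by move=> Lu; rewrite -scaleN1r nrmZ// normrN1 mul1r. Qed.

Lemma nrmBC u v : L2 u -> L2 v -> nrm (u - v) = nrm (v - u).
Proof. by move=> Lu Lv; rewrite -opprB nrmN//; exact: L2B. Qed.

Lemma nrmB_tri u v w : L2 u -> L2 v -> L2 w ->
  nrm (u - w) <= nrm (u - v) + nrm (v - w).
Proof.
by move=> ? ? ?; rewrite -(subrKA v) nrmD//; exact: L2B.
Qed.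

End SquareIntegrable.

(** * Completeness of L^2 and orthogonal projection *)

Section Completeness.
Context d (T : measurableType d) (R : realType) (mu : {measure set T -> \bar R}).
Implicit Types (u v w : T -> R) (s t : nat -> T -> R).

Definition L2cvg s u :=
  forall e : R, 0 < e -> exists N, forall n, (N <= n)%N -> nrm mu (s n - u) < e.
Definition L2cauchy s :=
  forall e : R, 0 < e -> exists N, forall m n, (N <= m)%N -> (N <= n)%N ->
    nrm mu (s m - s n) < e.

Let L2_abs u : L2 mu u -> L2 mu (fun x => `|u x|).
Proof.
move=> [mu_ iu]; split; first exact: measurableT_comp.
apply: eq_integrable iu => // x _ /=.
by rewrite real_normK// num_real.
Qed.

Let nrm_abs u : nrm mu (fun x => `|u x|) = nrm mu u.
Proof.
congr Num.sqrt; congr fine; apply: eq_integral => x _; congr EFin.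
by rewrite -!expr2 real_normK// num_real.
Qed.

Let nrm_lt_sqrt u (e : R) : 0 < e -> ip mu u u < e ^+ 2 -> nrm mu u < e.
Proof.
move=> e0 h; rewrite -ltr_sqr ?nnegrE ?nrm_ge0 ?(ltW e0)//.
by rewrite nrm_sqr.
Qed.

(** The Riesz-Fischer argument: monotone convergence makes the squared sum of absolute increments
    integrable, so the sequence converges almost everywhere, and that same squared sum dominates the
    squared distance to the limit. *)
Lemma L2cvg_of_summable_increments t :
  (forall k, L2 mu (t k)) ->
  (forall k, nrm mu (t k.+1 - t k) <= 2^-1 ^+ k) ->
  exists2 u, L2 mu u & L2cvg t u.
Proof.
move=> Lt ht.
pose G K := (fun x => \sum_(0 <= k < K) `|t k.+1 x - t k x|) : T -> R.
have GS K : G K.+1 = G K + (fun x => `|(t K.+1 - t K) x|).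
  by apply/funext => x; rewrite /G big_nat_recr.
have LG K : L2 mu (G K).
  elim: K => [|K IH]; last by rewrite GS; apply: L2D => //; apply: L2_abs; exact: L2B.
  suff -> : G 0%N = 0 by exact: L20.
  by apply/funext => x; rewrite /G big_geq.
(* Sharper than [nrm mu (G K) <= 2] so that the induction closes: a step adds at most [2^-1 ^+ K],
   which is what the second term loses. *)
have nG K : nrm mu (G K) + 2 * 2^-1 ^+ K <= 2.
  elim: K => [|K IH].
    have -> : G 0%N = 0 by apply/funext => x; rewrite /G big_geq.
    rewrite /nrm /ip.
    under eq_Rintegral => x _ do rewrite mulr0.
    by rewrite Rintegral_cst// mul0r sqrtr0 add0r expr0 mulr1.
  rewrite GS; apply: le_trans IH.
  have := nrmD (LG K) (L2_abs (L2B (Lt K.+1) (Lt K))).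
  rewrite nrm_abs exprS; have := ht K; lra.
have GnD : forall x, {homo G^~ x : n m / (n <= m)%N >-> n <= m}.
  move=> x n m nm; rewrite /G [leRHS](big_cat_nat (n := n))//= lerDl.
  by apply: sumr_ge0 => i _.
have G0 K x : 0 <= G K x by apply: sumr_ge0 => i _.
have ndE : forall x, [set: T] x -> {homo (fun K => (G K x ^+ 2)%:E) : n m / (n <= m)%N >-> (n <= m)%E}.
  by move=> x _ n m nm; rewrite lee_fin ler_sqr ?nnegrE//; exact: GnD.
pose g x := ereal_sup (range (fun K => (G K x ^+ 2)%:E)).
have cg x : (G K x ^+ 2)%:E @[K --> \oo] --> g x.
  by apply: ereal_nondecreasing_cvgn => n m; exact: ndE.
have mG2 K : measurable_fun setT (fun x => (G K x ^+ 2)%:E).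
  by apply/measurable_EFinP/measurable_funX/L2_meas/LG.
have Gg K x : ((G K x ^+ 2)%:E <= g x)%E.
  by apply: ereal_sup_ubound; exists K.
have g0 x : (0 <= g x)%E by apply: le_trans (Gg 0%N x); rewrite lee_fin sqr_ge0.
have mg : measurable_fun setT g.
  by apply: (emeasurable_fun_cvg _ _ mG2) => x _; exact: cg.
have ig : mu.-integrable setT g.
  apply/integrableP; split => //.
  under eq_integral => x _ do rewrite gee0_abs//.
  have := @cvg_monotone_convergence _ _ _ mu setT measurableT _ mG2.
  move=> /(_ _ ndE) h.
  have /h : forall n x, [set: T] x -> (0 <= (G n x ^+ 2)%:E)%E.
    by move=> n x _; rewrite lee_fin sqr_ge0.
  move=> {}h; apply: (@le_lt_trans _ _ 4%:E); last by rewrite ltry.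
  have -> : (\int[mu]_x g x = \int[mu]_x limn (fun K => (G K x ^+ 2)%:E))%E.
    by apply: eq_integral => x _; apply/esym/cvg_lim => //; exact: cg.
  apply: (lee_cvg_to h (cvg_cst _)); apply: nearW => K.
  have iG : intg mu (fun x => G K x ^+ 2) by case: (LG K).
  rewrite EFin_Rint// lee_fin.
  have -> : \int[mu]_x (G K x ^+ 2) = nrm mu (G K) ^+ 2.
    by rewrite nrm_sqr; apply: eq_Rintegral => x _; rewrite expr2.
  have := nG K; have := nrm_ge0 mu (G K).
  have : 0 <= (2^-1 : R) ^+ K by rewrite exprn_ge0.
  by nra.
have gfin := integrable_ae measurableT ig.
pose C := [set x | g x \is a fin_num].
have mC : measurable C.
  by rewrite -(setTI C); exact: emeasurable_fin_num.
have ct x : C x -> cvgn (t^~ x).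
  move=> Cx.
  have : cvgn [normed series (fun k => t k.+1 x - t k x)].
    apply: nondecreasing_is_cvgn => [n m nm|]; first exact: GnD.
    exists (fine (g x) + 1) => _ [K _ <-].
    have := Gg K x; rewrite -(fineK Cx) lee_fin => h.
    have : 0 <= (G K x - 1) ^+ 2 by exact: sqr_ge0.
    have -> : [normed series (fun k => t k.+1 x - t k x)] K = G K x by [].
    have : 0 <= fine (g x) by rewrite fine_ge0.
    by nra.
  move/normed_cvg.
  have -> : series (fun k => t k.+1 x - t k x) = (fun n => t n x - t 0%N x).
    by apply/funext => n; rewrite /series/= telescope_sumr.
  move=> h; have : cvgn (fun n => (t n x - t 0%N x) + t 0%N x).
    by apply: is_cvgD => //; exact: is_cvg_cst.
  by under eq_fun => n do rewrite subrK.
(* Set to 0 off [C], the sequence converges everywhere, so its limit is measurable. *)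
pose t' k := (fun x => t k x * \1_C x) : T -> R.
pose u x := limn (fun k => t' k x).
have ct' x : t' k x @[k --> \oo] --> u x.
  rewrite /u; have [Cx|nCx] := pselect (C x).
    have -> : (fun k => t' k x) = t^~ x.
      by apply/funext => k; rewrite /t' indicE mem_set// mulr1.
    exact: ct.
  have -> : (fun k => t' k x) = (fun=> 0).
    by apply/funext => k; rewrite /t' indicE memNset// mulr0.
  exact: is_cvg_cst.
have mu_ : measurable_fun setT u.
  apply: (@measurable_fun_cvg _ _ _ _ t') => [k|x _]; last exact: ct'.
  by apply: measurable_funM; [exact: L2_meas (Lt k)|exact: measurable_indic].
have tuC x : C x -> t k x @[k --> \oo] --> u x.
  move=> Cx; have := ct' x.
  have -> // : (fun k => t' k x) = t^~ x.
  by apply/funext => k; rewrite /t' indicE mem_set// mulr1.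
have tail k x : C x -> (((t k x - u x) ^+ 2)%:E <= g x)%E.
  move=> Cx; rewrite -(fineK Cx) lee_fin.
  have h : (t k x - t j x) ^+ 2 @[j --> \oo] --> (t k x - u x) ^+ 2.
    rewrite expr2; under eq_fun do rewrite expr2.
    by apply: cvgM; (apply: cvgB; [exact: cvg_cst|exact: tuC]).
  apply: (ler_cvg_to h (cvg_cst _)); exists k => // j /= kj.
  have tG : `|t k x - t j x| <= G j x.
    rewrite distrC -(telescope_sumr (t^~ x) kj) (le_trans (ler_norm_sum _ _ _))//.
    rewrite /G [leRHS](big_cat_nat (n := k))//= lerDr.
    by apply: sumr_ge0 => i _.
  have := Gg j x; rewrite -(fineK Cx) lee_fin; apply: le_trans.
  by rewrite -(real_normK (num_real (t k x - t j x))) ler_sqr ?nnegrE.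
have mf k : measurable_fun [set: T] (fun x => ((t k x - u x) ^+ 2)%:E).
  by apply/measurable_EFinP/measurable_funX/measurable_funB => //; exact: L2_meas.
have aeC : {ae mu, forall x, C x} by apply: filterS gfin => x /(_ I).
have itu k : intg mu (fun x => (t k x - u x) ^+ 2).
  apply/integrableP; split; first exact: mf.
  have /integrableP[_ h] := ig; apply: (le_lt_trans _ h).
  apply: ae_ge0_le_integral => //.
  - by apply: measurableT_comp => //; exact: mf.
  - exact: measurableT_comp.
  - apply: filterS aeC => x Cx _ /=.
    by rewrite gee0_abs// ger0_norm ?sqr_ge0//; exact: tail.
have Lu : L2 mu u.
  have Lut : L2 mu (t 0%N - u) by split; [apply: measurable_funB => //; exact: L2_meas|exact: itu].
  have -> : u = t 0%N - (t 0%N - u) by rewrite subKr.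
  exact: L2B.
exists u => // e e0.
have a1 : {ae mu, forall x, [set: T] x -> ((t k x - u x) ^+ 2)%:E @[k --> \oo] --> 0%E}.
  apply: filterS aeC => x Cx _; apply: cvg_EFin; first exact: nearW.
  have -> : 0 = (u x - u x) * (u x - u x) :> R by rewrite subrr mul0r.
  by under eq_fun do rewrite expr2;
    apply: cvgM; (apply: cvgB; [exact: tuC|exact: cvg_cst]).
have a2 : {ae mu, forall x, forall k, [set: T] x -> (`|((t k x - u x) ^+ 2)%:E| <= g x)%E}.
  by apply: filterS aeC => x Cx k _; rewrite gee0_abs ?lee_fin ?sqr_ge0//; exact: tail.
have [_ _] := @dominated_convergence _ _ _ mu setT measurableT
  (fun k x => ((t k x - u x) ^+ 2)%:E) (fun=> 0%E) g mf (measurable_cst _) a1 ig a2.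
rewrite integral0 => /fine_cvgP[_] /cvgrPdist_lt /(_ (e ^+ 2)).
rewrite exprn_gt0// => /(_ isT)[N _ hN]; exists N => n /hN /=.
rewrite sub0r normrN => h; apply: nrm_lt_sqrt => //.
by rewrite (le_lt_trans _ h)// ler_norm.
Qed.

(** A subsequence with increments at most [2^-1 ^+ k] converges; the running maximum [M] makes the
    chosen indices nondecreasing. *)
Lemma L2_complete s : (forall n, L2 mu (s n)) -> L2cauchy s ->
  exists2 u, L2 mu u & L2cvg s u.
Proof.
move=> Ls cs.
have e0 k : 0 < (2^-1 : R) ^+ k by rewrite exprn_gt0.
have [N hN] := choice (fun k => cs _ (e0 k)).
pose M k := \max_(i < k.+1) N i.
have NM k : (N k <= M k)%N by rewrite /M; exact: (leq_bigmax (ord_max : 'I_k.+1)).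
have MM k : (M k <= M k.+1)%N.
  by rewrite {2}/M big_ord_recr/= leq_maxl.
have [|k|u Lu cu] := @L2cvg_of_summable_increments (fun k => s (M k)).
- by move=> k; exact: Ls.
- by apply/ltW/hN => //; exact: leq_trans (NM k) (MM k).
exists u => // e ep; have e2 : 0 < e / 2 by rewrite divr_gt0.
have [K hK] := cu _ e2.
have [K' hK'] : exists K', (2^-1 : R) ^+ K' < e / 2.
  have : (2^-1 : R) ^+ k @[k --> \oo] --> 0 by apply: cvg_expr; rewrite ger0_norm// invf_lt1// ltr1n.
  move=> /cvgrPdist_lt /(_ _ e2)[K' _ /(_ K' (leqnn _))] /=.
  by rewrite sub0r normrN ger0_norm ?exprn_ge0//; exists K'.
pose L := maxn K K'.
exists (M L) => n Mn.
have h1 := hK L (leq_maxl _ _).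
have h2 := hN L n (M L) (leq_trans (NM L) Mn) (NM L).
have h3 : (2^-1 : R) ^+ L <= 2^-1 ^+ K' by apply: ler_wiXn2l; rewrite ?leq_maxr// invf_le1// ler1n.
have := nrmB_tri (Ls n) (Ls (M L)) Lu; lra.
Qed.

Lemma L2cvg_cauchy s u : (forall n, L2 mu (s n)) -> L2 mu u -> L2cvg s u -> L2cauchy s.
Proof.
move=> Ls Lu su e e0; have e2 : 0 < e / 2 by rewrite divr_gt0.
have [N hN] := su _ e2; exists N => m n /hN h1 /hN h2.
have := nrmB_tri (Ls m) Lu (Ls n); rewrite (nrmBC Lu (Ls n)); lra.
Qed.

Lemma L2cvg_ip s t u v : (forall n, L2 mu (s n)) -> (forall n, L2 mu (t n)) ->
  L2 mu u -> L2 mu v -> L2cvg s u -> L2cvg t v ->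
  ip mu (s n) (t n) @[n --> \oo] --> ip mu u v.
Proof.
move=> Ls Lt Lu Lv su tv; apply/cvgrPdist_lt => e e0.
(* With [d' <= 1] the three error terms add up to less than [d' * A]; the constant 2 absorbs the
   quadratic one and keeps [A] positive. *)
pose A := nrm mu u + nrm mu v + 2.
have A0 : 0 < A by rewrite /A; have := nrm_ge0 mu u; have := nrm_ge0 mu v; lra.
pose d' := Num.min 1 (e / A).
have d0 : 0 < d' by rewrite lt_min ltr01 divr_gt0.
have [N hN] := su _ d0; have [N' hN'] := tv _ d0.
exists (maxn N N') => // n /=; rewrite geq_max => /andP[/hN h1 /hN' h2].
have B1 : L2 mu (s n - u) by exact: L2B.
have B2 : L2 mu (t n - v) by exact: L2B.
have -> : ip mu u v - ip mu (s n) (t n)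
    = - (ip mu (s n - u) (t n - v) + ip mu (s n - u) v + ip mu u (t n - v)).
  by rewrite !(ipBl, ipBr)//; ring.
rewrite normrN.
have d1 : d' <= 1 by rewrite ge_min lexx.
have dA : d' * A <= e by rewrite -ler_pdivlMr// ge_min lexx orbT.
have := ip_cauchy_schwarz B1 B2; have := ip_cauchy_schwarz B1 Lv; have := ip_cauchy_schwarz Lu B2.
have := nrm_ge0 mu u; have := nrm_ge0 mu v.
have := nrm_ge0 mu (s n - u); have := nrm_ge0 mu (t n - v).
have := ler_normD (ip mu (s n - u) (t n - v) + ip mu (s n - u) v) (ip mu u (t n - v)).
have := ler_normD (ip mu (s n - u) (t n - v)) (ip mu (s n - u) v).
rewrite /A in dA A0 *; nra.
Qed.

Lemma L2cvg_cst u : L2 mu u -> L2cvg (fun=> u) u.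
Proof.
move=> Lu e e0; exists 0%N => n _; rewrite subrr.
rewrite /nrm /ip; under eq_Rintegral => x _ do rewrite mulr0.
by rewrite Rintegral_cst// mul0r sqrtr0.
Qed.

(* [M] need not be closed: the projection [p] is a limit of elements of [M]. *)
Lemma L2_projection (M : set (T -> R)) u :
  M 0 -> (forall (c : R) v w, M v -> M w -> M (c *: v + w)) ->
  (forall v, M v -> L2 mu v) -> L2 mu u ->
  exists s p, [/\ forall n, M (s n), L2 mu p, L2cvg s p &
    forall v, M v -> ip mu (u - p) v = 0].
Proof.
move=> M0 Mlin ML Lu.
pose D := [set ip mu (u - v) (u - v) | v in M].
pose dist := inf D.
have hD : has_inf D.
  split; first by exists (ip mu (u - 0) (u - 0)), 0.
  by exists 0 => _ [v _ <-]; exact: ip_ge0.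
have dle v : M v -> dist <= ip mu (u - v) (u - v).
  by move=> Mv; apply: inf_lbound; [case: hD|exists v].
have ex n : exists v, M v /\ ip mu (u - v) (u - v) < dist + n.+1%:R^-1.
  have n0 : 0 < n.+1%:R^-1 :> R by rewrite invr_gt0 ltr0n.
  by have [_ [v Mv <-] h] := inf_adherent n0 hD; exists v.
have [s hs] := choice ex.
have Ms n : M (s n) := (hs n).1.
have Ls n : L2 mu (s n) := ML _ (Ms n).
have par m n : ip mu (s m - s n) (s m - s n) <= 2 * m.+1%:R^-1 + 2 * n.+1%:R^-1.
  have Mmid : M (2^-1 *: s m + (2^-1 *: s n + 0)) by apply/(Mlin)/(Mlin).
  have := dle _ Mmid; have := (hs m).2; have := (hs n).2.
  have L1 := L2Z 2^-1 (Ls m); have L2_ := L2Z 2^-1 (Ls n).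
  have L3 := L2D L1 L2_.
  rewrite addr0.
  (* The parallelogram identity; the midpoint of [s m] and [s n] is again in [M]. *)
  have E : ip mu (s m - s n) (s m - s n) =
     2 * ip mu (u - s m) (u - s m) + 2 * ip mu (u - s n) (u - s n)
     - 4 * ip mu (u - (2^-1 *: s m + 2^-1 *: s n)) (u - (2^-1 *: s m + 2^-1 *: s n)).
    have H1 := L2B (Ls m) (Ls n); have H2 := L2B Lu (Ls m); have H3 := L2B Lu (Ls n).
    have H4 := L2B Lu L3.
    rewrite !(ipBl, ipBr)// !(ipDl, ipDr)// !(ipZl, ipZr)//.
    rewrite (ip_sym mu (s m) u) (ip_sym mu (s n) u) (ip_sym mu (s n) (s m)); field.
    by [].
  have lin (A B C x y z : R) : B < z + y -> A < z + x -> z <= C ->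
    2 * A + 2 * B - 4 * C <= 2 * x + 2 * y by lra.
  by rewrite E; exact: lin.
have cs : L2cauchy s.
  move=> e e0.
  have e4 : 0 < e ^+ 2 / 4 by rewrite divr_gt0// exprn_gt0.
  have [N _ hN] := near_infty_natSinv_lt (PosNum e4).
  exists N => m n /hN /= h1 /hN /= h2.
  apply: nrm_lt_sqrt => //; apply: le_lt_trans (par m n) _.
  have lin (x y z : R) : x < z / 4 -> y < z / 4 -> 2 * x + 2 * y < z by lra.
  exact: lin.
have [p Lp sp] := L2_complete Ls cs.
exists s, p; split => // v Mv.
have Lv := ML _ Mv; have Lup := L2B Lu Lp.
have us : L2cvg (fun n => u - s n) (u - p).
  move=> e e0; have [N hN] := sp _ e0; exists N => n /hN.
  have -> : u - s n - (u - p) = p - s n by apply/funext => x; rewrite !fctE; ring.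
  by rewrite nrmBC.
have Lus n : L2 mu (u - s n) by exact: L2B.
have c1 := L2cvg_ip Lus Lus Lup Lup us us.
have c2 := L2cvg_ip Lus (fun=> Lv) Lup Lv us (L2cvg_cst Lv).
have dp : ip mu (u - p) (u - p) <= dist.
  apply/ler_addgt0Pr => e e0.
  have [N _ hN] := near_infty_natSinv_lt (PosNum e0).
  apply: (ler_cvg_to c1 (cvg_cst _)); exists N => // n /= /hN /= h.
  by rewrite (le_trans (ltW (hs n).2))// lerD2l ltW.
have key (t : R) : dist <= ip mu (u - p) (u - p) - 2 * t * ip mu (u - p) v + t ^+ 2 * ip mu v v.
  have c3 : ip mu (u - s n) (u - s n) - 2 * t * ip mu (u - s n) v + t ^+ 2 * ip mu v v @[n --> \oo]
     --> ip mu (u - p) (u - p) - 2 * t * ip mu (u - p) v + t ^+ 2 * ip mu v v.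
    by apply: cvgD; [apply: cvgB => //; apply: cvgM => //|]; exact: cvg_cst.
  apply: (ler_cvg_to (cvg_cst _) c3); apply: nearW => n.
  have -> : ip mu (u - s n) (u - s n) - 2 * t * ip mu (u - s n) v + t ^+ 2 * ip mu v v
     = ip mu (u - (t *: v + s n)) (u - (t *: v + s n)).
    have L1 := L2Z t Lv; have L2_ := L2D L1 (Ls n); have L3 := L2B Lu L2_.
    rewrite !(ipBl, ipBr)// !(ipDl, ipDr)// !(ipZl, ipZr)//.
    rewrite (ip_sym mu (s n) u) (ip_sym mu v u) (ip_sym mu v (s n)); ring.
  by apply: dle; exact: Mlin.
set a := ip mu (u - p) v in key *; set b := ip mu v v in key.
have b0 : 0 <= b by exact: ip_ge0.
(* The optimal [t] would be [a / b]; the denominator [b + 1] also covers [b = 0] and still yields a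
   strictly positive multiple of [a ^+ 2]. *)
have := key (a / (b + 1)).
have b1 : b + 1 != 0 by apply: lt0r_neq0; lra.
have -> : ip mu (u - p) (u - p) - 2 * (a / (b + 1)) * a + (a / (b + 1)) ^+ 2 * b
   = ip mu (u - p) (u - p) - a ^+ 2 * ((b + 2) / (b + 1) ^+ 2) by field.
have kp : 0 < (b + 2) / (b + 1) ^+ 2 by rewrite divr_gt0// ?exprn_even_gt0//; lra.
move=> h; apply/eqP; rewrite -sqrf_eq0 eq_le sqr_ge0 andbT.
by rewrite -(pmulr_lle0 _ kp) mulrC; lra.
Qed.

End Completeness.

(** * Changes of variable *)

Section ScalingMaps.
Context d (T : measurableType d) (R : realType) (mu : {measure set T -> \bar R}).
Implicit Types (u v : T -> R) (phi : T -> T).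

(** The pushforward of [mu] by [phi] is [k] times [mu]; for an invertible affine map of the plane,
    [k] is the inverse of the absolute value of the determinant. *)
Definition scales phi (k : R) := [/\ measurable_fun setT phi, 0 < k &
  forall A, measurable A -> mu (phi @^-1` A) = (k%:E * mu A)%E].

Lemma scales_comp phi psi k l : scales phi k -> scales psi l ->
  scales (phi \o psi) (k * l).
Proof.
move=> [mphi k0 hphi] [mpsi l0 hpsi]; split.
- exact: measurableT_comp.
- exact: mulr_gt0.
- move=> A mA; rewrite comp_preimage hpsi.
    by rewrite hphi// muleA -EFinM mulrC.
  by rewrite -(setTI (_ @^-1` _)); exact: mphi.
Qed.

Lemma scales_ae phi k (P : T -> Prop) : scales phi k ->
  {ae mu, forall x, P x} -> {ae mu, forall x, P (phi x)}.
Proof.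
move=> [mphi k0 hphi] [N [mN N0 PN]]; exists (phi @^-1` N); split.
- by rewrite -(setTI (_ @^-1` _)); exact: mphi.
- by rewrite hphi// N0 mule0.
- by move=> x /= nP; apply: PN.
Qed.

Let ge0_integral_scales phi k (f : T -> \bar R) : scales phi k ->
  measurable_fun setT f -> (forall x, (0 <= f x)%E) ->
  (\int[mu]_x f (phi x) = k%:E * \int[mu]_x f x)%E.
Proof.
move=> [mphi k0 hphi] mf f0.
have := @ge0_integral_pushforward _ _ _ _ _ phi mphi mu setT f measurableT mf (fun x _ => f0 x).
rewrite preimage_setT => <-.
have k0' : 0 <= k by exact: ltW.
rewrite -(ge0_integral_mscale mu measurableT (NngNum k0'))//.
apply: eq_measure_integral => A mA _.
exact: hphi.
Qed.

Lemma scales_intg phi k u : scales phi k -> intg mu u -> intg mu (fun x => u (phi x)).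
Proof.
move=> sphi iu; have [mphi k0 hphi] := sphi.
have mu_ := intg_meas iu.
apply/integrableP; split.
  by apply/measurable_EFinP; exact: (measurableT_comp mu_).
have ma : measurable_fun setT (fun x => `|(u x)%:E|%E).
  by apply: measurableT_comp => //; exact/measurable_EFinP.
have /= -> := ge0_integral_scales sphi ma (fun=> abse_ge0 _).
move/integrableP : iu => [_ iu]; rewrite lte_mul_pinfty// ?lee_fin ?(ltW k0)//.
Qed.

Lemma scales_Rint phi k u : scales phi k -> intg mu u ->
  \int[mu]_x u (phi x) = k * \int[mu]_x u x.
Proof.
move=> sphi iu; have mu_ := intg_meas iu.
have mE : measurable_fun setT (EFin \o u) by exact/measurable_EFinP.
suff E : (\int[mu]_x (u (phi x))%:E = k%:E * \int[mu]_x (u x)%:E)%E.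
  by rewrite /Rintegral E fineM//; exact: integrable_fin_num.
rewrite [LHS]integralE [in RHS]integralE.
rewrite muleBr//; last first.
  apply: fin_num_adde_defr.
  exact: (integrable_pos_fin_num measurableT iu).
rewrite -(ge0_integral_scales sphi); [|exact: measurable_funepos|by []].
rewrite -(ge0_integral_scales sphi); [|exact: measurable_funeneg|by []].
by congr (_ - _)%E; apply: eq_integral => x _; rewrite ?funeposE ?funenegE.
Qed.

Lemma scales_L2 phi k u : scales phi k -> L2 mu u -> L2 mu (fun x => u (phi x)).
Proof.
move=> sphi [mu_ iu]; have [mphi _ _] := sphi; split.
  exact: (measurableT_comp mu_).
exact: (scales_intg sphi iu).
Qed.

End ScalingMaps.

(** * Affine maps of the line and of the plane *)

Section PlaneMaps.
Variable R : realType.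
Notation mu := (@lebesgue_measure R).
Notation mR := (measurableTypeR R).

Definition pushforward_measure d d' (X : measurableType d) (Y : measurableType d')
    (m : {measure set X -> \bar R}) (phi : X -> Y)
    (mphi : measurable_fun setT phi) : {measure set Y -> \bar R} :=
  measure_function_pushforward__canonical__measure_function_Measure m mphi.

(** Puts the scaling property in the form of uniqueness theorems for measures: [m] itself compared
    with a multiple of a pushforward. *)
Lemma scalesI d (T : measurableType d) (m : {measure set T -> \bar R}) (phi : T -> T)
    (k : R) (mphi : measurable_fun setT phi) (k0 : 0 <= k) :
  0 < k ->
  (forall A, measurable A -> m A = mscale (NngNum k0) (pushforward_measure m mphi) A) ->
  scales m phi k^-1.
Proof.
move=> kp h; split; rewrite ?invr_gt0// => A mA.
rewrite (h A mA)/= /mscale/= muleA -EFinM mulVf ?mul1e//.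
exact: lt0r_neq0.
Qed.

Lemma lebesgue_affine (a b : R) : 0 < a ->
  scales mu (fun x : mR => a * x + b : mR) a^-1.
Proof.
move=> a0.
have mphi : measurable_fun setT (fun x : mR => a * x + b : mR).
  by apply: measurable_funD => //; exact: measurable_funM.
apply: (@scalesI _ _ mu _ a mphi (ltW a0)) => // A mA.
apply: lebesgue_measure_unique mA => _ [[c e] ce <-].
rewrite [RHS](_ : _ = a%:E * mu ((fun x : mR => (a * x + b)%R : mR) @^-1` `]c, e]%classic))%E//.
have -> : (fun x : mR => a * x + b : mR) @^-1` `]c, e] = `](c - b) / a, (e - b) / a]%classic.
  apply/seteqP; split => x /=; rewrite !in_itv/=.
    by rewrite ltr_pdivrMr// ler_pdivlMr// ltrBlDr lerBrDr mulrC.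
  by rewrite ltr_pdivrMr// ler_pdivlMr// ltrBlDr lerBrDr mulrC.
rewrite !lebesgue_measure_itv/= !lte_fin ltr_pM2r ?invr_gt0// ltrD2r.
case: ifPn => // _; last by rewrite mule0.
by rewrite -!EFinD -EFinM; congr EFin; field; rewrite lt0r_neq0.
Qed.

Lemma lebesgue_opp : scales mu (fun x : mR => - x : mR) 1.
Proof.
split=> //; first exact: oppr_measurable.
by move=> A mA; rewrite mul1e; exact: (lebesgue_measureN mA).
Qed.

Implicit Types phi : plane R -> plane R.

Lemma scales_rect phi (k : R) : measurable_fun setT phi -> 0 < k ->
  (forall A B : set mR, measurable A -> measurable B ->
    leb2 (phi @^-1` (A `*` B)) = (k^-1%:E * (mu A * mu B))%E) ->
  scales leb2 phi k^-1.
Proof.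
move=> mphi k0 h.
apply: (@scalesI _ _ leb2 _ k mphi (ltW k0)) => // X mX.
apply: product_measure_unique mX => A B mA mB.
rewrite [RHS](_ : _ = k%:E * leb2 (phi @^-1` (A `*` B)))%E// h// muleA -EFinM divff ?mul1e//.
exact: lt0r_neq0.
Qed.

Lemma plane_affine (a : R) (b : plane R) : 0 < a ->
  scales leb2 (fun x : plane R => (a * x.1 + b.1, a * x.2 + b.2) : plane R) (a ^+ 2)^-1.
Proof.
move=> a0.
have [m1 _ h1] := lebesgue_affine b.1 a0; have [m2 _ h2] := lebesgue_affine b.2 a0.
apply: scales_rect; last 2 first.
- exact: exprn_gt0.
- move=> A B mA mB.
  have -> : (fun x : plane R => (a * x.1 + b.1, a * x.2 + b.2) : plane R) @^-1` (A `*` B)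
     = ((fun x : mR => a * x + b.1 : mR) @^-1` A) `*` ((fun x : mR => a * x + b.2 : mR) @^-1` B).
    by [].
  rewrite product_measure1E; last 2 first.
  - by rewrite -(setTI (_ @^-1` _)); exact: m1.
  - by rewrite -(setTI (_ @^-1` _)); exact: m2.
  by rewrite h1// h2// muleACA -EFinM expr2 invfM.
- by apply: measurable_fun_pair;
    [apply: (measurableT_comp m1)|apply: (measurableT_comp m2)].
Qed.

Lemma plane_opp : scales leb2 (fun x : plane R => (- x.1, - x.2) : plane R) 1.
Proof.
have [m1 _ h1] := lebesgue_opp.
rewrite -[1]invr1; apply: scales_rect => //.
- by apply: measurable_fun_pair; apply: (measurableT_comp m1).
- move=> A B mA mB.
  have -> : (fun x : plane R => (- x.1, - x.2) : plane R) @^-1` (A `*` B)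
     = ((fun x : mR => - x : mR) @^-1` A) `*` ((fun x : mR => - x : mR) @^-1` B).
    by [].
  rewrite product_measure1E; last 2 first.
  - by rewrite -(setTI (_ @^-1` _)); exact: m1.
  - by rewrite -(setTI (_ @^-1` _)); exact: m1.
  by rewrite h1// h1// !mul1e invr1 mul1e.
Qed.

Lemma plane_swap : scales leb2 (fun x : plane R => (x.2, x.1) : plane R) 1.
Proof.
rewrite -[1]invr1; apply: scales_rect => //.
- exact: measurable_fun_pair.
- move=> A B mA mB.
  have -> : (fun x : plane R => (x.2, x.1) : plane R) @^-1` (A `*` B) = B `*` A.
    by apply/seteqP; split => x [].
  by rewrite product_measure1E// invr1 mul1e muleC.
Qed.

(** By Fubini: each vertical section of the preimage is a translate of the section of the set. *)
Lemma plane_shear (c : R) : scales leb2 (fun x : plane R => (x.1, x.2 + c * x.1) : plane R) 1.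
Proof.
have mphi : measurable_fun setT (fun x : plane R => (x.1, x.2 + c * x.1) : plane R).
  apply: measurable_fun_pair => //; apply: measurable_funD => //.
  exact: measurable_funM.
split => // X mX; rewrite mul1e; apply: eq_integral => x _ /=.
have [m1 _ h1] := lebesgue_affine (c * x) ltr01.
have -> : xsection ((fun x : plane R => (x.1, x.2 + c * x.1) : plane R) @^-1` X) x =
   (fun y : mR => 1 * y + c * x : mR) @^-1` (xsection X x).
  by rewrite !xsectionE; apply/seteqP; split => y /=; rewrite mul1r.
by rewrite h1 ?invr1 ?mul1e//; exact: measurable_xsection.
Qed.

(* A rotation is the product of three shears, with slopes - tan (theta / 2),
   sin theta and - tan (theta / 2), or the reflection x |-> - x. *)
Lemma plane_rot (theta : R) : scales leb2 (rmat theta) 1.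
Proof.
pose h := theta / 2.
have th : theta = h + h by rewrite /h -splitr.
have [c0|c0] := eqVneq (cos h) 0.
  have : cos h ^+ 2 + sin h ^+ 2 = 1 by exact: cos2Dsin2.
  rewrite c0 expr0n add0r expr2 => s1.
  suff -> : rmat theta = (fun x : plane R => (- x.1, - x.2) : plane R) by exact: plane_opp.
  apply/funext => x; rewrite /rmat th cosD sinD c0 s1.
  by congr pair; ring.
have sw := plane_swap.
have hs c : scales leb2 (fun x : plane R => (x.1 + c * x.2, x.2) : plane R) 1.
  have := scales_comp sw (scales_comp (plane_shear c) sw).
  by rewrite !mul1r.
(* This is tan (theta / 2). The identities [ct] and [st] below match the product of the shears to
   the rotation matrix. *)
pose t := sin h / cos h.
have c2 : cos h ^+ 2 = 1 - sin h ^+ 2 by rewrite cos2sin2.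
have ct : cos theta = 1 - t * sin theta.
  have -> : t * sin theta = 2 * sin h ^+ 2 by rewrite th sinD /t; field.
  by rewrite th cosD -!expr2 c2; ring.
have st : sin theta = 2 * t - t ^+ 2 * sin theta.
  have -> : 2 * t - t ^+ 2 * sin theta = 2 * t * (1 - sin h ^+ 2).
    by rewrite th sinD /t; field.
  by rewrite -c2 th sinD /t; field.
have := scales_comp (hs (- t)) (scales_comp (plane_shear (sin theta)) (hs (- t))).
rewrite !mul1r; congr (scales _ _ _); apply/funext => x; rewrite /rmat /= ct.
congr pair; last by ring.
rewrite [in RHS]st.
have -> : x.1 + - t * x.2 + - t * (x.2 + sin theta * (x.1 + - t * x.2)) =
   (1 - t * sin theta) * x.1 - (2 * t - t ^+ 2 * sin theta) * x.2 by ring.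
by rewrite -!st.
Qed.

End PlaneMaps.

(** * Boxes as a generating family of the plane *)

Section Boxes.
Variable R : realType.
Notation mu := (@lebesgue_measure R).
Notation mR := (measurableTypeR R).
Implicit Types a b x : plane R.

(** Half-open boxes, empty ones included, are stable under intersection, as induction on the
    generated sigma-algebra requires. *)
Definition box a b : set (plane R) := (`]a.1, b.1] `*` `]a.2, b.2])%classic.

Lemma box_measurable a b : measurable (box a b).
Proof. by apply: measurableX; exact: measurable_itv. Qed.

Lemma box_setI a b c e : box a b `&` box c e =
  box (Num.max a.1 c.1, Num.max a.2 c.2) (Num.min b.1 e.1, Num.min b.2 e.2).
Proof.
apply/seteqP; split => x; rewrite /box /= !in_itv/= !gt_max !le_min.
  by move=> [[/andP[-> ->] /andP[-> ->]] [/andP[-> ->] /andP[-> ->]]].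
by move=> [/andP[/andP[-> ->] /andP[-> ->]] /andP[/andP[-> ->] /andP[-> ->]]].
Qed.

Definition boxes : set (set (plane R)) := [set B | exists a b, B = box a b].

Lemma boxes_setI : setI_closed boxes.
Proof. by move=> _ _ [a [b ->]] [c [e ->]]; rewrite box_setI; do 2 eexists. Qed.

Lemma in_itv_nat (r : R) : exists n : nat, r \in `]- n%:R, n%:R].
Proof.
exists (Num.truncn `|r|).+1; rewrite in_itv/=.
have h : `|r| < (Num.truncn `|r|).+1%:R by exact: truncnS_gt.
by move: h; rewrite ltr_norml => /andP[-> /ltW ->].
Qed.

Definition cube (n : nat) := box (- n%:R, - n%:R) (n%:R, n%:R).

Lemma in_cube x : exists n, cube n x.
Proof.
have [n1 h1] := in_itv_nat x.1; have [n2 h2] := in_itv_nat x.2.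
exists (maxn n1 n2); move: h1 h2; rewrite /cube /box /= !in_itv/= => /andP[a1 a2] /andP[b1 b2].
have e1 : n1%:R <= (maxn n1 n2)%:R :> R by rewrite ler_nat leq_maxl.
have e2 : n2%:R <= (maxn n1 n2)%:R :> R by rewrite ler_nat leq_maxr.
by split; apply/andP; split; lra.
Qed.

Lemma measurable_boxes : (measurable : set (set (plane R))) = <<s boxes >>.
Proof.
pose TB := g_sigma_algebraType boxes.
have mbox B : boxes B -> measurable (B : set TB) by move=> h; exact: sub_sigma_algebra.
have m1 : measurable_fun setT (fst : TB -> mR).
  apply: (@measurability _ _ TB mR setT fst (@ocitv R) erefl) => _ [_ [[c e] _ <-] <-].
  rewrite setTI.
  have -> : fst @^-1` `]c, e] = \bigcup_n (box (c, - n%:R) (e, n%:R)).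
    apply/seteqP; split => [x /= xce|x [n _] []//].
    by have [n hn] := in_itv_nat x.2; exists n.
  by apply: (@bigcupT_measurable _ TB) => n; apply: mbox; do 2 eexists.
have m2 : measurable_fun setT (snd : TB -> mR).
  apply: (@measurability _ _ TB mR setT snd (@ocitv R) erefl) => _ [_ [[c e] _ <-] <-].
  rewrite setTI.
  have -> : snd @^-1` `]c, e] = \bigcup_n (box (- n%:R, c) (n%:R, e)).
    apply/seteqP; split => [x /= xce|x [n _] []//].
    by have [n hn] := in_itv_nat x.1; exists n.
  by apply: (@bigcupT_measurable _ TB) => n; apply: mbox; do 2 eexists.
apply/seteqP; split.
  rewrite measurable_prod_measurableType; apply: smallest_sub.
    exact: (@sigma_algebra_measurable _ TB).
  move=> _ [A mA [B mB <-]].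
  have -> : A `*` B = (setT `&` (fst : TB -> mR) @^-1` A) `&` (setT `&` (snd : TB -> mR) @^-1` B).
    by rewrite !setTI.
  by apply: (@measurableI _ TB); [exact: m1|exact: m2].
apply: smallest_sub; first exact: sigma_algebra_measurable.
by move=> _ [a [b ->]]; exact: box_measurable.
Qed.

(** Inside a cube, the sets over which [w] has zero integral form a Dynkin class containing the
    boxes. Integrability is asked on boxes only, which admits tempered functions. *)
Lemma ae0_of_box_integrals (w : plane R -> R) : measurable_fun setT w ->
  (forall a b, intg leb2 (fun x => w x * \1_(box a b) x)) ->
  (forall a b, \int[leb2]_x (w x * \1_(box a b) x) = 0) ->
  {ae leb2, forall x, w x = 0}.
Proof.
move=> mw iw w0.
suff h n : {ae leb2, forall x, cube n x -> w x = 0}.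
  have := ae_foralln h; apply: filterS => x hx.
  by have [n] := in_cube x; exact: hx.
pose v x := w x * \1_(cube n) x.
have iv : intg leb2 v by exact: iw.
pose P A := (\int[leb2]_(x in A) (v x)%:E = 0)%E.
have Pbox a b : P (box a b).
  rewrite /P integral_mkcond.
  rewrite (eq_integral (fun x => (w x * \1_(cube n `&` box a b) x)%:E)); last first.
    move=> x _; rewrite patchE; case: ifPn => xb.
      by rewrite /v !indicE in_setI xb andbT.
    by rewrite indicE in_setI (negbTE xb) andbF mulr0.
  rewrite box_setI.
  by rewrite EFin_Rint ?w0//; exact: iw.
have PT : P setT.
  have := Pbox (- n%:R, - n%:R) (n%:R, n%:R); rewrite /P integral_mkcond => <-.
  apply: eq_integral => x _; rewrite patchE; case: ifPn => //.
  by rewrite /v indicE => /negbTE ->; rewrite mulr0.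
have PA A : measurable A -> P A.
  move=> mA; have := mA; rewrite measurable_boxes.
  apply: (@dynkin_induction _ _ boxes P measurable_boxes boxes_setI PT).
  - by move=> _ [a [b ->]]; exact: Pbox.
  - move=> S mS PS; rewrite /P.
    have := PT; rewrite /P -(setUv S) integral_setU//.
    + by rewrite -/(P S) PS add0e.
    + exact: measurableC.
    + apply/measurable_EFinP; rewrite setUv; exact: intg_meas iv.
    + by apply/disj_setPS; rewrite setICr.
  - move=> F mF tF PF; rewrite /P integral_bigcup//.
      by rewrite eseries0// => i _ _; exact: PF.
    apply: integrableS iv => //; exact: bigcupT_measurable.
have := @integral_ae_eq _ _ _ leb2 setT measurableT (fun=> 0%E) (EFin \o v) iv.
have h0 : measurable_fun [set: plane R] (fun=> 0%E : \bar R) by exact: measurable_cst.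
move=> /(_ h0) h.
have : ae_eq leb2 setT (EFin \o v) (fun=> 0%E).
  apply: h => E _ mE; rewrite integral0; exact: PA.
by apply: filterS => x /(_ I) [] + xn; rewrite /v indicE mem_set// mulr1.
Qed.

End Boxes.

(** * The Fejer kernel and transforms of intervals *)

Section RealLineKernels.
Variable R : realType.
Notation mu := (@lebesgue_measure R).
Notation mR := (measurableTypeR R).
Implicit Types a b c e k t x : R.

(** A pointwise limit of continuous functions; the approximants vanish at 0, in agreement with the
    convention that the inverse of 0 is 0. *)
Lemma measurable_invr : measurable_fun setT (GRing.inv : R -> R).
Proof.
apply: (@measurable_fun_cvg _ _ _ _ (fun n x => x * (x ^+ 2 + n.+1%:R^-1)^-1)).
  move=> n; apply: continuous_measurable_fun => x.
  apply: cvgM => //; apply: cvgV; last first.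
    by apply: cvgD; [exact: exprn_continuous|exact: cvg_cst].
  by rewrite lt0r_neq0// ltr_wpDl ?sqr_ge0// invr_gt0 ltr0n.
move=> x _; have [->|x0] := eqVneq x 0.
  by rewrite invr0; under eq_fun do rewrite mul0r; exact: cvg_cst.
have -> : x^-1 = x * (x ^+ 2 + 0)^-1 by field.
apply: cvgM; first exact: cvg_cst.
apply: cvgV; first by rewrite addr0 sqrf_eq0.
by apply: cvgD; [exact: cvg_cst|exact: cvg_harmonic].
Qed.

Lemma measurable_sin : measurable_fun setT (@sin R).
Proof. by apply: continuous_measurable_fun; exact: continuous_sin. Qed.

Lemma measurable_cos : measurable_fun setT (@cos R).
Proof. by apply: continuous_measurable_fun; exact: continuous_cos. Qed.

Lemma abs_sin_le x : `|sin x| <= `|x|.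
Proof.
wlog x0 : x / 0 <= x => [h|].
  have [/h//|/ltW x0] := leP 0 x.
  by rewrite -normrN -sinN -(normrN x) h// oppr_ge0.
have cs : {within `[0, x], continuous (@sin R)}.
  by apply: continuous_subspaceT => y; exact: continuous_sin.
have [z _] := MVT_segment x0 (fun y _ => is_derive_sin y) cs.
rewrite sin0 !subr0 => ->; rewrite normrM ler_piMl//.
by rewrite ler_norml cos_geN1 cos_le1.
Qed.

Lemma one_sub_cos k : 1 - cos k = 2 * sin (k / 2) ^+ 2.
Proof.
have {1}-> : k = k / 2 + k / 2 by rewrite -splitr.
by rewrite cosD -!expr2 cos2sin2; ring.
Qed.

Lemma FTC_oc (F f : R -> R) a b : a <= b -> (forall x, is_derive x 1 F (f x)) ->
  continuous f ->
  \int[mu]_x (f x * \1_(`]a, b]) x) = F b - F a.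
Proof.
move=> ab dF cf.
have -> : \int[mu]_x (f x * \1_(`]a, b]) x) = \int[mu]_(x in `]a, b]) f x.
  rewrite [RHS]Rintegral_mkcond; apply: eq_Rintegral => x _.
  by rewrite patchE indicE; case: ifPn => _; rewrite ?mulr1 ?mulr0.
have cF : continuous F.
  by move=> x; apply: differentiable_continuous; apply/derivable1_diffP/ex_derive.
move: ab; rewrite le_eqVlt => /predU1P[<-|ab].
  by rewrite set_itvoc0 Rintegral_set0 subrr.
rewrite Rintegral_itv_obnd_cbnd; last first.
  have iab : mu.-integrable `[a, b] (EFin \o f).
    apply: continuous_compact_integrable; first exact: segment_compact.
    exact: continuous_subspaceT.
  apply: integrableS iab => //.
  by apply: subset_itvr; rewrite bnd_simp.
rewrite /Rintegral (@continuous_FTC2 _ _ F)//.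
- exact: continuous_subspaceT.
- split.
  + by move=> x _; exact: ex_derive.
  + by apply: cvg_at_right_filter; exact: cF.
  + by apply: cvg_at_left_filter; exact: cF.
- by move=> x _; rewrite derive1E; exact: derive_val.
Qed.

(** Equal to [2 * (sin (pi * x * t) / (2 * pi * x)) ^+ 2], a Fejer kernel in [x] up to
    normalisation. *)
Definition fejer t x := (1 - cos (2 * pi * x * t)) / (2 * pi * x) ^+ 2.
(** For [a <= b], this and [sinbox] are the cosine and sine transforms of the indicator of []a, b]]
    at a frequency [x != 0]; at [x = 0] the division convention gives 0. *)
Definition cosbox a b x := (sin (2 * pi * x * b) - sin (2 * pi * x * a)) / (2 * pi * x).
Definition sinbox a b x := (cos (2 * pi * x * a) - cos (2 * pi * x * b)) / (2 * pi * x).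

Lemma twopi_gt0 : 0 < 2 * pi :> R. Proof. by rewrite mulr_gt0// pi_gt0. Qed.

Lemma is_derive_scaled (g dg : R -> R) k c t : (forall y : R, is_derive y 1 g (dg y)) ->
  is_derive t 1 (fun s => c * g (k * s)) (c * (dg (k * t) * k)).
Proof.
move=> dg_; have h1 : is_derive t 1 (fun s : R => k * s) k.
  have := is_deriveZ k (is_derive_id t (1 : R)).
  by rewrite /GRing.scale/= mulr1.
exact: (is_deriveZ c (is_derive1_comp (dg_ (k * t)) h1)).
Qed.

Let cont_cos_scaled k : continuous (fun t => cos (k * t)).
Proof.
move=> t; apply: (continuous_comp (f := fun t => k * t)); last exact: continuous_cos.
by apply: cvgM; [exact: cvg_cst|exact: cvg_id].
Qed.

Let cont_sin_scaled k : continuous (fun t => sin (k * t)).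
Proof.
move=> t; apply: (continuous_comp (f := fun t => k * t)); last exact: continuous_sin.
by apply: cvgM; [exact: cvg_cst|exact: cvg_id].
Qed.

Lemma integral_cos_box a b x : a <= b -> x != 0 ->
  \int[mu]_t (cos (2 * pi * x * t) * \1_(`]a, b]) t) = cosbox a b x.
Proof.
move=> ab x0; have p0 := lt0r_neq0 twopi_gt0.
set k := 2 * pi * x.
have k0 : k != 0 by rewrite mulf_neq0.
have dF t : is_derive t 1 (fun s => k^-1 * sin (k * s)) (cos (k * t)).
  have h := is_derive_scaled k k^-1 t (@is_derive_sin R).
  apply: (is_derive_eq h).
  by rewrite mulrCA mulVf// mulr1.
rewrite (FTC_oc ab dF); last exact: cont_cos_scaled.
by rewrite /cosbox -/k mulrC (mulrC _ (sin (k * a))) -mulrBl.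
Qed.

Lemma integral_sin_box a b x : a <= b -> x != 0 ->
  \int[mu]_t (sin (2 * pi * x * t) * \1_(`]a, b]) t) = sinbox a b x.
Proof.
move=> ab x0; have p0 := lt0r_neq0 twopi_gt0.
set k := 2 * pi * x.
have k0 : k != 0 by rewrite mulf_neq0.
have dF t : is_derive t 1 (fun s => - k^-1 * cos (k * s)) (sin (k * t)).
  have h := is_derive_scaled k (- k^-1) t (@is_derive_cos R).
  apply: (is_derive_eq h).
  by field.
rewrite (FTC_oc ab dF); last exact: cont_sin_scaled.
by rewrite /sinbox -/k mulrC (mulrC _ (cos (k * a))) -mulrBl mulrN -mulNr opprB.
Qed.

(** Expanding cosines of differences leaves four terms; the constants 1 that turn them into Fejer
    kernels cancel in the signed sum, and each kernel is integrable on its own. *)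
Lemma fejerE a b c e x : cosbox a b x * cosbox c e x + sinbox a b x * sinbox c e x =
  fejer (b - c) x + fejer (a - e) x - fejer (b - e) x - fejer (a - c) x.
Proof.
rewrite /cosbox /sinbox /fejer -!exprVn !mulrBr !cosB; ring.
Qed.

Let measurable_scaled k : measurable_fun setT (fun x : R => 2 * pi * x * k).
Proof. by apply: measurable_funM => //; exact: measurable_funM. Qed.

Let measurable_den : measurable_fun setT (fun x : R => (2 * pi * x)^-1).
Proof. by apply: (measurableT_comp measurable_invr); exact: measurable_funM. Qed.

Lemma measurable_cosbox a b : measurable_fun setT (cosbox a b).
Proof.
by apply: measurable_funM => //; apply: measurable_funB;
  exact: (measurableT_comp measurable_sin).
Qed.

Lemma measurable_sinbox a b : measurable_fun setT (sinbox a b).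
Proof.
by apply: measurable_funM => //; apply: measurable_funB;
  exact: (measurableT_comp measurable_cos).
Qed.

Lemma measurable_fejer t : measurable_fun setT (fejer t).
Proof.
apply: measurable_funM.
  by apply: measurable_funB => //; exact: (measurableT_comp measurable_cos).
apply: (measurableT_comp measurable_invr); apply: measurable_funX.
exact: measurable_funM.
Qed.

Lemma fejer_ge0 t x : 0 <= fejer t x.
Proof. by rewrite mulr_ge0// ?invr_ge0 ?sqr_ge0// subr_ge0 cos_le1. Qed.

Lemma intg_oneDsqr : intg mu (fun x => (oneDsqr x)^-1).
Proof.
have mo : measurable_fun [set: R] (fun x => (oneDsqr x)^-1).
  by apply: continuous_measurable_fun; exact: continuous_oneDsqrV.
apply/integrableP; split; first exact/measurable_EFinP.
have o0 x : 0 <= (oneDsqr x)^-1 by rewrite invr_ge0.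
under eq_integral => x _ do rewrite gee0_abs ?lee_fin//.
rewrite ge0_symfun_integralT//=.
- rewrite (_ : [set x | _] = `[0, +oo[%classic); last first.
    by apply/seteqP; split => x/=; rewrite in_itv/= andbT.
  by rewrite integral0y_oneDsqr -EFinM ltry.
- exact: continuous_oneDsqrV.
- by move=> x /=; rewrite /oneDsqr sqrrN.
Qed.

(** Combines [1 - cos k <= k ^+ 2 / 2], sharp near 0, with [1 - cos k <= 2], which serves at
    infinity; [pi >= 2] makes [k ^+ 2] at least [16 * x ^+ 2]. *)
Lemma fejer1_le x : fejer 1 x <= (oneDsqr x)^-1.
Proof.
have [->|x0] := eqVneq x 0.
  by rewrite /fejer !mulr0 mul0r cos0 subrr mul0r invr_ge0.
have d0 : 0 < oneDsqr x by rewrite (lt_le_trans ltr01)// oneDsqr_ge1.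
have p2 : 2 <= pi :> R by exact: pi_ge2.
set k := 2 * pi * x.
have k2 : 16 * x ^+ 2 <= k ^+ 2.
  rewrite /k exprMn ler_wpM2r ?sqr_ge0//; nra.
have x2 : 0 < x ^+ 2 by rewrite exprn_even_gt0.
have k2p : 0 < k ^+ 2 by lra.
rewrite /fejer mulr1 -/k ler_pdivrMr// mulrC ler_pdivlMr// /oneDsqr mulrDr mulr1.
have h1 : 1 - cos k <= k ^+ 2 / 2.
  rewrite one_sub_cos.
  have := abs_sin_le (k / 2); rewrite -ler_sqr ?nnegrE// !real_normK ?num_real//.
  by rewrite exprMn => h; lra.
have h2 : 1 - cos k <= 2 by have := cos_geN1 k; lra.
nra.
Qed.

Lemma intg_fejer1 : intg mu (fejer 1).
Proof.
apply: intg_le intg_oneDsqr _; first exact: measurable_fejer.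
by move=> x; rewrite ger0_norm ?fejer_ge0// fejer1_le.
Qed.

Definition fejer_mass := \int[mu]_x fejer 1 x.

Lemma fejerN t : fejer (- t) = fejer t.
Proof. by apply/funext => x; rewrite /fejer mulrN cosN. Qed.

Lemma fejer_abs t : fejer t = fejer `|t|.
Proof. by have [t0|t0] := leP 0 t; [rewrite ger0_norm|rewrite ltr0_norm// fejerN]. Qed.

Lemma fejer_scale t x : t != 0 -> fejer t x = t ^+ 2 * fejer 1 (t * x + 0).
Proof.
move=> t0; rewrite /fejer addr0 mulr1.
have -> : 2 * pi * (t * x) = 2 * pi * x * t by ring.
rewrite (exprMn _ (2 * pi * x) t) (invfM ((2 * pi * x) ^+ 2)).
transitivity ((t ^+ 2 / t ^+ 2) * ((1 - cos (2 * pi * x * t)) / (2 * pi * x) ^+ 2)).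
  by rewrite divff ?expf_neq0// mul1r.
by ring.
Qed.

(** [fejer] is even in [t], and for [t > 0] the substitution [x |-> t * x] turns the factor [t ^+ 2]
    of [fejer_scale] into [t]. *)
Lemma fejer_integral t : intg mu (fejer t) /\ \int[mu]_x fejer t x = `|t| * fejer_mass.
Proof.
rewrite fejer_abs; have := normr_ge0 t; move: `|t| => {}t.
rewrite le_eqVlt => /predU1P[<-|t0].
  have -> : fejer 0 = fun=> 0.
    by apply/funext => x; rewrite /fejer mulr0 cos0 subrr mul0r.
  by rewrite mul0r Rintegral_cst// mul0r; split => //; exact: integrable0.
have t0' := lt0r_neq0 t0.
have sc := lebesgue_affine (0 : R) t0.
have -> : fejer t = t ^+ 2 *: (fun x => fejer 1 (t * x + 0)).
  by apply/funext => x; exact: fejer_scale.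
have i1 := scales_intg sc intg_fejer1.
split; first exact: intgZ.
rewrite (RintZ _ i1) (scales_Rint sc intg_fejer1) mulrA; congr (_ * _); field.
done.
Qed.

(** Were the mass zero, [fejer 1] would vanish almost everywhere, yet it is positive on []0, 1[],
    where [sin (pi * x)] is. *)
Lemma fejer_mass_gt0 : 0 < fejer_mass.
Proof.
have f0 : 0 <= fejer_mass by apply: Rintegral_ge0 => x _; exact: fejer_ge0.
rewrite lt_neqAle f0 andbT eq_sym; apply/negP => /eqP m0.
have mf : measurable_fun setT (EFin \o fejer 1) by apply/measurable_EFinP; exact: measurable_fejer.
have : (\int[mu]_x `|(fejer 1 x)%:E| = 0)%E.
  under eq_integral => x _ do rewrite gee0_abs ?lee_fin ?fejer_ge0//.
  by rewrite (EFin_Rint intg_fejer1) -/fejer_mass m0.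
move/(ae_eq_integral_abs mu measurableT mf).1 => [N [mN N0 hN]].
have : (mu `]0%R, 1%R[ <= mu N)%E.
  apply: le_measure; rewrite ?inE//.
  move=> x /=; rewrite in_itv/= => /andP[x0 x1]; apply: hN => /= /(_ I) [] /eqP.
  rewrite /fejer mulf_eq0 invr_eq0 sqrf_eq0 one_sub_cos.
  have k0 : 0 < 2 * pi * x by rewrite mulr_gt0// twopi_gt0.
  rewrite (gt_eqF k0) orbF mulf_eq0 pnatr_eq0/= sqrf_eq0 => /eqP s0.
  have : 0 < sin (2 * pi * x / 2).
    have -> : 2 * pi * x / 2 = pi * x by field.
    by rewrite sin_gt0_pi// mulr_gt0 ?pi_gt0//= -[ltRHS]mulr1 ltr_pM2l// pi_gt0.
  by rewrite mulr1 in s0 *; rewrite s0 ltxx.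
by rewrite N0 lebesgue_measure_itv/= lte_fin ltr01 lee_fin oppr0 addr0 ler10.
Qed.

Lemma L2_cosbox a b : L2 mu (cosbox a b).
Proof.
split; first exact: measurable_cosbox.
have iv := intgZ 2 (fejer_integral (b - a)).1.
apply: intg_le iv _; first by apply: measurable_funX; exact: measurable_cosbox.
move=> x; rewrite ger0_norm ?sqr_ge0//.
have := fejerE a b a b x; rewrite -(opprB b a) fejerN !subrr.
have -> : fejer 0 x = 0 by rewrite /fejer mulr0 cos0 subrr mul0r.
have := sqr_ge0 (sinbox a b x); rewrite fctE /GRing.scale/=; lra.
Qed.

Lemma L2_sinbox a b : L2 mu (sinbox a b).
Proof.
split; first exact: measurable_sinbox.
have iv := intgZ 2 (fejer_integral (b - a)).1.
apply: intg_le iv _; first by apply: measurable_funX; exact: measurable_sinbox.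
move=> x; rewrite ger0_norm ?sqr_ge0//.
have := fejerE a b a b x; rewrite -(opprB b a) fejerN !subrr.
have -> : fejer 0 x = 0 by rewrite /fejer mulr0 cos0 subrr mul0r.
have := sqr_ge0 (cosbox a b x); rewrite fctE /GRing.scale/=; lra.
Qed.

(** [cosbox] is even and [sinbox] is odd in the frequency. *)
Lemma ip_cosbox_sinbox a b c e : ip mu (cosbox a b) (sinbox c e) = 0.
Proof.
have h := scales_Rint (lebesgue_opp R) (L2_mul (L2_cosbox a b) (L2_sinbox c e)).
have : \int[mu]_x (cosbox a b (- x) * sinbox c e (- x)) = - ip mu (cosbox a b) (sinbox c e).
  rewrite /ip -[RHS]mulN1r -RintZ; last exact: (L2_mul (L2_cosbox _ _) (L2_sinbox _ _)).
  apply: eq_Rintegral => x _; rewrite /cosbox /sinbox.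
  rewrite !(mulrN, mulNr) !sinN !cosN invrN; ring.
rewrite h mul1r -/(ip _ _ _); lra.
Qed.

(** A mixed second difference of the absolute value measures the overlap of []a, b]] and []c, e]].
    It turns the Fejer masses of [fejerE] into the inner product of two indicators. *)
Lemma overlap_length a b c e : a <= b -> c <= e ->
  `|b - c| + `|a - e| - `|b - e| - `|a - c| =
  2 * Num.max 0 (Num.min b e - Num.max a c).
Proof.
have norm_max (r : R) : `|r| = Num.max r (- r).
  by have [r0|r0] := leP 0 r; [rewrite ger0_norm// max_l|rewrite ltr0_norm// max_r]; lra.
move=> ab ce; have [be|be] := leP b e; have [ac|ac] := leP a c.
- rewrite (ler0_norm (_ : b - e <= 0)) 1?(ler0_norm (_ : a - c <= 0)) 1?(ler0_norm (_ : a - e <= 0)); try lra.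
  by rewrite norm_max; have [] := leP 0 (b - c); have [] := leP (b - c) (- (b - c)); lra.
- rewrite (ler0_norm (_ : b - e <= 0)) 1?(ger0_norm (_ : 0 <= a - c)) 1?(ger0_norm (_ : 0 <= b - c)) 1?(ler0_norm (_ : a - e <= 0)); try lra.
  by have [] := leP 0 (b - a); lra.
- rewrite (ger0_norm (_ : 0 <= b - e)) 1?(ler0_norm (_ : a - c <= 0)) 1?(ger0_norm (_ : 0 <= b - c)) 1?(ler0_norm (_ : a - e <= 0)); try lra.
  by have [] := leP 0 (e - c); lra.
- rewrite (ger0_norm (_ : 0 <= b - e)) 1?(ger0_norm (_ : 0 <= a - c)) 1?(ger0_norm (_ : 0 <= b - c)); try lra.
  by rewrite norm_max; have [] := leP 0 (e - a); have [] := leP (a - e) (- (a - e)); lra.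
Qed.

Lemma ip_cosboxD a b c e : a <= b -> c <= e ->
  ip mu (cosbox a b) (cosbox c e) + ip mu (sinbox a b) (sinbox c e) =
  2 * fejer_mass * Num.max 0 (Num.min b e - Num.max a c).
Proof.
move=> ab ce.
have i1 := L2_mul (L2_cosbox a b) (L2_cosbox c e).
have i2 := L2_mul (L2_sinbox a b) (L2_sinbox c e).
rewrite /ip -(RintD i1 i2).
under eq_Rintegral do rewrite fejerE.
have [f1 e1] := fejer_integral (b - c); have [f2 e2] := fejer_integral (a - e).
have [f3 e3] := fejer_integral (b - e); have [f4 e4] := fejer_integral (a - c).
rewrite (RintB (intgB (intgD f1 f2) f3) f4) (RintB (intgD f1 f2) f3) (RintD f1 f2).
rewrite e1 e2 e3 e4 -mulrDl -!mulrBl [RHS]mulrAC; congr (_ * _).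
exact: overlap_length.
Qed.

End RealLineKernels.

(** * Tensor products of integrable functions *)

Section Tensor.
Context d1 d2 (T1 : measurableType d1) (T2 : measurableType d2) (R : realType).
Variables (m1 : {sigma_finite_measure set T1 -> \bar R})
  (m2 : {sigma_finite_measure set T2 -> \bar R}).
Implicit Types (p : T1 -> R) (q : T2 -> R).

Lemma intg_tensor p q : intg m1 p -> intg m2 q ->
  intg (m1 \x m2)%E (fun x => p x.1 * q x.2).
Proof.
move=> ip_ iq; have mp := intg_meas ip_; have mq := intg_meas iq.
have mpq : measurable_fun setT (fun x : T1 * T2 => (p x.1 * q x.2)%:E).
  by apply/measurable_EFinP; apply: measurable_funM; apply: measurableT_comp.
apply/(integrable12ltyP m1 m2 mpq).
have mp' : measurable_fun setT (fun x => `|(p x)%:E|%E).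
  by apply: measurableT_comp => //; exact/measurable_EFinP.
have mq' : measurable_fun setT (fun x => `|(q x)%:E|%E).
  by apply: measurableT_comp => //; exact/measurable_EFinP.
have -> : (\int[m1]_x \int[m2]_y `|(p (x, y).1 * q (x, y).2)%:E| =
    \int[m1]_x (`|(p x)%:E| * \int[m2]_y `|(q y)%:E|))%E.
  apply: eq_integral => x _; rewrite -ge0_integralZl//.
  by apply: eq_integral => y _; rewrite EFinM abseM.
have /integrableP[_ fp] := ip_; have /integrableP[_ fq] := iq.
rewrite ge0_integralZr//; last exact: integral_ge0.
rewrite lte_mul_pinfty//; first exact: integral_ge0.
by rewrite ge0_fin_numE// integral_ge0.
Qed.

Lemma Rint_tensor p q : intg m1 p -> intg m2 q ->
  \int[(m1 \x m2)%E]_x (p x.1 * q x.2) = \int[m1]_x p x * \int[m2]_y q y.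
Proof.
move=> ip_ iq; have ipq := intg_tensor ip_ iq.
rewrite {1}/Rintegral -(integral12_prod_meas1 ipq) /fubini_F/=.
have -> : (\int[m1]_x \int[m2]_y (p x * q y)%:E =
   \int[m1]_x (\int[m2]_y q y * p x)%:E)%E.
  apply: eq_integral => x _.
  by rewrite (EFin_Rint (intgZ (p x) iq)) RintZ// mulrC.
by rewrite (EFin_Rint (intgZ _ ip_)) /= RintZ// mulrC.
Qed.

Lemma L2_tensor p q : L2 m1 p -> L2 m2 q -> L2 (m1 \x m2)%E (fun x => p x.1 * q x.2).
Proof.
move=> [mp ip_] [mq iq]; split.
  by apply: measurable_funM; apply: measurableT_comp.
have := intg_tensor ip_ iq; apply: eq_integrable => // x _ /=.
by rewrite exprMn.
Qed.

Lemma ip_tensor p p' q q' : L2 m1 p -> L2 m1 p' -> L2 m2 q -> L2 m2 q' ->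
  ip (m1 \x m2)%E (fun x => p x.1 * q x.2) (fun x => p' x.1 * q' x.2) =
  ip m1 p p' * ip m2 q q'.
Proof.
move=> Lp Lp' Lq Lq'.
rewrite /ip -(Rint_tensor (L2_mul Lp Lp') (L2_mul Lq Lq')).
by apply: eq_Rintegral => x _; rewrite mulrACA.
Qed.

End Tensor.

(* The library's product measure has no canonical sigma-finite structure usable
   on [leb2] (its key is taken by the sub-probability instance), so the Fubini
   lemmas over pairs of points of the plane go through this alias. *)
Definition plane_measure (R : realType) : set (plane R) -> \bar R := leb2.

Section PlaneMeasure.
Variable R : realType.

HB.instance Definition _ := Measure.on (@plane_measure R).

Lemma itv_lty (r s : R) : (@lebesgue_measure R (`]r, s]%classic) < +oo)%E.
Proof. by rewrite lebesgue_measure_itv/=; case: ifPn; rewrite ?ltry. Qed.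

Lemma plane_measure_sigma_finite : sigma_finite setT (@plane_measure R).
Proof.
exists (@cube R).
  by apply/esym/seteqP; split => // x _; have [n hn] := in_cube x; exists n.
move=> n; split; first exact: box_measurable.
have : ((@lebesgue_measure R \x @lebesgue_measure R) (cube n) < +oo)%E.
  rewrite product_measure1E//.
  by rewrite lte_mul_pinfty// ?ge0_fin_numE//; exact: itv_lty.
by [].
Qed.

HB.instance Definition _ :=
  Measure_isSigmaFinite.Build _ _ _ (@plane_measure R) plane_measure_sigma_finite.

End PlaneMeasure.

(** * Hartley transforms of boxes *)

Section BoxKernel.
Variable R : realType.
Notation mu := (@lebesgue_measure R).
Notation mR := (measurableTypeR R).
Implicit Types (a b c e x f : plane R) (u v w : plane R -> R).

Definition cas (t : R) : R := cos t + sin t.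
Definition hartley_int w f := \int[leb2]_x (w x * cas (2 * pi * dot2 f x)).

Definition tens (p q : R -> R) : plane R -> R := fun x => p x.1 * q x.2.
(* The value of the Hartley transform of a box off the coordinate axes, where
   division by zero does not occur. *)
Definition hbox a b : plane R -> R :=
  tens (cosbox a.1 b.1) (cosbox a.2 b.2) - tens (sinbox a.1 b.1) (sinbox a.2 b.2)
  + tens (sinbox a.1 b.1) (cosbox a.2 b.2) + tens (cosbox a.1 b.1) (sinbox a.2 b.2).

Lemma L2_tens p q : L2 mu p -> L2 mu q -> L2 leb2 (tens p q).
Proof. by move=> Lp Lq; exact: (L2_tensor Lp Lq). Qed.

Lemma ip_tens p p' q q' : L2 mu p -> L2 mu p' -> L2 mu q -> L2 mu q' ->
  ip leb2 (tens p q) (tens p' q') = ip mu p p' * ip mu q q'.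
Proof. by move=> Lp Lp' Lq Lq'; exact: (ip_tensor Lp Lp' Lq Lq'). Qed.

Let LC := @L2_cosbox R.
Let LS := @L2_sinbox R.

Lemma L2_hbox a b : L2 leb2 (hbox a b).
Proof.
by apply: L2D; [apply: L2D; [apply: L2B|]|]; apply: L2_tens.
Qed.

Let ip_sc (a b c e : R) : ip mu (sinbox a b) (cosbox c e) = 0.
Proof. by rewrite ip_sym ip_cosbox_sinbox. Qed.

(** One factor [2 * fejer_mass R] for each coordinate, as produced by [ip_cosboxD]. *)
Definition hartley_mass : R := (2 * fejer_mass R) ^+ 2.

Lemma hartley_mass_gt0 : 0 < hartley_mass.
Proof. by rewrite exprn_gt0// mulr_gt0// fejer_mass_gt0. Qed.

Definition box_le a b := a.1 <= b.1 /\ a.2 <= b.2.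

Lemma box_indicE a b : \1_(box a b) = tens (\1_(`]a.1, b.1]%classic)) (\1_(`]a.2, b.2]%classic)).
Proof.
apply/funext => x; rewrite /tens !indicE -natrM mulnb; congr (nat_of_bool _)%:R.
by apply/idP/andP; rewrite !inE.
Qed.

Lemma intg_itv (r s : R) : intg mu (\1_(`]r, s]%classic)).
Proof. exact: integrable_indic_itv. Qed.

Lemma intg_box a b : intg leb2 (\1_(box a b) : plane R -> R).
Proof.
by rewrite box_indicE; exact: (intg_tensor (intg_itv _ _) (intg_itv _ _)).
Qed.

Lemma L2_box a b : L2 leb2 (\1_(box a b) : plane R -> R).
Proof.
have h := intg_box a b; split; first exact: intg_meas h.
by apply: eq_integrable h => // x _ /=; rewrite indicE; case: (_ \in _); rewrite ?expr1n ?expr0n.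
Qed.

Lemma L2_itv (r s : R) : L2 mu (\1_(`]r, s]%classic)).
Proof.
have h := intg_itv r s; split; first exact: intg_meas h.
by apply: eq_integrable h => // x _ /=; rewrite indicE; case: (_ \in _); rewrite ?expr1n ?expr0n.
Qed.

Lemma ip_itv (r s t z : R) : ip mu (\1_(`]r, s]%classic)) (\1_(`]t, z]%classic)) =
  Num.max 0 (Num.min s z - Num.max r t).
Proof.
rewrite /ip.
have -> : (fun y : mR => \1_(`]r, s]%classic) y * \1_(`]t, z]%classic) y) =
   \1_(`]Num.max r t, Num.min s z]%classic) :> (R -> R).
  apply/funext => x; rewrite !indicE -natrM mulnb; congr (nat_of_bool _)%:R.
  apply/andP/idP; rewrite !inE/= !in_itv/= gt_max le_min.
    by move=> [/andP[-> ->] /andP[-> ->]].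
  by move=> /andP[/andP[-> ->] /andP[-> ->]].
rewrite /Rintegral integral_indic// setIT.
transitivity (fine (@lebesgue_measure R [set` (`]Num.max r t, Num.min s z] : interval R)])) => //.
rewrite lebesgue_measure_itv.
rewrite /= lte_fin.
by case: ltP => h /=; [rewrite [RHS]max_r ?subr_ge0 ?(ltW h)|rewrite [RHS]max_l ?subr_le0].
Qed.

Lemma ip_box a b c e :
  ip leb2 (\1_(box a b)) (\1_(box c e)) =
  Num.max 0 (Num.min b.1 e.1 - Num.max a.1 c.1) * Num.max 0 (Num.min b.2 e.2 - Num.max a.2 c.2).
Proof. by rewrite !box_indicE ip_tens ?ip_itv//; exact: L2_itv. Qed.

(** Products mixing [cosbox] with [sinbox] in some coordinate integrate to 0; the four that survive
    factor into one sum of the form [ip_cosboxD] per coordinate. *)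
Lemma ip_hbox a b c e : box_le a b -> box_le c e ->
  ip leb2 (hbox a b) (hbox c e) = hartley_mass * ip leb2 (\1_(box a b)) (\1_(box c e)).
Proof.
move=> [ab1 ab2] [ce1 ce2]; rewrite ip_box//.
rewrite /hbox.
have L1 := L2_tens (LC a.1 b.1) (LC a.2 b.2); have L2_ := L2_tens (LS a.1 b.1) (LS a.2 b.2).
have L3 := L2_tens (LS a.1 b.1) (LC a.2 b.2); have L4 := L2_tens (LC a.1 b.1) (LS a.2 b.2).
have K1 := L2_tens (LC c.1 e.1) (LC c.2 e.2); have K2 := L2_tens (LS c.1 e.1) (LS c.2 e.2).
have K3 := L2_tens (LS c.1 e.1) (LC c.2 e.2); have K4 := L2_tens (LC c.1 e.1) (LS c.2 e.2).
have L12 := L2B L1 L2_; have L123 := L2D L12 L3.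
have K12 := L2B K1 K2; have K123 := L2D K12 K3; have K1234 := L2D K123 K4.
rewrite (ipDl L123 L4 K1234) (ipDl L12 L3 K1234) (ipBl L1 L2_ K1234).
rewrite !(ipDr K123 K4) // !(ipDr K12 K3)// !(ipBr K1 K2)//.
rewrite !ip_tens// !ip_cosbox_sinbox !ip_sc.
have := ip_cosboxD ab1 ce1; have := ip_cosboxD ab2 ce2.
rewrite /hartley_mass; set m1 := Num.max 0 _; set m2 := Num.max 0 _ => h2 h1.
have -> : (2 * fejer_mass R) ^+ 2 * (m2 * m1) = (2 * fejer_mass R * m2) * (2 * fejer_mass R * m1) by ring.
rewrite -h1 -h2; ring.
Qed.

Lemma dot2C x f : dot2 x f = dot2 f x.
Proof. by rewrite /dot2 mulrC (mulrC x.2). Qed.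

Lemma cas_le2 (t : R) : `|cas t| <= 2.
Proof.
rewrite /cas (le_trans (ler_normD _ _))//.
have h1 : `|cos t| <= 1 by rewrite ler_norml cos_geN1 cos_le1.
by have := sin_max t; lra.
Qed.

Lemma measurable_cas : measurable_fun setT cas.
Proof. by apply: measurable_funD; [exact: measurable_cos|exact: measurable_sin]. Qed.

Let measurable_kernel : measurable_fun setT
  (fun z : plane R * plane R => cas (2 * pi * dot2 z.1 z.2)).
Proof.
apply: (measurableT_comp measurable_cas); apply: measurable_funM => //.
by apply: measurable_funD; apply: measurable_funM;
  (apply: measurableT_comp => //; [exact: measurable_fst|exact: measurable_snd]) ||
  (apply: (measurableT_comp (measurable_fst : measurable_fun setT (fst : plane R -> mR))) => //) ||
  (apply: (measurableT_comp (measurable_snd : measurable_fun setT (snd : plane R -> mR))) => //).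
Qed.

Lemma measurable_cas_dot f : measurable_fun setT (fun x => cas (2 * pi * dot2 f x)).
Proof.
apply: (measurableT_comp measurable_cas); apply: measurable_funM => //.
by apply: measurable_funD; apply: measurable_funM.
Qed.

Lemma intg_cas w f : intg leb2 w -> intg leb2 (fun x => w x * cas (2 * pi * dot2 f x)).
Proof.
move=> iw; apply: (@intg_le _ _ _ _ _ (fun x => 2 * `|w x|)).
- by apply: measurable_funM; [exact: intg_meas iw|exact: measurable_cas_dot].
- exact: (intgZ 2 (integrable_norm iw)).
- by move=> x; rewrite normrM mulrC ler_wpM2r// cas_le2.
Qed.

(** Tonelli's theorem gives measurability of partial integrals of nonnegative functions, whence the
    split into positive and negative parts. *)
Lemma measurable_hartley_int w : measurable_fun setT w -> measurable_fun setT (hartley_int w).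
Proof.
move=> mw.
pose g (z : plane R * plane R) := (w z.2 * cas (2 * pi * dot2 z.1 z.2))%:E.
have mg : measurable_fun setT g.
  apply/measurable_EFinP; apply: measurable_funM => //.
  exact: (measurableT_comp mw).
have m1 := @measurable_fun_fubini_tonelli_F _ _ _ _ R (@plane_measure R) _
  (measurable_funepos mg) (funepos_ge0 g).
have m2 := @measurable_fun_fubini_tonelli_F _ _ _ _ R (@plane_measure R) _
  (measurable_funeneg mg) (funeneg_ge0 g).
have -> : hartley_int w = fine \o
  (fubini_F (@plane_measure R) g^\+ \- fubini_F (@plane_measure R) g^\-)%E.
  apply/funext => f; rewrite /hartley_int /Rintegral /= integralE /fubini_F.
  by congr (fine (_ - _)%E); apply: eq_integral => x _; rewrite ?funeposE ?funenegE.
apply: measurableT_comp; first exact: fine_measurable.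
exact: emeasurable_funB.
Qed.

(** Fubini for a symmetric kernel bounded by 2. *)
Lemma hartley_int_adjoint v w : intg leb2 v -> intg leb2 w ->
  \int[leb2]_x (hartley_int w x * v x) = \int[leb2]_x (w x * hartley_int v x).
Proof.
move=> iv iw.
pose P := @plane_measure R.
pose G (z : plane R * plane R) := v z.1 * w z.2 * cas (2 * pi * dot2 z.1 z.2).
have iG : intg (P \x P)%E G.
  have h := intgZ 2 (@intg_tensor _ _ _ _ _ P P _ _ (integrable_norm iv) (integrable_norm iw)).
  apply: intg_le h _.
    apply: measurable_funM => //; apply: measurable_funM.
      by apply: (measurableT_comp (intg_meas iv)).
    by apply: (measurableT_comp (intg_meas iw)).
  move=> z; rewrite /G !normrM mulrC; apply: ler_wpM2r; last exact: cas_le2.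
  exact: mulr_ge0.
have := integral12_prod_meas1 iG; rewrite -(integral21_prod_meas1 iG).
have -> : fubini_F P (EFin \o G) = EFin \o (fun x => hartley_int w x * v x).
  apply/funext => x; rewrite /fubini_F /= mulrC -(RintZ _ (intg_cas x iw)).
  rewrite -EFin_Rint; last exact: intgZ (intg_cas x iw).
  by apply: eq_integral => y _; rewrite /G /= mulrA.
have -> : fubini_G P (EFin \o G) = EFin \o (fun x => w x * hartley_int v x).
  apply/funext => x; rewrite /fubini_G /= -(RintZ _ (intg_cas x iv)).
  rewrite -EFin_Rint; last exact: intgZ (intg_cas x iv).
  by apply: eq_integral => y _; rewrite /G /= dot2C; congr EFin; ring.
by rewrite /Rintegral => ->.
Qed.

Lemma ae_coord_neq c : {ae leb2, forall x, x.1 != c.1 /\ x.2 != c.2}.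
Proof.
have s0 (r : R) : @lebesgue_measure R [set r] = 0%E by exact: lebesgue_measure_set1.
have h1 : {ae leb2, forall x, x.1 != c.1}.
  exists ([set c.1 : mR] `*` [set: mR]); split.
  - by apply: measurableX.
  - transitivity (mu [set c.1] * mu setT)%E; first exact: product_measure1E.
    by rewrite s0 mul0e.
  - by move=> x /= /negP; rewrite negbK => /eqP.
have h2 : {ae leb2, forall x, x.2 != c.2}.
  exists ([set: mR] `*` [set c.2 : mR]); split.
  - by apply: measurableX.
  - transitivity (mu setT * mu [set c.2])%E; first exact: product_measure1E.
    by rewrite s0 mule0.
  - by move=> x /= /negP; rewrite negbK => /eqP.
by apply: filterS2 h1 h2 => x.
Qed.

(** The addition formulas split the kernel into four tensor products; the coordinate axes are left
    out because the one-dimensional transforms divide by the frequency. *)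
Lemma hartley_int_box a b : box_le a b ->
  {ae leb2, forall f, hartley_int (\1_(box a b)) f = hbox a b f}.
Proof.
move=> [ab1 ab2]; apply: filterS (ae_coord_neq (0, 0)) => f [/= f1 f2].
pose I1 := \1_(`]a.1, b.1]%classic) : mR -> R.
pose I2 := \1_(`]a.2, b.2]%classic) : mR -> R.
pose c1 (y : R) := cos (2 * pi * f.1 * y) * I1 y.
pose s1 (y : R) := sin (2 * pi * f.1 * y) * I1 y.
pose c2 (y : R) := cos (2 * pi * f.2 * y) * I2 y.
pose s2 (y : R) := sin (2 * pi * f.2 * y) * I2 y.
have bnd (r i : R) : 0 <= i -> `|r| <= 1 -> `|r * i| <= i.
  by move=> i0 r1; rewrite normrM (ger0_norm i0) ler_piMl.
have ms k : measurable_fun setT (fun y : mR => 2 * pi * k * y : mR) by exact: measurable_funM.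
have ic1 : intg mu c1.
  apply: intg_le (intg_itv a.1 b.1) _.
    by apply: measurable_funM; [exact: (measurableT_comp (@measurable_cos R))|exact: measurable_indic].
  by move=> y; apply: bnd; rewrite ?indicE ?ler0n// ler_norml cos_geN1 cos_le1.
have is1 : intg mu s1.
  apply: intg_le (intg_itv a.1 b.1) _.
    by apply: measurable_funM; [exact: (measurableT_comp (@measurable_sin R))|exact: measurable_indic].
  by move=> y; apply: bnd; rewrite ?indicE ?ler0n// sin_max.
have ic2 : intg mu c2.
  apply: intg_le (intg_itv a.2 b.2) _.
    by apply: measurable_funM; [exact: (measurableT_comp (@measurable_cos R))|exact: measurable_indic].
  by move=> y; apply: bnd; rewrite ?indicE ?ler0n// ler_norml cos_geN1 cos_le1.
have is2 : intg mu s2.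
  apply: intg_le (intg_itv a.2 b.2) _.
    by apply: measurable_funM; [exact: (measurableT_comp (@measurable_sin R))|exact: measurable_indic].
  by move=> y; apply: bnd; rewrite ?indicE ?ler0n// sin_max.
rewrite /hbox !fctE /tens -(integral_cos_box ab1 f1) -(integral_cos_box ab2 f2).
rewrite -(integral_sin_box ab1 f1) -(integral_sin_box ab2 f2).
have t1 := intg_tensor ic1 ic2; have t2 := intg_tensor is1 is2.
have t3 := intg_tensor is1 ic2; have t4 := intg_tensor ic1 is2.
rewrite -(Rint_tensor ic1 ic2) -(Rint_tensor is1 is2) -(Rint_tensor is1 ic2) -(Rint_tensor ic1 is2).
rewrite -(RintB t1 t2) -(RintD (intgB t1 t2) t3) -(RintD (intgD (intgB t1 t2) t3) t4).
apply: eq_Rintegral => x _; rewrite box_indicE /tens -/I1 -/I2 !fctE /c1 /c2 /s1 /s2 /cas /dot2.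
have -> : 2 * pi * (f.1 * x.1 + f.2 * x.2) = 2 * pi * f.1 * x.1 + 2 * pi * f.2 * x.2 by ring.
rewrite cosD sinD; ring.
Qed.

End BoxKernel.

(** * Invariance under almost everywhere equality *)

Section AlmostEverywhere.
Context d (T : measurableType d) (R : realType) (mu : {measure set T -> \bar R}).
Implicit Types u v : T -> R.

Lemma ae_refl u : {ae mu, forall x, u x = u x}.
Proof. exact: nearW. Qed.

Lemma intg_ae u v : measurable_fun setT u -> intg mu v ->
  {ae mu, forall x, u x = v x} -> intg mu u.
Proof.
move=> mu_ iv uv; apply/integrableP; split; first exact/measurable_EFinP.
have /integrableP[mv fv] := iv.
rewrite (ae_eq_integral (fun x => `|(EFin \o v) x|%E))//.
- by apply: measurableT_comp => //; exact/measurable_EFinP.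
- exact: measurableT_comp.
- by apply: filterS uv => x /= -> _.
Qed.

Lemma L2_ae u v : measurable_fun setT u -> L2 mu v ->
  {ae mu, forall x, u x = v x} -> L2 mu u.
Proof.
move=> mu_ [mv iv] uv; split => //; apply: intg_ae iv _.
  exact: measurable_funX.
by apply: filterS uv => x ->.
Qed.

Lemma nrm_ae u v w : L2 mu u -> L2 mu v -> L2 mu w ->
  {ae mu, forall x, u x = v x} -> nrm mu (w - u) = nrm mu (w - v).
Proof.
move=> Lu Lv Lw uv; have L1 := L2B Lw Lu; have L2_ := L2B Lw Lv.
have h : {ae mu, forall x, (w - u) x = (w - v) x}.
  by apply: filterS uv => x; rewrite !fctE => ->.
by congr Num.sqrt; apply: eq_ae_ip.
Qed.

Lemma ip_suml (I : Type) (l : seq I) (c : I -> R) (F : I -> T -> R) v :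
  (forall i, L2 mu (F i)) -> L2 mu v ->
  L2 mu (\sum_(i <- l) c i *: F i) /\
  ip mu (\sum_(i <- l) c i *: F i) v = \sum_(i <- l) c i * ip mu (F i) v.
Proof.
move=> LF Lv; elim: l => [|i l [IH1 IH2]].
  rewrite !big_nil; split; first exact: L20.
  by rewrite -(scale0r 0) ipZl ?mul0r//; exact: L20.
rewrite !big_cons; have Li := L2Z (c i) (LF i).
by split; [exact: L2D|rewrite ipDl// ipZl// IH2].
Qed.

End AlmostEverywhere.

Lemma real_cvg_unique (R : realType) (s : nat -> R) (x y : R) :
  s n @[n --> \oo] --> x -> s n @[n --> \oo] --> y -> x = y.
Proof. by move=> /cvg_lim <-// /cvg_lim <-//; exact: Rhausdorff. Qed.

(** * The Hartley transform on L^2 *)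

Section HartleyTransform.
Variable R : realType.
Implicit Types (a b x f : plane R) (u v w U V W : plane R -> R).
Local Notation ipp := (ip leb2).

Definition boxfun (p : plane R * plane R) : plane R -> R := \1_(box p.1 p.2).
(** Taken as the integral rather than as [hbox], so that it vanishes for degenerate boxes too, where
    [hbox] need not. *)
Definition hboxfun (p : plane R * plane R) : plane R -> R := hartley_int (boxfun p).

Lemma L2_boxfun p : L2 leb2 (boxfun p). Proof. exact: L2_box. Qed.
Lemma intg_boxfun p : intg leb2 (boxfun p). Proof. exact: intg_box. Qed.

Lemma boxfun_degenerate p : ~ box_le p.1 p.2 -> boxfun p = 0 /\ hboxfun p = 0.
Proof.
move=> np; have e0 : boxfun p = 0.
  apply/funext => x; rewrite /boxfun indicE memNset// => -[] /=.
  rewrite !in_itv/= => /andP[h1 h2] /andP[h3 h4]; apply: np.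
  by split; apply: ltW; [exact: lt_le_trans h1 h2|exact: lt_le_trans h3 h4].
split => //; apply/funext => f; rewrite /hboxfun e0 /hartley_int.
under eq_Rintegral do rewrite mul0r.
by rewrite Rintegral_cst// mul0r.
Qed.

Lemma L2_hboxfun p : L2 leb2 (hboxfun p).
Proof.
have [ple|nple] := pselect (box_le p.1 p.2).
  apply: L2_ae (L2_hbox p.1 p.2) (hartley_int_box ple).
  by apply: measurable_hartley_int; exact: (L2_meas (L2_boxfun p)).
by rewrite (boxfun_degenerate nple).2; exact: L20.
Qed.

Lemma ip_hboxfun p q : ipp (hboxfun p) (hboxfun q) = hartley_mass R * ipp (boxfun p) (boxfun q).
Proof.
have ip0 u v : u = 0 \/ v = 0 -> L2 leb2 u -> L2 leb2 v -> ipp u v = 0.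
  move=> [->|->] Lu Lv; first by rewrite -(scale0r 0) ipZl ?mul0r//; exact: L20.
  by rewrite -(scale0r 0) ipZr ?mul0r//; exact: L20.
have [ple|nple] := pselect (box_le p.1 p.2); last first.
  have [e1 e2] := boxfun_degenerate nple.
  have h1 := L2_hboxfun p; have h2 := L2_hboxfun q.
  have h3 := L2_boxfun p; have h4 := L2_boxfun q.
  by rewrite !ip0 ?mulr0//; left.
have [qle|nqle] := pselect (box_le q.1 q.2); last first.
  have [e1 e2] := boxfun_degenerate nqle.
  have h1 := L2_hboxfun p; have h2 := L2_hboxfun q.
  have h3 := L2_boxfun p; have h4 := L2_boxfun q.
  by rewrite !ip0 ?mulr0//; right.
rewrite -ip_hbox//; apply: eq_ae_ip; try exact: L2_hbox; try exact: L2_hboxfun;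
  exact: hartley_int_box.
Qed.

Lemma ip_hboxfun_boxfun p q : ipp (hboxfun p) (boxfun q) = ipp (boxfun p) (hboxfun q).
Proof. exact: (hartley_int_adjoint (intg_boxfun q) (intg_boxfun p)). Qed.

(** Combinations are kept as lists, so that a step function and its transform come from the same
    data. *)
Let stype := seq (R * (plane R * plane R)).
Definition stepfun (l : stype) : plane R -> R := \sum_(p <- l) p.1 *: boxfun p.2.
Definition hstepfun (l : stype) : plane R -> R := \sum_(p <- l) p.1 *: hboxfun p.2.
Definition steplin (c : R) (l l' : stype) : stype := [seq (c * p.1, p.2) | p <- l] ++ l'.

Lemma stepfun_lin c l l' : stepfun (steplin c l l') = c *: stepfun l + stepfun l'.
Proof.
rewrite /stepfun big_cat big_map scaler_sumr /=; congr (_ + _).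
by apply: eq_bigr => p _; rewrite scalerA.
Qed.

Lemma hstepfun_lin c l l' : hstepfun (steplin c l l') = c *: hstepfun l + hstepfun l'.
Proof.
rewrite /hstepfun big_cat big_map scaler_sumr /=; congr (_ + _).
by apply: eq_bigr => p _; rewrite scalerA.
Qed.

Lemma L2_stepfun l : L2 leb2 (stepfun l).
Proof. by have [] := ip_suml l (fun p => p.1) (fun p => L2_boxfun p.2) (@L20 _ _ _ leb2). Qed.

Lemma L2_hstepfun l : L2 leb2 (hstepfun l).
Proof. by have [] := ip_suml l (fun p => p.1) (fun p => L2_hboxfun p.2) (@L20 _ _ _ leb2). Qed.

Lemma ip_stepfun l v : L2 leb2 v -> ipp (stepfun l) v = \sum_(p <- l) p.1 * ipp (boxfun p.2) v.
Proof. by move=> Lv; have [] := ip_suml l (fun p => p.1) (fun p => L2_boxfun p.2) Lv. Qed.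

Lemma ip_hstepfun l v : L2 leb2 v -> ipp (hstepfun l) v = \sum_(p <- l) p.1 * ipp (hboxfun p.2) v.
Proof. by move=> Lv; have [] := ip_suml l (fun p => p.1) (fun p => L2_hboxfun p.2) Lv. Qed.

Lemma ip_hstep_hstep l l' : ipp (hstepfun l) (hstepfun l') = hartley_mass R * ipp (stepfun l) (stepfun l').
Proof.
rewrite (ip_hstepfun _ (L2_hstepfun _)) (ip_stepfun _ (L2_stepfun _)) mulr_sumr.
apply: eq_bigr => p _; rewrite mulrCA; congr (_ * _).
rewrite ip_sym (ip_hstepfun _ (L2_hboxfun _)) ip_sym (ip_stepfun _ (L2_boxfun _)) mulr_sumr.
by apply: eq_bigr => q _; rewrite ip_hboxfun mulrCA.
Qed.

Lemma ip_hstep_box l p : ipp (hstepfun l) (boxfun p) = ipp (stepfun l) (hboxfun p).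
Proof.
rewrite (ip_hstepfun _ (L2_boxfun _)) (ip_stepfun _ (L2_hboxfun _)).
by apply: eq_bigr => q _; rewrite ip_hboxfun_boxfun.
Qed.

Lemma ae0_of_ip_box w : L2 leb2 w -> (forall p, ipp w (boxfun p) = 0) ->
  {ae leb2, forall x, w x = 0}.
Proof.
move=> Lw h; apply: ae0_of_box_integrals; first exact: (L2_meas Lw).
  by move=> a b; exact: (L2_mul Lw (L2_box a b)).
by move=> a b; exact: (h (a, b)).
Qed.

(** The part of [u] orthogonal to all step functions has zero integral over every box, hence
    vanishes almost everywhere. *)
Lemma stepfun_dense u : L2 leb2 u -> exists l, L2cvg leb2 (stepfun \o l) u.
Proof.
move=> Lu; have [||||s [p [Ms Lp sp orth]]] :=
    @L2_projection _ _ R leb2 [set stepfun l | l in [set: stype]] u.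
- by exists [::] => //; rewrite /stepfun big_nil.
- move=> c _ _ [l _ <-] [l' _ <-]; exists (steplin c l l') => //.
  exact: stepfun_lin.
- by move=> _ [l _ <-]; exact: L2_stepfun.
- by [].
have hc n : exists l, s n = stepfun l by have [l _ <-] := Ms n; exists l.
have [l hl] := choice hc.
have up : {ae leb2, forall x, u x = p x}.
  have := ae0_of_ip_box (L2B Lu Lp); case.
    move=> q; apply: orth; exists [:: (1, q)] => //.
    by rewrite /stepfun big_seq1 scale1r.
  move=> N [mN N0 hN]; exists N; split => // x /= ne; apply: hN => /= h; apply: ne.
  by apply/eqP; rewrite -subr_eq0; apply/eqP.
exists l => e e0; have [N hN] := sp _ e0; exists N => n Nn.
by rewrite /= (nrm_ae Lu Lp (L2_stepfun _) up) -hl; exact: hN.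
Qed.

(* The relation rather than a function: [U] is determined up to a null set. *)
Definition HT u U := [/\ L2 leb2 u, L2 leb2 U &
  forall p, ipp U (boxfun p) = ipp u (hboxfun p)].

Lemma HT_of_approx u U l : L2 leb2 u -> L2 leb2 U ->
  L2cvg leb2 (stepfun \o l) u -> L2cvg leb2 (hstepfun \o l) U -> HT u U.
Proof.
move=> Lu LU lu lU; split => // p.
have c1 := L2cvg_ip (fun n => L2_hstepfun (l n)) (fun=> L2_boxfun p) LU (L2_boxfun p) lU
  (L2cvg_cst (L2_boxfun p)).
have c2 := L2cvg_ip (fun n => L2_stepfun (l n)) (fun=> L2_hboxfun p) Lu (L2_hboxfun p) lu
  (L2cvg_cst (L2_hboxfun p)).
have E : (fun n => ipp ((hstepfun \o l) n) (boxfun p)) =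
    (fun n => ipp ((stepfun \o l) n) (hboxfun p)).
  by apply/funext => n; exact: ip_hstep_box.
rewrite E in c1; exact: (real_cvg_unique c1 c2).
Qed.

Lemma HT_unique u u' U U' : HT u U -> HT u' U' ->
  {ae leb2, forall x, u x = u' x} -> {ae leb2, forall x, U x = U' x}.
Proof.
move=> [Lu LU hU] [Lu' LU' hU'] uu'.
have := ae0_of_ip_box (L2B LU LU'); case.
  move=> p; rewrite (ipBl LU LU' (L2_boxfun p)) hU hU'; apply/eqP; rewrite subr_eq0; apply/eqP.
  apply: eq_ae_ip => //; try exact: L2_hboxfun.
  exact: nearW.
move=> N [mN N0 hN]; exists N; split => // x /= ne; apply: hN => /= h; apply: ne.
by apply/eqP; rewrite -subr_eq0; apply/eqP.
Qed.

Lemma HT_ae u u' U U' : HT u U -> L2 leb2 u' -> L2 leb2 U' ->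
  {ae leb2, forall x, u' x = u x} -> {ae leb2, forall x, U' x = U x} -> HT u' U'.
Proof.
move=> [Lu LU hU] Lu' LU' uu' UU'; split => // p.
have -> : ipp U' (boxfun p) = ipp U (boxfun p).
  by apply: eq_ae_ip => //; [exact: L2_boxfun|exact: L2_boxfun|exact: nearW].
rewrite hU; apply/esym/eq_ae_ip => //; try exact: L2_hboxfun.
exact: nearW.
Qed.

(** On step functions the transform multiplies norms by [Num.sqrt (hartley_mass R)], so Cauchy
    sequences go to Cauchy sequences. *)
Lemma HT_approx u : L2 leb2 u -> exists l U, [/\ L2 leb2 U,
  L2cvg leb2 (stepfun \o l) u & L2cvg leb2 (hstepfun \o l) U].
Proof.
move=> Lu; have [l lu] := stepfun_dense Lu.
have Ls n : L2 leb2 ((stepfun \o l) n) by exact: L2_stepfun.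
have Lh n : L2 leb2 ((hstepfun \o l) n) by exact: L2_hstepfun.
have [|U LU lU] := @L2_complete _ _ _ leb2 (hstepfun \o l) Lh; last by exists l, U.
have m0 := hartley_mass_gt0 R.
have sm0 : 0 < Num.sqrt (hartley_mass R) by rewrite sqrtr_gt0.
move=> e e0.
have e1 : 0 < e / Num.sqrt (hartley_mass R) by rewrite divr_gt0.
have [N hN] := L2cvg_cauchy Ls Lu lu e1.
exists N => m n Nm Nn; have := hN m n Nm Nn; rewrite ltr_pdivlMr//; apply: le_lt_trans.
have eh : hstepfun (l m) - hstepfun (l n) = hstepfun (steplin (-1) (l n) (l m)).
  by rewrite hstepfun_lin scaleN1r addrC.
have es : stepfun (l m) - stepfun (l n) = stepfun (steplin (-1) (l n) (l m)).
  by rewrite stepfun_lin scaleN1r addrC.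
by rewrite /= eh es /nrm ip_hstep_hstep (sqrtrM _ (ltW m0)) mulrC.
Qed.

Lemma HT_exists u : L2 leb2 u -> exists U, HT u U.
Proof.
move=> Lu; have [l [U [LU lu lU]]] := HT_approx Lu.
by exists U; exact: HT_of_approx lu lU.
Qed.

(** [HT] only speaks of pairings with boxes; uniqueness identifies [U] and [V] with limits of
    transformed step functions, for which the identity is [ip_hstep_hstep]. *)
Lemma HT_isometry u U v V : HT u U -> HT v V -> ipp U V = hartley_mass R * ipp u v.
Proof.
move=> HU HV; have [Lu LU _] := HU; have [Lv LV _] := HV.
have [l [U' [LU' lu lU]]] := HT_approx Lu; have [k [V' [LV' kv kV]]] := HT_approx Lv.
have e1 := HT_unique HU (HT_of_approx Lu LU' lu lU) (ae_refl _ _).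
have e2 := HT_unique HV (HT_of_approx Lv LV' kv kV) (ae_refl _ _).
rewrite (eq_ae_ip LU LU' LV LV' e1 e2).
have c1 := L2cvg_ip (fun n => L2_hstepfun (l n)) (fun n => L2_hstepfun (k n)) LU' LV' lU kV.
have c2 := L2cvg_ip (fun n => L2_stepfun (l n)) (fun n => L2_stepfun (k n)) Lu Lv lu kv.
have E : (fun n => ipp ((hstepfun \o l) n) ((hstepfun \o k) n)) =
    (fun n => hartley_mass R * ipp ((stepfun \o l) n) ((stepfun \o k) n)).
  by apply/funext => n; exact: ip_hstep_hstep.
rewrite E in c1; exact: (real_cvg_unique c1 (cvgM (cvg_cst (hartley_mass R)) c2)).
Qed.

Lemma HT_box p : HT (boxfun p) (hboxfun p).
Proof.
split; [exact: L2_boxfun|exact: L2_hboxfun|move=> q; exact: ip_hboxfun_boxfun].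
Qed.

(** The isometry taken against [HT_box] is the defining relation of the inverse: up to the constant,
    the transform is an involution. *)
Lemma HT_sym u U : HT u U -> HT U (hartley_mass R *: u).
Proof.
move=> HU; have [Lu LU _] := HU; split => //; first exact: L2Z.
move=> p; rewrite (ipZl _ Lu (L2_boxfun p)).
by rewrite (HT_isometry HU (HT_box p)).
Qed.

Lemma HTZ (c : R) u U : HT u U -> HT (c *: u) (c *: U).
Proof.
move=> [Lu LU h]; split; [exact: L2Z|exact: L2Z|move=> p].
by rewrite (ipZl _ Lu (L2_hboxfun p)) (ipZl _ LU (L2_boxfun p)) h.
Qed.

Lemma hartley_int_bounded w f : intg leb2 w ->
  `|hartley_int w f| <= 2 * \int[leb2]_x `|w x|.
Proof.
move=> iw; have iwc := intg_cas f iw; have ia := integrable_norm iw.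
apply: (le_trans (le_normr_Rintegral measurableT iwc)).
rewrite -(RintZ 2 ia); apply: Rint_le.
- exact: integrable_norm.
- exact: intgZ.
- by move=> x; rewrite normrM mulrC ler_wpM2r// cas_le2.
Qed.

(** [hartley_int w] is bounded, hence integrable on boxes, so its difference with the L^2 transform
    can be tested on boxes before it is known to lie in L^2. *)
Lemma HT_hartley_int w : intg leb2 w -> L2 leb2 w -> HT w (hartley_int w).
Proof.
move=> iw Lw; have [W HW] := HT_exists Lw; have [_ LW hW] := HW.
have mH := measurable_hartley_int (L2_meas Lw).
have iHb p : intg leb2 (fun x => hartley_int w x * boxfun p x).
  have h := intgZ (2 * \int[leb2]_x `|w x|) (intg_boxfun p).
  apply: intg_le h _; first by apply: measurable_funM => //; exact: (L2_meas (L2_boxfun p)).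
  move=> x; have b0 : 0 <= boxfun p x by rewrite /boxfun indicE ler0n.
  by rewrite normrM (ger0_norm b0) ler_wpM2r// hartley_int_bounded.
have : {ae leb2, forall x, (hartley_int w - W) x = 0}.
  apply: ae0_of_box_integrals; first by apply: measurable_funB => //; exact: (L2_meas LW).
    move=> a b.
    have := intgB (iHb (a, b)) (L2_mul LW (L2_boxfun (a, b))).
    by apply: eq_integrable => // x _ /=; rewrite -mulrBl.
  move=> a b; under eq_Rintegral do rewrite mulrBl.
  rewrite (RintB (iHb (a, b)) (L2_mul LW (L2_boxfun (a, b)))).
  rewrite (hartley_int_adjoint (intg_boxfun (a, b)) iw).
  by rewrite -/(ipp W _) hW subrr.
move=> h; have h' : {ae leb2, forall x, hartley_int w x = W x}.
  by apply: filterS h => x /eqP; rewrite subr_eq0 => /eqP.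
apply: (HT_ae HW Lw _ (ae_refl _ _) h').
exact: L2_ae LW h'.
Qed.

(** Extends the defining relation of [HT] from indicators of boxes to a class containing the
    Schwartz functions; the constant of the isometry cancels. *)
Lemma HT_adjoint u U w : HT u U -> intg leb2 w -> L2 leb2 w ->
  ipp U w = ipp u (hartley_int w).
Proof.
move=> HU iw Lw; have := HT_isometry (HT_sym HU) (HT_hartley_int iw Lw).
have Hw := HT_hartley_int iw Lw; have [_ LH _] := Hw; have [Lu LU _] := HU.
rewrite (ipZl _ Lu LH) => /mulfI-> //.
by rewrite lt0r_neq0// hartley_mass_gt0.
Qed.

End HartleyTransform.

(** * Dilations and translations under the Hartley transform *)

Section Covariance.
Variable R : realType.
Implicit Types (b x y f : plane R) (u v w U V W m : plane R -> R).
Local Notation ipp := (ip leb2).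

Lemma L2_bounded_mul m u : measurable_fun setT m -> (forall x, `|m x| <= 1) ->
  L2 leb2 u -> L2 leb2 (fun x => m x * u x).
Proof.
move=> mm m1 [mu_ iu]; split; first exact: measurable_funM.
apply: intg_le iu _; first by apply: measurable_funX; exact: measurable_funM.
move=> x; rewrite ger0_norm ?sqr_ge0// exprMn ler_piMl ?sqr_ge0//.
by rewrite -(real_normK (num_real (m x))) expr_le1.
Qed.

Lemma intg_bounded_mul m w : measurable_fun setT m -> (forall x, `|m x| <= 1) ->
  intg leb2 w -> intg leb2 (fun x => m x * w x).
Proof.
move=> mm m1 iw; apply: intg_le (integrable_norm iw) _.
  by apply: measurable_funM => //; exact: (intg_meas iw).
by move=> x; rewrite normrM ler_piMl.
Qed.

Definition dil (a : R) b x : plane R := (a * x.1 + b.1, a * x.2 + b.2).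
Definition opp2 x : plane R := (- x.1, - x.2).

Lemma scales_dil (a : R) b : 0 < a -> scales leb2 (dil a b) (a ^+ 2)^-1.
Proof. exact: plane_affine. Qed.

Lemma scales_opp2 : scales leb2 opp2 1.
Proof. exact: plane_opp. Qed.

Lemma opp2K x : opp2 (opp2 x) = x.
Proof. by case: x => s t; rewrite /opp2 /= !opprK. Qed.

Lemma Rint_opp2 u : intg leb2 u -> \int[leb2]_x u (opp2 x) = \int[leb2]_x u x.
Proof. by move=> iu; rewrite (scales_Rint scales_opp2 iu) mul1r. Qed.

Lemma casD (s t : R) : cas (s + t) = cos t * cas s + sin t * cas (- s).
Proof. by rewrite /cas cosD sinD cosN sinN; ring. Qed.

Lemma measurable_dot2 f : measurable_fun setT (dot2 f).
Proof. by apply: measurable_funD; apply: measurable_funM. Qed.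

Lemma dot2Nl x f : dot2 (opp2 x) f = - dot2 x f.
Proof. by rewrite /dot2 /opp2 /=; ring. Qed.

Lemma dot2Nr x f : dot2 x (opp2 f) = - dot2 x f.
Proof. by rewrite /dot2 /opp2 /=; ring. Qed.

Lemma hartley_int_opp w f : intg leb2 w ->
  hartley_int (fun x => w (opp2 x)) f = hartley_int w (opp2 f).
Proof.
move=> iw; rewrite /hartley_int -(Rint_opp2 (intg_cas (opp2 f) iw)).
by apply: eq_Rintegral => x _; rewrite dot2Nl dot2Nr opprK.
Qed.

Lemma hartley_int_dil (a : R) w f : 0 < a -> intg leb2 w ->
  hartley_int (fun x => w (dil a (0, 0) x)) f =
  (a ^+ 2)^-1 * hartley_int w (dil a^-1 (0, 0) f).
Proof.
move=> a0 iw; rewrite /hartley_int -(scales_Rint (scales_dil (0, 0) a0) (intg_cas _ iw)).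
apply: eq_Rintegral => x _; congr (_ * cas _); rewrite /dot2 /dil /=.
by rewrite !addr0; field; rewrite lt0r_neq0.
Qed.

(** The transform of [x |-> u ((x - b) / a)]. Since [cas (s + t)] involves [cas (- s)], translation
    mixes the values of [U] at opposite frequencies. *)
Definition phased_dil (a : R) b U f : R :=
  a ^+ 2 * (cos (2 * pi * dot2 b f) * U (dil a (0, 0) f) +
            sin (2 * pi * dot2 b f) * U (opp2 (dil a (0, 0) f))).

Let m_cos b : measurable_fun setT (fun x => cos (2 * pi * dot2 b x)).
Proof.
by apply: (measurableT_comp (@measurable_cos R)); apply: measurable_funM => //; exact: measurable_dot2.
Qed.

Let m_sin b : measurable_fun setT (fun x => sin (2 * pi * dot2 b x)).
Proof.
by apply: (measurableT_comp (@measurable_sin R)); apply: measurable_funM => //; exact: measurable_dot2.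
Qed.

Let cos_le_1 (t : R) : `|cos t| <= 1.
Proof. by rewrite ler_norml cos_geN1 cos_le1. Qed.

Lemma L2_phased_dil (a : R) b U : 0 < a -> L2 leb2 U -> L2 leb2 (phased_dil a b U).
Proof.
move=> a0 LU; have L1 := scales_L2 (scales_dil (0, 0) a0) LU.
have L2_ := scales_L2 (scales_dil (0, 0) a0) (scales_L2 scales_opp2 LU).
apply: (L2Z (a ^+ 2)); apply: L2D.
  by apply: (L2_bounded_mul (m_cos b) _ L1) => x; exact: cos_le_1.
by apply: (L2_bounded_mul (m_sin b) _ L2_) => x; exact: sin_max.
Qed.

(* With [w f = cos (2 pi b.f / a) B (f / a) - sin (2 pi b.f / a) B (- f / a)],
   the integral Hartley transform of [w] is [a^2] times that of [B] at
   [a x + b], so both sides of the adjointness relation are changes of variable. *)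
Lemma HT_dil (a : R) b u U : 0 < a -> HT u U ->
  HT (fun x => u (dil a^-1 (- b.1 / a, - b.2 / a) x)) (phased_dil a b U).
Proof.
move=> a0 HU; have [Lu LU _] := HU.
have a0' := lt0r_neq0 a0; have ai0 : 0 < a^-1 by rewrite invr_gt0.
have sa := scales_dil (0, 0) a0; have sai := scales_dil (0, 0) ai0.
have sv := scales_dil (- b.1 / a, - b.2 / a) ai0.
split; first exact: (scales_L2 sv Lu).
  exact: (L2_phased_dil b a0 LU).
move=> p.
pose B := boxfun p; have LB : L2 leb2 B := L2_boxfun p.
have iB : intg leb2 B := intg_boxfun p.
pose Ba x := B (dil a^-1 (0, 0) x).
have LBa : L2 leb2 Ba := scales_L2 sai LB.
have iBa : intg leb2 Ba := scales_intg sai iB.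
pose b' : plane R := (b.1 / a, b.2 / a).
pose C f := cos (2 * pi * dot2 b' f); pose S f := sin (2 * pi * dot2 b' f).
have LC v : L2 leb2 v -> L2 leb2 (fun f => C f * v f).
  by move=> Lv; apply: (L2_bounded_mul (m_cos b') _ Lv) => f; exact: cos_le_1.
have LS v : L2 leb2 v -> L2 leb2 (fun f => S f * v f).
  by move=> Lv; apply: (L2_bounded_mul (m_sin b') _ Lv) => f; exact: sin_max.
have iC v : intg leb2 v -> intg leb2 (fun f => C f * v f).
  by move=> iv; apply: (intg_bounded_mul (m_cos b') _ iv) => f; exact: cos_le_1.
have iS v : intg leb2 v -> intg leb2 (fun f => S f * v f).
  by move=> iv; apply: (intg_bounded_mul (m_sin b') _ iv) => f; exact: sin_max.
have Sopp f : S (opp2 f) = - S f by rewrite /S dot2Nr mulrN sinN.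
pose w1 f := C f * Ba f; pose w2 f := S f * Ba f.
have Lw1 : L2 leb2 w1 := LC _ LBa; have Lw2 : L2 leb2 w2 := LS _ LBa.
have iw1 : intg leb2 w1 := iC _ iBa; have iw2 : intg leb2 w2 := iS _ iBa.
have Lw2o : L2 leb2 (fun f => w2 (opp2 f)) := scales_L2 scales_opp2 Lw2.
have iw2o : intg leb2 (fun f => w2 (opp2 f)) := scales_intg scales_opp2 iw2.
pose w : plane R -> R := w1 + (fun f => w2 (opp2 f)).
have Lw : L2 leb2 w := L2D Lw1 Lw2o; have iw : intg leb2 w := intgD iw1 iw2o.
have LUo : L2 leb2 (fun f => U (opp2 f)) := scales_L2 scales_opp2 LU.
have -> : ipp (phased_dil a b U) B = ipp U w.
  rewrite (ipDr Lw1 Lw2o LU).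
  have -> : ipp U (fun f => w2 (opp2 f)) = ipp (fun f => U (opp2 f)) w2.
    rewrite /ip -(Rint_opp2 (L2_mul LU Lw2o)).
    by apply: eq_Rintegral => f _; rewrite opp2K.
  rewrite /ip -(RintD (L2_mul LU Lw1) (L2_mul LUo Lw2)).
  have h := scales_Rint sa (intgD (L2_mul LU Lw1) (L2_mul LUo Lw2)).
  rewrite -[RHS](mulKf (_ : (a ^+ 2)^-1 != 0)) ?invr_eq0 ?expf_neq0//.
  rewrite invrK -h -RintZ; last first.
    exact: (scales_intg sa (intgD (L2_mul LU Lw1) (L2_mul LUo Lw2))).
  apply: eq_Rintegral => f _; rewrite /phased_dil fctE /w1 /w2 /Ba /C /S.
  have -> : dot2 b' (dil a (0, 0) f) = dot2 b f.
    by rewrite /dot2 /dil /b' /= !addr0; field.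
  have -> : dil a^-1 (0, 0) (dil a (0, 0) f) = f.
    by rewrite /dil /= !addr0 !mulKf//; case: (f).
  ring.
rewrite (HT_adjoint HU iw Lw).
have hw x : hartley_int w x = a ^+ 2 * hboxfun p (dil a b x).
  rewrite /hartley_int.
  under eq_Rintegral do rewrite mulrDl.
  rewrite (RintD (intg_cas x iw1) (intg_cas x iw2o)).
  rewrite -/(hartley_int w1 x) -/(hartley_int (fun f => w2 (opp2 f)) x) hartley_int_opp//.
  rewrite /hartley_int -(RintD (intg_cas x iw1) (intg_cas (opp2 x) iw2)).
  (* [casD] absorbs the phases of [w1] and [w2] into a shift of the argument by [b / a]. *)
  pose z : plane R := (x.1 + b.1 / a, x.2 + b.2 / a).
  transitivity (hartley_int Ba z).
    apply: eq_Rintegral => f _; rewrite dot2Nl mulrN /w1 /w2.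
    have -> : 2 * pi * dot2 z f = 2 * pi * dot2 x f + 2 * pi * dot2 b' f.
      by rewrite /dot2 /z /b' /=; ring.
    by rewrite casD /C /S; ring.
  rewrite /Ba (hartley_int_dil z ai0 iB) exprVn !invrK; congr (_ * hartley_int _ _).
  by rewrite /dil /z /= !addr0; congr pair; field.
rewrite /ip; under eq_Rintegral do rewrite hw.
have [_ LH _] := HT_box p.
have Lv := scales_L2 sv Lu.
have sab := scales_dil b a0.
have h := scales_Rint sab (L2_mul Lv LH).
rewrite -[RHS](mulKf (_ : (a ^+ 2)^-1 != 0)) ?invr_eq0 ?expf_neq0//.
rewrite invrK -h -RintZ; last exact: (scales_intg sab (L2_mul Lv LH)).
apply: eq_Rintegral => x _.
have -> : dil a^-1 (- b.1 / a, - b.2 / a) (dil a b x) = x.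
  by rewrite /dil /=; case: (x) => s t; congr pair => /=; field.
by rewrite mulrCA.
Qed.

End Covariance.

(** * Riesz transforms through the Hartley transform *)

Section RieszRelation.
Variable R : realType.
Implicit Types (b x y f : plane R) (u v w z U V W m : plane R -> R).
Local Notation ipp := (ip leb2).

(** Oddness makes multiplication by -j m preserve the form of the transform of a real function,
    homogeneity gives commutation with dilations, and the bound keeps the product in L^2. *)
Definition odd_multiplier m := [/\ measurable_fun setT m, forall x, `|m x| <= 1,
  forall x, m (opp2 x) = - m x & forall (a : R) x, 0 < a -> m (dil a (0, 0) x) = m x].

Definition riesz_mult1 f : R := f.1 / norm2 f.
Definition riesz_mult2 f : R := f.2 / norm2 f.

Lemma norm2_ge0 x : 0 <= norm2 x. Proof. exact: sqrtr_ge0. Qed.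

Lemma norm2_sqr x : norm2 x ^+ 2 = x.1 ^+ 2 + x.2 ^+ 2.
Proof. by rewrite sqr_sqrtr /dot2 -!expr2// addr_ge0 ?sqr_ge0. Qed.

Lemma norm2_opp2 x : norm2 (opp2 x) = norm2 x.
Proof. by rewrite /norm2 dot2Nl dot2Nr opprK. Qed.

Lemma norm2_dil (a : R) x : 0 < a -> norm2 (dil a (0, 0) x) = a * norm2 x.
Proof.
move=> a0; rewrite /norm2.
have -> : dot2 (dil a (0, 0) x) (dil a (0, 0) x) = a ^+ 2 * dot2 x x.
  by rewrite /dot2 /dil /=; ring.
by rewrite sqrtrM ?sqr_ge0// sqrtr_sqr gtr0_norm.
Qed.

Lemma measurable_norm2 : measurable_fun setT (@norm2 R).
Proof.
have ms : measurable_fun setT (Num.sqrt : R -> R).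
  by apply: continuous_measurable_fun; exact: sqrt_continuous.
apply: (measurableT_comp ms).
by apply: measurable_funD; apply: measurable_funM.
Qed.

Lemma odd_multiplier_of_coord (c : plane R -> R) : measurable_fun setT c ->
  (forall x, c x ^+ 2 <= norm2 x ^+ 2) -> (forall x, c (opp2 x) = - c x) ->
  (forall (a : R) x, 0 < a -> c (dil a (0, 0) x) = a * c x) ->
  odd_multiplier (fun f => c f / norm2 f).
Proof.
move=> mc cn co cd; split.
- apply: measurable_funM => //; apply: (measurableT_comp (@measurable_invr R)).
  exact: measurable_norm2.
- move=> x; have := norm2_ge0 x; rewrite le_eqVlt => /predU1P[<-|n0].
    by rewrite invr0 mulr0 normr0.
  rewrite normrM normfV (gtr0_norm n0) ler_pdivrMr// mul1r.
  by rewrite -ler_sqr ?nnegrE ?(ltW n0)// real_normK ?num_real.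
- by move=> x; rewrite co norm2_opp2 mulNr.
- move=> a x a0; rewrite cd// norm2_dil// invfM mulrACA divff ?mul1r//.
  exact: lt0r_neq0.
Qed.

Lemma riesz_mult1P : odd_multiplier riesz_mult1.
Proof.
apply: (@odd_multiplier_of_coord fst) => //.
- by move=> x; rewrite norm2_sqr lerDl sqr_ge0.
- by move=> a x _; rewrite /dil /= addr0.
Qed.

Lemma riesz_mult2P : odd_multiplier riesz_mult2.
Proof.
apply: (@odd_multiplier_of_coord snd) => //.
- by move=> x; rewrite norm2_sqr lerDr sqr_ge0.
- by move=> a x _; rewrite /dil /= addr0.
Qed.

(** The identity fails at the origin, where both quotients are 0. *)
Lemma riesz_mult_sqr : {ae leb2, forall f, riesz_mult1 f ^+ 2 + riesz_mult2 f ^+ 2 = 1}.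
Proof.
apply: filterS (ae_coord_neq (0, 0)) => f [/= f1 f2].
have n0 : norm2 f ^+ 2 != 0.
  by rewrite norm2_sqr lt0r_neq0// ltr_wpDr ?sqr_ge0// exprn_even_gt0.
by rewrite /riesz_mult1 /riesz_mult2 !expr_div_n -mulrDl -norm2_sqr divff.
Qed.

Definition twist m U f : R := m f * U (opp2 f).

Lemma L2_twist m U : odd_multiplier m -> L2 leb2 U -> L2 leb2 (twist m U).
Proof.
move=> [mm m1 _ _] LU; apply: L2_bounded_mul => //.
exact: scales_L2 (scales_opp2 R) LU.
Qed.

(** A relation, so that it does not depend on which representatives [riesz1] and [riesz2] select. *)
Definition RT m u v := exists2 U, HT u U & HT v (twist m U).

Lemma RT_L2l m u v : RT m u v -> L2 leb2 u. Proof. by move=> [U []]. Qed.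
Lemma RT_L2r m u v : RT m u v -> L2 leb2 v. Proof. by move=> [U _ []]. Qed.

Lemma HT_onto V : L2 leb2 V -> exists v, HT v V.
Proof.
move=> LV; have [w HV] := HT_exists LV.
exists ((hartley_mass R)^-1 *: w).
have := HTZ (hartley_mass R)^-1 (HT_sym HV).
by rewrite scalerA mulVf ?scale1r// lt0r_neq0// hartley_mass_gt0.
Qed.

Lemma RT_HT m u v U : odd_multiplier m -> RT m u v -> HT u U -> HT v (twist m U).
Proof.
move=> om [U' HU' Hv] HU; have [_ LU _] := HU; have [Lv _ _] := Hv.
apply: (HT_ae Hv Lv (L2_twist om LU) (ae_refl _ _)).
have := scales_ae (scales_opp2 R) (HT_unique HU HU' (ae_refl _ _)).
by apply: filterS => x; rewrite /twist => ->.
Qed.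

(** In frequency, [phased_dil] and [twist] commute: [m] is unchanged by the dilation, and its sign
    change under [opp2] compensates that of the sine phase. *)
Lemma RT_dil m (a : R) b u v : odd_multiplier m -> 0 < a -> RT m u v ->
  RT m (fun x => u (dil a^-1 (- b.1 / a, - b.2 / a) x))
       (fun x => v (dil a^-1 (- b.1 / a, - b.2 / a) x)).
Proof.
move=> [mm m1 mo md] a0 [U HU Hv]; exists (phased_dil a b U); first exact: HT_dil.
have := HT_dil b a0 Hv; congr HT; apply/funext => f.
have e : opp2 (dil a (0, 0) f) = dil a (0, 0) (opp2 f).
  by rewrite /opp2 /dil /= !addr0 !mulrN.
rewrite /twist /phased_dil opp2K dot2Nr mulrN cosN sinN -e opp2K mo md//.
by ring.
Qed.

Lemma mass_inj (s t : R) : hartley_mass R * s = hartley_mass R * t -> s = t.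
Proof. by apply: mulfI; rewrite lt0r_neq0// hartley_mass_gt0. Qed.

(** The substitution [f |-> opp2 f] in frequency, with [m] odd. *)
Lemma RT_antisym m u v w z : odd_multiplier m -> RT m u v -> RT m w z ->
  ipp u z = - ipp v w.
Proof.
move=> om [U HU Hv] [W HW Hz]; apply: mass_inj.
have [mm m1 mo _] := om; have [_ LU _] := HU; have [_ LW _] := HW.
rewrite mulrN -(HT_isometry HU Hz) -(HT_isometry Hv HW).
have LT := L2_mul LU (L2_twist om LW).
rewrite /ip -(Rint_opp2 LT) -mulN1r -RintZ; last exact: L2_mul (L2_twist om LU) LW.
by apply: eq_Rintegral => f _; rewrite /twist opp2K mo; ring.
Qed.

(** In frequency both sides integrate [m f * n f * U (opp2 f) * W (opp2 f)]. *)
Lemma RT_comm m n u v v' w z z' : odd_multiplier m -> odd_multiplier n ->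
  RT m u v -> RT n u v' -> RT m w z -> RT n w z' ->
  ipp v z' = ipp v' z.
Proof.
move=> om on mv nv' mz nz'; apply: mass_inj.
have [U HU] := HT_exists (RT_L2l mv); have [W HW] := HT_exists (RT_L2l mz).
rewrite -(HT_isometry (RT_HT om mv HU) (RT_HT on nz' HW)).
rewrite -(HT_isometry (RT_HT on nv' HU) (RT_HT om mz HW)).
by apply: eq_Rintegral => f _; rewrite /twist; ring.
Qed.

(** In frequency this is [riesz_mult_sqr] under the integral, after a reflection. *)
Lemma riesz_parseval u u1 u2 w w1 w2 :
  RT riesz_mult1 u u1 -> RT riesz_mult2 u u2 ->
  RT riesz_mult1 w w1 -> RT riesz_mult2 w w2 ->
  ipp u w = ipp u1 w1 + ipp u2 w2.
Proof.
move=> r1 r2 s1 s2; apply: mass_inj; rewrite mulrDr.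
have [U HU] := HT_exists (RT_L2l r1); have [W HW] := HT_exists (RT_L2l s1).
have o1 := riesz_mult1P; have o2 := riesz_mult2P.
have [_ LU _] := HU; have [_ LW _] := HW.
rewrite -(HT_isometry HU HW).
rewrite -(HT_isometry (RT_HT o1 r1 HU) (RT_HT o1 s1 HW)).
rewrite -(HT_isometry (RT_HT o2 r2 HU) (RT_HT o2 s2 HW)).
have L1 := L2_mul (L2_twist o1 LU) (L2_twist o1 LW).
have L2_ := L2_mul (L2_twist o2 LU) (L2_twist o2 LW).
rewrite /ip -(Rint_opp2 (L2_mul LU LW)) -(RintD L1 L2_); apply: eq_ae_Rint.
- exact: intg_meas (scales_intg (scales_opp2 R) (L2_mul LU LW)).
- exact: intg_meas (intgD L1 L2_).
- apply: filterS riesz_mult_sqr => f e; rewrite /twist.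
  rewrite -[LHS]mul1r -e; ring.
Qed.

End RieszRelation.

(** * Test functions *)

Import HBSimple.

Section SchwartzFunctions.
Variable R : realType.
Notation mu := (@lebesgue_measure R).
Notation mR := (measurableTypeR R).
Implicit Types (x : plane R) (phi u H : plane R -> R) (p q : {poly R}).

(** The definition of [schwartz] yields continuity in each variable separately. Approximating the
    first coordinate by simple functions gives measurable functions, which converge by continuity in
    that variable. *)
Lemma measurable_of_separately_continuous phi :
  (forall s : R, continuous (fun t : R => phi (t, s))) ->
  (forall s : R, continuous (fun t : R => phi (s, t))) -> measurable_fun setT phi.
Proof.
move=> c1 c2.
have mid : measurable_fun [set: mR] (EFin : mR -> \bar R) by exact/measurable_EFinP.
have [g hg] := approximation_sfun measurableT mid.
have mg n : measurable_fun setT (fun x => phi (g n x.1, x.2)).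
  move=> _ B mB; rewrite setTI.
  have -> : (fun x : plane R => phi (g n x.1, x.2)) @^-1` B =
      \bigcup_(r in range (g n)) ((g n @^-1` [set r]) `*` ((fun t : mR => phi (r, t)) @^-1` B)).
    apply/seteqP; split => [x /= Bx|x [r _ [/= <-]]//].
    by exists (g n x.1).
  apply: fin_bigcup_measurable; first exact: fimfunP.
  move=> r _; apply: measurableX; first exact: measurable_funPTI.
  rewrite -[X in measurable X]setTI.
  have : measurable_fun setT (fun t : mR => phi (r, t)) by apply: continuous_measurable_fun; exact: c2.
  by apply.
apply: (measurable_fun_cvg mg) => x _.
have gx : g n x.1 @[n --> \oo] --> x.1 by have /fine_cvgP[_] := hg x.1 I.
have := cvg_comp (g^~ x.1) (fun t => phi (t, x.2)) gx (c1 x.2 x.1).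
by case: (x).
Qed.

Lemma schwartz_measurable phi : schwartz phi -> measurable_fun setT phi.
Proof.
move=> /(_ [::])[d _]; apply: measurable_of_separately_continuous => s t.
  have /= [h _] := d (t, s).
  by apply/differentiable_continuous/derivable1_diffP.
have /= [_ h] := d (s, t).
by apply/differentiable_continuous/derivable1_diffP.
Qed.

Definition weight x : R := 1 + dot2 x x.

Lemma weight_ge1 x : 1 <= weight x.
Proof. by rewrite lerDl /dot2 addr_ge0// -expr2 sqr_ge0. Qed.

Lemma weight_gt0 x : 0 < weight x.
Proof. exact: lt_le_trans ltr01 (weight_ge1 x). Qed.

Lemma measurable_weightV n : measurable_fun setT (fun x => (weight x ^+ n)^-1).
Proof.
apply: (measurableT_comp (@measurable_invr R)); apply: measurable_funX.
by apply: measurable_funD => //; apply: measurable_funD; apply: measurable_funM.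
Qed.

Lemma schwartz_bound phi n : schwartz phi ->
  exists C : R, 0 <= C /\ forall x, `|phi x| <= C / weight x ^+ n.
Proof.
move=> /(_ [::])[_ /(_ n)[C hC]]; exists C; split.
  apply: le_trans (hC (0, 0)); apply: mulr_ge0 => //.
  by apply: exprn_ge0; exact: ltW (weight_gt0 _).
by move=> x; rewrite ler_pdivlMr ?exprn_gt0 ?weight_gt0// mulrC; exact: hC.
Qed.

(** [weight x ^+ 2] dominates the product of the one-dimensional weights. *)
Lemma intg_weightV2 : intg leb2 (fun x : plane R => (weight x ^+ 2)^-1).
Proof.
apply: intg_le (intg_tensor (intg_oneDsqr R) (intg_oneDsqr R)) _.
  exact: measurable_weightV.
move=> x; have w0 := weight_gt0 x.
rewrite ger0_norm ?invr_ge0 ?exprn_ge0 ?(ltW w0)// -invfM lef_pV2 ?posrE ?exprn_gt0//.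
rewrite /oneDsqr /weight /dot2 -!expr2.
by have := sqr_ge0 x.1; have := sqr_ge0 x.2; nra.
Qed.

Lemma schwartz_tempered_intg phi H : schwartz phi -> tempered H ->
  intg leb2 (fun x => phi x * H x).
Proof.
move=> sphi [mH [n iH]]; have [C [C0 hC]] := schwartz_bound n sphi.
have h := intgZ C (integrable_norm iH).
apply: intg_le h _; first by apply: measurable_funM => //; exact: schwartz_measurable.
move=> x; change (`|phi x * H x| <= C * `|H x / weight x ^+ n|).
have w0 : 0 < weight x ^+ n by rewrite exprn_gt0// weight_gt0.
by rewrite !normrM normfV (gtr0_norm w0) mulrCA [leLHS]mulrC ler_wpM2l.
Qed.

Lemma schwartz_intg phi : schwartz phi -> intg leb2 phi.
Proof.
move=> sphi; have [C [C0 hC]] := schwartz_bound 2 sphi.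
exact: intg_le (schwartz_measurable sphi) (intgZ C intg_weightV2) hC.
Qed.

Lemma schwartz_L2 phi : schwartz phi -> L2 leb2 phi.
Proof.
move=> sphi; have [C [C0 hC]] := schwartz_bound 2 sphi.
have mphi := schwartz_measurable sphi; split => //.
apply: intg_le (intgZ (C ^+ 2) intg_weightV2) _; first exact: measurable_funX.
move=> x; have w0 := weight_gt0 x; rewrite fctE.
have w1 : (weight x ^+ 2)^-1 <= 1 by rewrite invf_le1 ?exprn_gt0// exprn_ege1// weight_ge1.
have wp : 0 <= (weight x ^+ 2)^-1 by rewrite invr_ge0 exprn_ge0// ltW.
rewrite ger0_norm ?sqr_ge0// -(real_normK (num_real (phi x))).
have := hC x; have := normr_ge0 (phi x).
move: (`|phi x|) ((weight x ^+ 2)^-1) w1 wp => y v v1 v0 y0 yC.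
apply: (@le_trans _ _ ((C * v) ^+ 2)).
  by rewrite ler_sqr ?nnegrE// mulr_ge0.
by rewrite exprMn ler_wpM2l ?sqr_ge0//; nra.
Qed.

Lemma L2_tempered u : L2 leb2 u -> tempered u.
Proof.
move=> [mu_ iu]; split => //; exists 2%N.
apply: (intg_le _ (intgD iu intg_weightV2)).
  by apply: measurable_funM => //; exact: measurable_weightV.
move=> x; have w0 := weight_gt0 x; rewrite fctE.
have w1 : (weight x ^+ 2)^-1 <= 1 by rewrite invf_le1 ?exprn_gt0// exprn_ege1// weight_ge1.
have wp : 0 <= (weight x ^+ 2)^-1 by rewrite invr_ge0 exprn_ge0// ltW.
rewrite normrM (ger0_norm wp) -(real_normK (num_real (u x))).
have := normr_ge0 (u x); move: (`|u x|) ((weight x ^+ 2)^-1) w1 wp => y v v1 v0 y0.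
by have := sqr_ge0 (y - v); nra.
Qed.

(** For fixed [p] these functions are closed under differentiation, so all iterated partial
    derivatives of their tensor products stay in an explicit class. *)
Definition pexp p q (t : R) : R := q.[t] * expR (- p.[t]).

Lemma is_derive_pexp p q (t : R) :
  is_derive t 1 (pexp p q) (pexp p (q^`() - q * p^`()) t).
Proof.
have d1 : is_derive t 1 (fun s : R => - p.[s]) (- p^`().[t]) by exact: is_deriveN.
have d2 := @is_derive1_comp R expR (fun s => - p.[s]) t _ _ (is_derive_expR _) d1.
have d3 := is_deriveM (is_derive_poly q t) d2.
apply: (is_derive_eq d3); rewrite /pexp !hornerE /= /GRing.scale/=; ring.
Qed.

Definition rapid p := forall q, exists C : R, forall t, `|pexp p q t| <= C.

Lemma tens_partial p1 p2 q1 q2 (l : seq bool) : exists q1' q2',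
  partials l (tens (pexp p1 q1) (pexp p2 q2)) = tens (pexp p1 q1') (pexp p2 q2').
Proof.
elim: l => [|[] l [q1' [q2' IH]]]; first by exists q1, q2.
- exists q1', (q2'^`() - q2' * p2^`()); rewrite /= IH; apply/funext => x.
  rewrite /partial2 /tens derive1E.
  exact: (@derive_val _ _ _ _ _ _ _ (is_deriveZ (pexp p1 q1' x.1) (is_derive_pexp p2 q2' x.2))).
- exists (q1'^`() - q1' * p1^`()), q2'; rewrite /= IH; apply/funext => x.
  rewrite /partial1 /tens derive1E mulrC.
  under eq_fun do rewrite mulrC.
  exact: (@derive_val _ _ _ _ _ _ _ (is_deriveZ (pexp p2 q2' x.2) (is_derive_pexp p1 q1' x.1))).
Qed.

(** [weight x ^+ n] is at most the product of the powers of [1 + x.1 ^+ 2] and [1 + x.2 ^+ 2], which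
    the polynomial factors absorb. *)
Lemma tens_schwartz p1 p2 q1 q2 : rapid p1 -> rapid p2 ->
  schwartz (tens (pexp p1 q1) (pexp p2 q2)).
Proof.
move=> r1 r2 l; have [q1' [q2' ->]] := tens_partial p1 p2 q1 q2 l; split.
  move=> x; split; rewrite /tens /=.
    under eq_fun do rewrite mulrC.
    exact: (@ex_derive _ _ _ _ _ _ _ (is_deriveZ (pexp p2 q2' x.2) (is_derive_pexp p1 q1' x.1))).
  exact: (@ex_derive _ _ _ _ _ _ _ (is_deriveZ (pexp p1 q1' x.1) (is_derive_pexp p2 q2' x.2))).
move=> n.
have [C1 h1] := r1 ((1 + 'X ^+ 2) ^+ n * q1'); have [C2 h2] := r2 ((1 + 'X ^+ 2) ^+ n * q2').
exists (C1 * C2) => x; rewrite /tens.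
have {}h1 := h1 x.1; have {}h2 := h2 x.2.
have e q p t : pexp p ((1 + 'X ^+ 2) ^+ n * q) t = (1 + t ^+ 2) ^+ n * pexp p q t.
  by rewrite /pexp hornerM horner_exp hornerD hornerC hornerXn; ring.
have pos (t : R) : 0 <= 1 + t ^+ 2 by rewrite addr_ge0// sqr_ge0.
have := ler_pM (normr_ge0 _) (normr_ge0 _) h1 h2; apply: le_trans.
rewrite !e; move: (pexp p1 q1' x.1) (pexp p2 q2' x.2) => A B.
rewrite !normrM (ger0_norm (exprn_ge0 n (pos x.1))) (ger0_norm (exprn_ge0 n (pos x.2))).
rewrite [leRHS]mulrACA -exprMn; apply: ler_wpM2r; first exact: mulr_ge0.
apply: lerXn2r; rewrite ?nnegrE ?mulr_ge0//; first exact: ltW (weight_gt0 x).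
by rewrite /dot2 -!expr2; have := sqr_ge0 x.1; have := sqr_ge0 x.2; nra.
Qed.

End SchwartzFunctions.

(** * Schwartz approximations of indicators of boxes *)

Section BumpFunctions.
Variable R : realType.
Implicit Types (a b x f : plane R) (u U phi : plane R -> R) (p q : {poly R}).

(** The exponent is even and never 0: the bump of index 0 is already a Gaussian, and it serves as
    the dominating function. *)
Definition bump_poly (c r : R) n : {poly R} := (r^-1 *: ('X - c%:P)) ^+ (2 * n.+1).

Lemma bump_polyE (c r t : R) n : (bump_poly c r n).[t] = (((t - c) / r) ^+ 2) ^+ n.+1.
Proof. by rewrite /bump_poly horner_exp exprM hornerZ hornerXsubC mulrC. Qed.

(** A lower bound uniform in [n]: it gives both the decay of each bump and the domination of all of
    them by the one of index 0. *)
Lemma bump_poly_ge (c r t : R) n : ((t - c) / r) ^+ 2 - 1 <= (bump_poly c r n).[t].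
Proof.
rewrite bump_polyE; move: (_ ^+ 2) (sqr_ge0 ((t - c) / r)) => y y0.
have [y1|y1] := leP 1 y.
  have : y <= y ^+ n.+1 by rewrite ler_eXnr.
  lra.
by rewrite (@le_trans _ _ 0)// ?exprn_ge0//; lra.
Qed.

(** From [z <= expR z] at [z = y / k.+1], raised to the power [k]; [k.+1] keeps the divisor nonzero
    at [k = 0]. *)
Lemma pow_le_expR (y : R) k : 0 <= y -> y ^+ k <= k.+1%:R ^+ k * expR y.
Proof.
move=> y0; have k0 : 0 < k.+1%:R :> R by rewrite ltr0n.
have [z [z0 ->]] : exists z, 0 <= z /\ y = k.+1%:R * z.
  exists (y / k.+1%:R); rewrite divr_ge0 ?(ltW k0)//; split => //.
  by rewrite mulrC divfK// lt0r_neq0.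
have h : z <= expR z by apply: le_trans (expR_ge1Dx _); rewrite lerDr.
rewrite exprMn ler_wpM2l ?exprn_ge0 ?ler0n// expRM_natl exprS.
apply: (@le_trans _ _ (expR z ^+ k)).
  by rewrite lerXn2r// nnegrE// expR_ge0.
by rewrite ler_peMl ?exprn_ge0 ?expR_ge0// -expR0 ler_expR.
Qed.

Lemma bump_poly_rapid (c r : R) n : 0 < r -> rapid (bump_poly c r n).
Proof.
move=> r0.
have mono k : exists C : R, forall t, `|t| ^+ k * expR (- (bump_poly c r n).[t]) <= C.
  (* Here |t| is at most (|c| + r) (1 + s^2), and the exponential is at most
     [expR 2 * expR (- (1 + s ^+ 2))]; [pow_le_expR] is then applied to [1 + s ^+ 2]. *)
  exists ((`|c| + r) ^+ k * k.+1%:R ^+ k * expR 2) => t.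
  pose s := (t - c) / r.
  have ts : t = c + r * s by rewrite /s mulrC divfK ?subrKC// lt0r_neq0.
  have s1 : `|s| <= 1 + s ^+ 2.
    have := real_normK (num_real s); have := sqr_ge0 (`|s| - 1); have := normr_ge0 s; nra.
  have tM : `|t| <= (`|c| + r) * (1 + s ^+ 2).
    rewrite {1}ts (le_trans (ler_normD _ _))// normrM (gtr0_norm r0).
    have := normr_ge0 c; have := sqr_ge0 s; nra.
  have M0 : 0 <= `|c| + r by rewrite addr_ge0// ltW.
  have y0 : 0 <= 1 + s ^+ 2 by rewrite addr_ge0// sqr_ge0.
  apply: (@le_trans _ _ (((`|c| + r) * (1 + s ^+ 2)) ^+ k * expR (1 - s ^+ 2))).
    apply: ler_pM; rewrite ?exprn_ge0 ?expR_ge0//.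
      by rewrite lerXn2r// nnegrE// mulr_ge0.
    by rewrite ler_expR; have := bump_poly_ge c r t n; rewrite -/s; lra.
  have -> : expR 2 = expR (1 + s ^+ 2) * expR (1 - s ^+ 2) :> R.
    by rewrite -expRD; congr expR; ring.
  have P := pow_le_expR k y0.
  rewrite exprMn [leRHS]mulrA -[(`|c| + r) ^+ k * _ * _]mulrA.
  apply: ler_wpM2r; first exact: expR_ge0.
  by apply: ler_wpM2l; first exact: exprn_ge0.
move=> q.
suff H k : exists C : R, forall t, `|t| ^+ k * `|pexp (bump_poly c r n) q t| <= C.
  by have [C hC] := H 0%N; exists C => t; have := hC t; rewrite expr0 mul1r.
elim/poly_ind: q k => [|q d IH] k.
  by exists 0 => t; rewrite /pexp horner0 mul0r normr0 mulr0.
have [C1 h1] := IH k.+1; have [C2 h2] := mono k.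
exists (C1 + `|d| * C2) => t; rewrite /pexp hornerMXaddC.
have := h1 t; have := h2 t; rewrite /pexp !normrM (gtr0_norm (expR_gt0 _)).
move: (expR _) (expR_ge0 (- (bump_poly c r n).[t])) => e e0 k2 k1.
have h3 := ler_wpM2l (normr_ge0 d) k2.
have h4 : `|q.[t] * t + d| <= `|q.[t]| * `|t| + `|d|.
  by rewrite (le_trans (ler_normD _ _))// normrM.
have h5 : 0 <= `|t| ^+ k * e by rewrite mulr_ge0// exprn_ge0.
have h6 := ler_wpM2l h5 h4.
rewrite exprS in k1; lra.
Qed.

Definition bump a b n : plane R -> R :=
  tens (pexp (bump_poly ((a.1 + b.1) / 2) ((b.1 - a.1) / 2) n) 1)
       (pexp (bump_poly ((a.2 + b.2) / 2) ((b.2 - a.2) / 2) n) 1).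

Lemma bump_schwartz a b n : a.1 < b.1 -> a.2 < b.2 -> schwartz (bump a b n).
Proof.
move=> ab1 ab2; apply: tens_schwartz; apply: bump_poly_rapid;
by rewrite divr_gt0// subr_gt0.
Qed.

Lemma bump1E (c r t : R) n : pexp (bump_poly c r n) 1 t = expR (- (((t - c) / r) ^+ 2) ^+ n.+1).
Proof. by rewrite /pexp hornerC mul1r bump_polyE. Qed.

Lemma bump1_le (c r t : R) n :
  pexp (bump_poly c r n) 1 t <= expR 1 * pexp (bump_poly c r 0) 1 t.
Proof.
rewrite !bump1E -expRD ler_expR -bump_polyE expr1.
by have := bump_poly_ge c r t n; lra.
Qed.

(** In the coordinate [s] that maps the interval to []-1, 1]], the exponent tends to 0 inside and to
    minus infinity outside. At the endpoints the bump is constantly [expR (-1)], whence their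
    exclusion. *)
Lemma bump1_cvg (a b t : R) : a < b -> t != a -> t != b ->
  pexp (bump_poly ((a + b) / 2) ((b - a) / 2) n) 1 t @[n --> \oo] --> (\1_(`]a, b]%classic) t : R).
Proof.
move=> ab ta tb; under eq_fun do rewrite bump1E.
set s := (_ / _); have ba0 : 0 < b - a by rewrite subr_gt0.
have sE : t = (a + b) / 2 + (b - a) / 2 * s by rewrite /s; field; rewrite lt0r_neq0.
have [s1|s1] := ltP (s ^+ 2) 1.
  have -> : \1_(`]a, b]%classic) t = expR (- 0) :> R.
    rewrite oppr0 expR0 indicE mem_set//= in_itv/=.
    have : -1 < s < 1 by rewrite -ltr_norml -(@ltr_sqr _ `|s|) ?nnegrE// real_normK ?num_real ?expr1n.
    by move=> /andP[h1 h2]; apply/andP; split; rewrite sE; nra.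
  apply: (cvg_comp (fun n => - (s ^+ 2) ^+ n.+1) expR); last exact: continuous_expR.
  apply: cvgN; have := @cvg_expr R (s ^+ 2); rewrite ger0_norm ?sqr_ge0// => /(_ s1).
  by rewrite -(cvg_shiftS (fun n => (s ^+ 2) ^+ n)).
have nin : ~ (`]a, b]%classic t).
  rewrite /= in_itv/= => /andP[h1 h2].
  have h3 : t < b by rewrite lt_neqAle tb.
  have : `|s| < 1.
    by rewrite ltr_norml; apply/andP; split; rewrite sE in h1 h3; nra.
  rewrite -(@ltr_sqr _ `|s|) ?nnegrE// real_normK ?num_real// expr1n.
  by rewrite ltNge s1.
have -> : \1_(`]a, b]%classic) t = 0 :> R by rewrite indicE memNset.
have {}s1 : 1 < s ^+ 2.
  rewrite lt_neqAle s1 andbT eq_sym sqrf_eq1; apply/negP => /orP[] /eqP e.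
  - by move: tb; rewrite sE e => /eqP; apply; field.
  - by move: ta; rewrite sE e => /eqP; apply; field.
pose e := s ^+ 2 - 1; have e0 : 0 < e by rewrite subr_gt0.
(* A form of Bernoulli's inequality, which bounds the bumps outside the interval by a geometric
   sequence. *)
have bern n : n%:R * e <= (s ^+ 2) ^+ n.
  elim: n => [|n IH]; first by rewrite mul0r expr0.
  have h : 1 <= (s ^+ 2) ^+ n by rewrite exprn_ege1// ltW.
  rewrite exprS -natr1 mulrDl mul1r.
  have -> : s ^+ 2 = 1 + e by rewrite /e addrC subrK.
  have := h; have := IH; have -> : s ^+ 2 = 1 + e by rewrite /e addrC subrK.
  nra.
have sq : \forall n \near \oo, 0 <= expR (- (s ^+ 2) ^+ n.+1) <= expR (- e) ^+ n.+1.
  apply: nearW => n; rewrite expR_ge0/= -expRM_natl ler_expR mulrN lerN2.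
  exact: bern.
have e1 : `|expR (- e)| < 1.
  by rewrite ger0_norm ?expR_ge0// -expR0 ltr_expR oppr_lt0.
have lim := cvg_expr e1; rewrite -(cvg_shiftS (fun n => expR (- e) ^+ n)) in lim.
exact: (squeeze_cvgr sq (cvg_cst _) lim).
Qed.

Lemma indic_le_bump1 (a b t : R) : a < b ->
  \1_(`]a, b]%classic) t <= expR 1 * pexp (bump_poly ((a + b) / 2) ((b - a) / 2) 0) 1 t :> R.
Proof.
move=> ab; rewrite bump1E indicE; have [tin|_] := boolP (_ \in _); last first.
  by rewrite mulr_ge0// expR_ge0.
move: tin; rewrite inE/= in_itv/= => /andP[h1 h2].
rewrite -expRD -[leLHS]expR0 ler_expR expr1.
set s := (_ / _); have ba0 : 0 < b - a by rewrite subr_gt0.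
have sE : t = (a + b) / 2 + (b - a) / 2 * s by rewrite /s; field; rewrite lt0r_neq0.
have : `|s| <= 1 by rewrite ler_norml; apply/andP; split; rewrite sE in h1 h2; nra.
by rewrite -(@ler_sqr _ `|s|) ?nnegrE// real_normK ?num_real ?expr1n; lra.
Qed.

(** Testing on bumps and passing to the limit by dominated convergence gives zero integrals over all
    boxes. *)
Lemma tempered_ae0 U : tempered U ->
  (forall phi, schwartz phi -> \int[leb2]_x (phi x * U x) = 0) ->
  {ae leb2, forall x, U x = 0}.
Proof.
move=> tU hU; have [mU _] := tU.
have deg a b : ~ (a.1 < b.1 /\ a.2 < b.2) -> \1_(box a b) = (fun=> 0) :> (plane R -> R).
  move=> nab; apply/funext => x; rewrite indicE memNset// => -[] /=.
  rewrite !in_itv/= => /andP[h1 h2] /andP[h3 h4]; apply: nab.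
  by split; [exact: lt_le_trans h1 h2|exact: lt_le_trans h3 h4].
have mb a b : measurable_fun setT (fun x => U x * \1_(box a b) x).
  by apply: measurable_funM => //; exact: (intg_meas (intg_box a b)).
(* One factor [expR 1] for each coordinate, as in [bump1_le]. *)
pose E := expR 1 * expR 1 : R.
have idom a b : a.1 < b.1 -> a.2 < b.2 -> intg leb2 (fun x => E * `|bump a b 0 x * U x|).
  move=> ab1 ab2; apply: (intgZ E); apply: integrable_norm.
  exact: schwartz_tempered_intg (bump_schwartz 0 ab1 ab2) tU.
have b0 c r n (t : R) : 0 <= pexp (bump_poly c r n) 1 t by rewrite bump1E expR_ge0.
have bpos a b n x : 0 <= bump a b n x by rewrite mulr_ge0// b0.
have dom a b n x : `|bump a b n x * U x| <= E * `|bump a b 0 x * U x|.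
  rewrite (normrM (bump a b n x)) (normrM (bump a b 0 x)) [leRHS]mulrA.
  apply: ler_wpM2r => //; rewrite !(ger0_norm (bpos _ _ _ _)).
  have -> : E * bump a b 0 x = (expR 1 * pexp (bump_poly ((a.1 + b.1) / 2) ((b.1 - a.1) / 2) 0) 1 x.1)
     * (expR 1 * pexp (bump_poly ((a.2 + b.2) / 2) ((b.2 - a.2) / 2) 0) 1 x.2).
    by rewrite /bump /tens mulrACA.
  by apply: ler_pM => //; exact: bump1_le.
have domi a b x : a.1 < b.1 -> a.2 < b.2 -> `|U x * \1_(box a b) x| <= E * `|bump a b 0 x * U x|.
  move=> ab1 ab2; rewrite (normrM (U x)) (normrM (bump a b 0 x)) [leRHS]mulrA [leLHS]mulrC.
  apply: ler_wpM2r => //; rewrite (ger0_norm (bpos _ _ _ _)).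
  have -> : E * bump a b 0 x = (expR 1 * pexp (bump_poly ((a.1 + b.1) / 2) ((b.1 - a.1) / 2) 0) 1 x.1)
     * (expR 1 * pexp (bump_poly ((a.2 + b.2) / 2) ((b.2 - a.2) / 2) 0) 1 x.2).
    by rewrite /bump /tens mulrACA.
  have i0 (A : set R) (t : R) : 0 <= \1_A t :> R by rewrite indicE ler0n.
  rewrite box_indicE /tens normrM !(ger0_norm (i0 _ _)).
  by apply: ler_pM => //; exact: indic_le_bump1.
apply: ae0_of_box_integrals => // a b.
  have [[ab1 ab2]|/deg ->] := pselect (a.1 < b.1 /\ a.2 < b.2).
    by apply: intg_le (idom a b ab1 ab2) _ => // x; exact: domi.
  apply: eq_integrable (integrable0 leb2 setT) => // x _.
  by rewrite /= mulr0.
have [[ab1 ab2]|/deg ->] := pselect (a.1 < b.1 /\ a.2 < b.2); last first.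
  by under eq_Rintegral do rewrite mulr0; rewrite Rintegral_cst// mul0r.
have mn n : measurable_fun setT (fun x => (bump a b n x * U x)%:E).
  apply/measurable_EFinP/measurable_funM => //.
  exact: schwartz_measurable (bump_schwartz n ab1 ab2).
have mb' : measurable_fun setT (fun x => (U x * \1_(box a b) x)%:E) by exact/measurable_EFinP.
have cv : {ae leb2, forall x, [set: plane R] x ->
    (bump a b n x * U x)%:E @[n --> \oo] --> (U x * \1_(box a b) x)%:E}.
  apply: filterS2 (ae_coord_neq a) (ae_coord_neq b) => x [xa1 xa2] [xb1 xb2] _.
  apply: cvg_EFin; first exact: nearW.
  rewrite /= mulrC; apply: cvgM; last exact: cvg_cst.
  rewrite box_indicE; apply: cvgM; exact: bump1_cvg.
have dm : {ae leb2, forall x, forall n, [set: plane R] x ->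
   (`|(bump a b n x * U x)%:E| <= (E * `|bump a b 0 x * U x|)%:E)%E}.
  by apply: nearW => x n _; rewrite lee_fin dom.
have [_ _] := dominated_convergence measurableT mn mb' cv (idom a b ab1 ab2) dm.
have -> : [sequence (\int[leb2]_x (bump a b n x * U x)%:E)%E]_n = (fun=> 0%E).
  apply/funext => n /=; have sn := bump_schwartz n ab1 ab2.
  by rewrite (EFin_Rint (schwartz_tempered_intg sn tU)) hU.
move=> /cvg_lim h; rewrite /Rintegral -h ?lim_cst//; exact: ereal_hausdorff.
Qed.

End BumpFunctions.

(** * Quaternionic Fourier transforms of real functions *)

Section FourierHartley.
Variable R : realType.
Implicit Types (x f : plane R) (u v w U V phi : plane R -> R) (H h : plane R -> quat R).
Local Notation ipp := (ip leb2).

Lemma L2_LfunP u : L2 leb2 u <-> u \in Lfun leb2 2%:E.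
Proof.
split=> [[mu_ iu]|hu].
  rewrite inE; apply/andP; split; first by rewrite inE.
  rewrite inE /= /finite_norm unlock; apply: poweR_lty.
  rewrite (eq_integral (fun x => (u x ^+ 2)%:E)); first by rewrite (EFin_Rint iu) ltry.
  move=> x _; rewrite /= powR_mulrn// real_normK//.
  exact: num_real.
split; last exact: (Lfun2_integrable_sqr hu).
by move: hu; rewrite inE => /andP[]; rewrite inE.
Qed.

Lemma tempered0 : tempered (fun=> 0 : R).
Proof. by apply: L2_tempered; exact: L20. Qed.

Lemma tempered_weight u n k : measurable_fun setT u -> (n <= k)%N ->
  intg leb2 (fun x => u x / weight x ^+ n) -> intg leb2 (fun x => u x / weight x ^+ k).
Proof.
move=> mu_ nk iu; apply: intg_le (integrable_norm iu) _.
  by apply: measurable_funM => //; exact: measurable_weightV.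
move=> x /=; rewrite !normrM ler_wpM2l// !normfV lef_pV2 ?posrE ?normr_gt0 ?expf_neq0 ?lt0r_neq0 ?weight_gt0//.
rewrite !ger0_norm ?exprn_ge0 ?(ltW (weight_gt0 x))//.
by apply: ler_weXn2l => //; exact: weight_ge1.
Qed.

Lemma temperedB u v : tempered u -> tempered v -> tempered (fun x => u x - v x).
Proof.
move=> [mu_ [n iu]] [mv [k iv]]; split; first exact: measurable_funB.
exists (maxn n k).
have h1 := tempered_weight mu_ (leq_maxl n k) iu.
have h2 := tempered_weight mv (leq_maxr n k) iv.
have := intgB h1 h2; apply: eq_integrable => // x _ /=.
by rewrite mulrBl.
Qed.

Lemma tempered_unique u v : tempered u -> tempered v ->
  (forall phi, schwartz phi -> \int[leb2]_x (phi x * u x) = \int[leb2]_x (phi x * v x)) ->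
  {ae leb2, forall x, u x = v x}.
Proof.
move=> tu tv h; have := tempered_ae0 (temperedB tu tv); case.
  move=> phi sphi; under eq_Rintegral do rewrite mulrBr.
  rewrite (RintB (schwartz_tempered_intg sphi tu) (schwartz_tempered_intg sphi tv)).
  by rewrite h// subrr.
move=> N [mN N0 hN]; exists N; split => // x /= ne; apply: hN => /= e; apply: ne.
by apply/eqP; rewrite -subr_eq0; apply/eqP.
Qed.

Lemma is_fourier_unique h H H' : is_fourier h H -> is_fourier h H' ->
  {ae leb2, forall f, H f = H' f}.
Proof.
move=> [_ [t1 t2 t3 t4] hH] [_ [t1' t2' t3' t4'] hH'].
have eH phi (sp : schwartz phi) : qintegral (fun f => phi f *: H f) = qintegral (fun f => phi f *: H' f).
  by rewrite hH// hH'.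
have a1 := tempered_unique t1 t1' (fun phi sp => congr1 qre (eH phi sp)).
have a2 := tempered_unique t2 t2' (fun phi sp => congr1 qim_i (eH phi sp)).
have a3 := tempered_unique t3 t3' (fun phi sp => congr1 qim_j (eH phi sp)).
have a4 := tempered_unique t4 t4' (fun phi sp => congr1 qim_k (eH phi sp)).
have a12 : {ae leb2, forall f, qre (H f) = qre (H' f) /\ qim_i (H f) = qim_i (H' f)}.
  by apply: filterS2 a1 a2.
have a34 : {ae leb2, forall f, qim_j (H f) = qim_j (H' f) /\ qim_k (H f) = qim_k (H' f)}.
  by apply: filterS2 a3 a4.
apply: filterS2 a12 a34 => f [/= h1 h2] [/= h3 h4].
by case: (H f) (H' f) h1 h2 h3 h4 => ? ? ? ? [? ? ? ?] /= -> -> -> ->.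
Qed.

Definition hartley_to_fourier V f : quat R :=
  Quat ((V f + V (opp2 f)) / 2) 0 (- ((V f - V (opp2 f)) / 2)) 0.

Lemma qintegrable_real v : qintegrable (fun x => (v x)%:A) <-> intg leb2 v.
Proof.
have e1 : EFin \o (@qre R \o (fun x => (v x)%:A)) = EFin \o v.
  by apply/funext => x; rewrite /= mulr1.
have e0 : EFin \o (fun x => v x * 0) = (fun=> 0%E).
  by apply/funext => x; rewrite /= mulr0.
have i0 : leb2.-integrable setT (fun=> 0%E : \bar R) by exact: integrable0.
split => [[]|iv]; first by rewrite e1.
have iz : leb2.-integrable setT (EFin \o (fun x => v x * 0)) by rewrite e0.
by split; [rewrite e1|exact: iz..].
Qed.

Lemma Rint0 : \int[leb2]_x (0 : R) = 0.
Proof. by rewrite Rintegral_cst// mul0r. Qed.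

Lemma fourier_int_real v f : intg leb2 v ->
  fourier_int (fun x => (v x)%:A) f = hartley_to_fourier (hartley_int v) f.
Proof.
move=> iv; rewrite /fourier_int /qintegral /hartley_to_fourier.
have i1 := intg_cas f iv; have i2 := intg_cas (opp2 f) iv.
have k1 := intgZ 2^-1 (intgD i1 i2); have k2 := intgZ 2^-1 (intgB i1 i2).
congr Quat.
- rewrite mulrC /hartley_int -(RintD i1 i2) -(RintZ _ (intgD i1 i2)).
  apply: eq_Rintegral => x _; rewrite mulr_algl !fctE /= dot2Nl !mulrN /cas cosN sinN.
  by field.
- by rewrite -[RHS]Rint0; apply: eq_Rintegral => x _; rewrite mulr_algl /= mulr0.
- rewrite mulrC -mulNr /hartley_int -(RintB i1 i2) -(RintZ _ (intgB i1 i2)).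
  apply: eq_Rintegral => x _; rewrite mulr_algl !fctE /= dot2Nl !mulrN /cas cosN sinN.
  by field.
- by rewrite -[RHS]Rint0; apply: eq_Rintegral => x _; rewrite mulr_algl /= mulr0.
Qed.

(** Schwartz functions are integrable and in L^2, so [HT_adjoint] applies to a test function and to
    its reflection; half the sum and minus half the difference of the two identities are the two
    nonzero components. *)
Lemma is_fourier_hartley v V : HT v V -> is_fourier (fun x => (v x)%:A) (hartley_to_fourier V).
Proof.
move=> HV; have [Lv LV _] := HV.
have LVo := scales_L2 (scales_opp2 R) LV.
have te : tempered (fun f => (V f + V (opp2 f)) / 2).
  have := L2_tempered (L2Z 2^-1 (L2D LV LVo)); congr tempered.
  by apply/funext => f; rewrite mulrC.
have to : tempered (fun f => - ((V f - V (opp2 f)) / 2)).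
  have := L2_tempered (L2Z (- 2^-1) (L2B LV LVo)); congr tempered.
  by apply/funext => f; rewrite [in RHS]mulrC -mulNr.
split.
- have t0 : tempered (fun x => v x * 0).
    by have := tempered0; congr tempered; apply/funext => x; rewrite mulr0.
  split => //.
  have := L2_tempered Lv; congr tempered; apply/funext => x.
  by rewrite /= mulr1.
- by split => //; exact: tempered0.
move=> phi sphi; have ip_ := schwartz_intg sphi; have Lp := schwartz_L2 sphi.
have io := scales_intg (scales_opp2 R) ip_; have Lo := scales_L2 (scales_opp2 R) Lp.
have A1 := HT_adjoint HV ip_ Lp; have A2 := HT_adjoint HV io Lo.
have [_ LH1 _] := HT_hartley_int ip_ Lp; have [_ LH2 _] := HT_hartley_int io Lo.
have ev : ipp V (fun f => phi (opp2 f)) = ipp (fun f => V (opp2 f)) phi.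
  rewrite /ip -(Rint_opp2 (L2_mul LV Lo)).
  by apply: eq_Rintegral => f _; rewrite opp2K.
rewrite ev in A2.
have B1 := L2_mul LV Lp; have B2 := L2_mul LVo Lp.
have C1 := L2_mul Lv LH1; have C2 := L2_mul Lv LH2.
have Hopp x : hartley_int phi (opp2 x) = hartley_int (fun f => phi (opp2 f)) x.
  by rewrite (hartley_int_opp x ip_).
rewrite /qintegral; congr Quat.
- transitivity (2^-1 * (ipp V phi + ipp (fun f => V (opp2 f)) phi)).
    rewrite /ip -(RintD B1 B2) -(RintZ _ (intgD B1 B2)).
    by apply: eq_Rintegral => f _; rewrite fctE /=; ring.
  rewrite A1 A2 /ip -(RintD C1 C2) -(RintZ _ (intgD C1 C2)).
  apply: eq_Rintegral => x _; rewrite mulr_algl (fourier_int_real x ip_) /= Hopp fctE; ring.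
- transitivity (0 : R).
    by rewrite -[RHS]Rint0; apply: eq_Rintegral => x _; rewrite /= mulr0.
  rewrite -Rint0; apply: eq_Rintegral => x _.
  by rewrite mulr_algl (fourier_int_real x ip_) /= mulr0.
- transitivity (- 2^-1 * (ipp V phi - ipp (fun f => V (opp2 f)) phi)).
    rewrite /ip -(RintB B1 B2) -(RintZ _ (intgB B1 B2)).
    by apply: eq_Rintegral => f _; rewrite !fctE /=; ring.
  rewrite A1 A2 /ip -(RintB C1 C2) -(RintZ _ (intgB C1 C2)).
  apply: eq_Rintegral => x _; rewrite mulr_algl (fourier_int_real x ip_) /= Hopp !fctE; ring.
- transitivity (0 : R).
    by rewrite -[RHS]Rint0; apply: eq_Rintegral => x _; rewrite /= mulr0.
  rewrite -Rint0; apply: eq_Rintegral => x _.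
  by rewrite mulr_algl (fourier_int_real x ip_) /= mulr0.
Qed.

(** Where [fourier] is the integral, it agrees with the Hartley transform by [HT_unique]; otherwise
    the selected representative agrees by uniqueness of distributional transforms. *)
Lemma fourier_real v V : HT v V ->
  {ae leb2, forall f, fourier (fun x => (v x)%:A) f = hartley_to_fourier V f}.
Proof.
move=> HV; have [Lv LV _] := HV; rewrite /fourier; case: asboolP => iv.
  have {}iv := (qintegrable_real v).1 iv.
  have e := HT_unique (HT_hartley_int iv Lv) HV (ae_refl _ _).
  have e' := scales_ae (scales_opp2 R) e.
  apply: filterS2 e e' => f e1 e2.
  by rewrite fourier_int_real// /hartley_to_fourier e1 e2.
have HF := is_fourier_hartley HV.
have := is_fourier_unique (xgetPex (fun=> 0) (ex_intro _ _ HF)) HF.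
by [].
Qed.

End FourierHartley.

(** * Identification of the Riesz transforms *)

Section RieszTransforms.
Variable R : realType.
Implicit Types (x f : plane R) (u v U V m : plane R -> R).

(** Left multiplication by j exchanges the even and odd parts, as do the reflection in [twist] and
    the oddness of [m] together. *)
Lemma hartley_to_fourier_twist m U f : odd_multiplier m ->
  hartley_to_fourier (twist m U) f = (- m f *: qj) * hartley_to_fourier U f.
Proof.
move=> [_ _ mo _]; rewrite /hartley_to_fourier /twist opp2K mo.
by congr Quat => /=; ring.
Qed.

Lemma hartley_to_fourier_inj V V' f : hartley_to_fourier V f = hartley_to_fourier V' f -> V f = V' f.
Proof. by move=> [e1 /oppr_inj e2]; lra. Qed.

(** The set from which the multiplier selects is nonempty because the Hartley transform is onto;
    each of its elements has transform [twist m U] almost everywhere, as even and odd parts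
    determine a function. *)
Lemma fourier_multiplier_RT m u : odd_multiplier m -> L2 leb2 u ->
  RT m u (fourier_multiplier (fun f => - m f *: qj) u).
Proof.
move=> om Lu; have [U HU] := HT_exists Lu; have [_ LU _] := HU.
have FU := fourier_real HU.
set S := [set v | v \in Lfun leb2 2%:E /\ {ae leb2, forall f,
  fourier (fun x => (v x)%:A) f = (- m f *: qj) * fourier (fun x => (u x)%:A) f}].
have [v0 Hv0] := HT_onto (L2_twist om LU).
have ex : exists v, S v.
  exists v0; split; first by apply/L2_LfunP; have [] := Hv0.
  apply: filterS2 FU (fourier_real Hv0) => f -> ->.
  exact: hartley_to_fourier_twist.
have [/L2_LfunP Lv hv] := xgetPex (fun=> 0) ex.
rewrite /fourier_multiplier -/S; set v := xget _ S in Lv hv *.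
have [V HV] := HT_exists Lv; exists U => //.
apply: (HT_ae HV Lv (L2_twist om LU) (ae_refl _ _)).
have h2 := fourier_real HV.
have h3 : {ae leb2, forall f, hartley_to_fourier (twist m U) f = fourier (fun x => (v x)%:A) f}.
  by apply: filterS2 FU hv => f -> ->; exact: hartley_to_fourier_twist.
by apply: filterS2 h2 h3 => f -> h; exact: hartley_to_fourier_inj.
Qed.

Lemma riesz1_RT u : L2 leb2 u -> RT (@riesz_mult1 R) u (riesz1 u).
Proof. exact: fourier_multiplier_RT (@riesz_mult1P R). Qed.

Lemma riesz2_RT u : L2 leb2 u -> RT (@riesz_mult2 R) u (riesz2 u).
Proof. exact: fourier_multiplier_RT (@riesz_mult2P R). Qed.

End RieszTransforms.

(** * Quaternion-valued integrals and homogeneity of the Fourier transform *)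

Section QuaternionIntegrals.
Variable R : realType.
Implicit Types (x f : plane R) (u v phi : plane R -> R) (h k H F G : plane R -> quat R).

Lemma Rint_nonintegrable u : measurable_fun setT u -> ~ intg leb2 u ->
  \int[leb2]_x u x = 0.
Proof.
move=> mu_ nu; have mE : measurable_fun setT (EFin \o u) by exact/measurable_EFinP.
rewrite /Rintegral; case e : (\int[leb2]_x (u x)%:E)%E => [r| |] //=.
exfalso; apply: nu; apply/integrableP; split => //.
by apply/(abse_integralP leb2 measurableT mE); rewrite e ltry.
Qed.

(** A measurable function that is not integrable has real integral 0 by default, so homogeneity
    persists. [is_fourierZ] relies on this for the product of a tempered function with the transform
    of a test function, which it only shows to be measurable. *)
Lemma Rint_scale (c : R) u : c != 0 -> measurable_fun setT u ->
  \int[leb2]_x (c * u x) = c * \int[leb2]_x u x.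
Proof.
move=> c0 mu_; have [iu|nu] := pselect (intg leb2 u); first exact: RintZ.
rewrite (Rint_nonintegrable mu_ nu) mulr0; apply: Rint_nonintegrable.
  exact: measurable_funM.
move=> icu; apply: nu; have := intgZ c^-1 icu.
apply: eq_integrable => // x _.
by change ((c^-1 * (c * u x))%:E = (u x)%:E); rewrite mulKf.
Qed.

(** Each component of a quaternion product is a signed sum of four products of components. The three
    predicates cover both measurability and the integrability of a product of two L^2 functions. *)
Lemma each_part_mul (P : (plane R -> R) -> Prop) (Q S : (plane R -> R) -> Prop) h k :
  (forall u v, Q u -> S v -> P (fun x => u x * v x)) ->
  (forall u v, P u -> P v -> P (u + v)) -> (forall u v, P u -> P v -> P (u - v)) ->
  each_part Q h -> each_part S k -> each_part P (fun x => h x * k x).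
Proof.
move=> PM PD PB [h1 h2 h3 h4] [k1 k2 k3 k4].
have E : (fun x => h x * k x) = (fun x => Quat
    (qre (h x) * qre (k x) - qim_i (h x) * qim_i (k x) - qim_j (h x) * qim_j (k x) - qim_k (h x) * qim_k (k x))
    (qre (h x) * qim_i (k x) + qim_i (h x) * qre (k x) + qim_j (h x) * qim_k (k x) - qim_k (h x) * qim_j (k x))
    (qre (h x) * qim_j (k x) - qim_i (h x) * qim_k (k x) + qim_j (h x) * qre (k x) + qim_k (h x) * qim_i (k x))
    (qre (h x) * qim_k (k x) + qim_i (h x) * qim_j (k x) - qim_j (h x) * qim_i (k x) + qim_k (h x) * qre (k x))).
  by apply/funext => x; case: (h x) (k x) => ? ? ? ? [].
rewrite E; split.
- exact: (PB _ _ (PB _ _ (PB _ _ (PM _ _ h1 k1) (PM _ _ h2 k2)) (PM _ _ h3 k3)) (PM _ _ h4 k4)).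
- exact: (PB _ _ (PD _ _ (PD _ _ (PM _ _ h1 k2) (PM _ _ h2 k1)) (PM _ _ h3 k4)) (PM _ _ h4 k3)).
- exact: (PD _ _ (PD _ _ (PB _ _ (PM _ _ h1 k3) (PM _ _ h2 k4)) (PM _ _ h3 k1)) (PM _ _ h4 k2)).
- exact: (PD _ _ (PB _ _ (PD _ _ (PM _ _ h1 k4) (PM _ _ h2 k3)) (PM _ _ h3 k2)) (PM _ _ h4 k1)).
Qed.

Lemma each_part_meas_mul h k : each_part (measurable_fun setT) h ->
  each_part (measurable_fun setT) k -> each_part (measurable_fun setT) (fun x => h x * k x).
Proof.
apply: each_part_mul => u v mu_ mv.
- exact: measurable_funM.
- exact: measurable_funD.
- exact: measurable_funB.
Qed.

Lemma L2_qintegrable_mul h k : each_part (L2 leb2) h -> each_part (L2 leb2) k ->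
  qintegrable (fun x => h x * k x).
Proof.
apply: (@each_part_mul (intg leb2)) => u v.
- exact: L2_mul.
- exact: intgD.
- exact: intgB.
Qed.

Lemma each_part_sub (P Q : (plane R -> R) -> Prop) h : (forall u, P u -> Q u) ->
  each_part P h -> each_part Q h.
Proof. by move=> PQ [? ? ? ?]; split; exact: PQ. Qed.

Lemma qintegralZ (c : R) F : c != 0 -> each_part (measurable_fun setT) F ->
  qintegral (fun x => c *: F x) = c *: qintegral F.
Proof. by move=> c0 [m1 m2 m3 m4]; congr Quat; exact: Rint_scale. Qed.

Lemma qintegralD F G : qintegrable F -> qintegrable G ->
  qintegral (fun x => F x + G x) = qintegral F + qintegral G.
Proof.
by move=> [f1 f2 f3 f4] [g1 g2 g3 g4]; congr Quat; apply: RintD.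
Qed.

Lemma qintegral_scales F (T : plane R -> plane R) : scales leb2 T 1 -> qintegrable F ->
  qintegral (fun x => F (T x)) = qintegral F.
Proof.
move=> sT [f1 f2 f3 f4]; congr Quat.
- by rewrite (scales_Rint sT f1) mul1r.
- by rewrite (scales_Rint sT f2) mul1r.
- by rewrite (scales_Rint sT f3) mul1r.
- by rewrite (scales_Rint sT f4) mul1r.
Qed.

Lemma expNj_measurable f : each_part (measurable_fun setT) (fun x => expNj (dot2 f x)).
Proof.
have m : measurable_fun setT (fun x => 2 * pi * dot2 f x).
  by apply: measurable_funM => //; exact: measurable_dot2.
split; try exact: measurable_cst.
- exact: (measurableT_comp (@measurable_cos R) m).
- by apply: measurable_funN; exact: (measurableT_comp (@measurable_sin R) m).
Qed.

Lemma qintegrable_measurable h : qintegrable h -> each_part (measurable_fun setT) h.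
Proof. by apply: each_part_sub => u; exact: intg_meas. Qed.

Lemma qintegrableZ (c : R) h : qintegrable h -> qintegrable (fun x => c *: h x).
Proof. by move=> [h1 h2 h3 h4]; split; exact: intgZ. Qed.

Lemma qintegrableZP (c : R) h : c != 0 -> qintegrable (fun x => c *: h x) <-> qintegrable h.
Proof.
move=> c0; split; last exact: qintegrableZ.
move=> /(qintegrableZ c^-1); congr qintegrable; apply/funext => x.
by rewrite scalerA mulVf// scale1r.
Qed.

Lemma fourier_intZ (c : R) h f : c != 0 -> qintegrable h ->
  fourier_int (fun x => c *: h x) f = c *: fourier_int h f.
Proof.
move=> c0 ih; rewrite /fourier_int -qintegralZ//.
  by congr qintegral; apply/funext => x; rewrite -scalerAl.
by apply: each_part_meas_mul; [exact: qintegrable_measurable|exact: expNj_measurable].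
Qed.

Lemma temperedZ (c : R) u : tempered u -> tempered (fun x => c * u x).
Proof.
move=> [mu_ [n iu]]; split; first exact: measurable_funM.
exists n; have := intgZ c iu; apply: eq_integrable => // x _.
by change ((c * (u x / weight x ^+ n))%:E = (c * u x / weight x ^+ n)%:E); rewrite mulrA.
Qed.

Lemma is_fourierZ (c : R) h H : c != 0 -> is_fourier h H ->
  is_fourier (fun x => c *: h x) (fun f => c *: H f).
Proof.
move=> c0 [th tH hH]; split.
- by move: th => [? ? ? ?]; split; exact: temperedZ.
- by move: tH => [? ? ? ?]; split; exact: temperedZ.
move=> phi sphi.
have mphi := schwartz_measurable sphi; have ip_ := schwartz_intg sphi.
have mH : each_part (measurable_fun setT) (fun f => phi f *: H f).
  by move: tH => [[m1 _] [m2 _] [m3 _] [m4 _]]; split; exact: measurable_funM.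
transitivity (c *: qintegral (fun f => phi f *: H f)).
  rewrite -qintegralZ//; congr qintegral; apply/funext => f.
  by rewrite !scalerA mulrC.
rewrite hH// -qintegralZ//.
  by congr qintegral; apply/funext => x; rewrite scalerAl.
apply: each_part_meas_mul; first by apply: each_part_sub th => u [].
have m1 := measurable_hartley_int mphi.
have m2 : measurable_fun setT (fun x => hartley_int phi (opp2 x)).
  by have [mo _ _] := scales_opp2 R; exact: (measurableT_comp m1 mo).
have M : each_part (measurable_fun setT) (hartley_to_fourier (hartley_int phi)).
  split; try exact: measurable_cst.
  - by apply: measurable_funM => //; exact: measurable_funD.
  - by apply: measurable_funN; apply: measurable_funM => //; exact: measurable_funB.
move: M; congr (each_part _ _); apply/funext => x.
by rewrite fourier_int_real.
Qed.

(** As [c] is nonzero, both functions fall in the same case of [fourier]: the integral, a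
    representative unique up to a null set, or no transform at all and the default 0. *)
Lemma fourierZ (c : R) h : c != 0 ->
  {ae leb2, forall f, fourier (fun x => c *: h x) f = c *: fourier h f}.
Proof.
move=> c0; rewrite /fourier; case: asboolP => [/(qintegrableZP _ c0) ih|nih].
  by case: asboolP => // _; apply: nearW => f; exact: fourier_intZ.
case: asboolP => [ih|_]; first by case: nih; exact: qintegrableZ.
have [[H hH]|nH] := pselect (exists H, is_fourier h H).
  have := is_fourier_unique
    (xgetPex (fun=> 0) (ex_intro _ _ (is_fourierZ c0 hH)))
    (is_fourierZ c0 (xgetPex (fun=> 0) (ex_intro _ _ hH))).
  by [].
apply: nearW => f; rewrite !xgetPN ?scaler0// => H hH; apply: nH.
  by exists H.
exists (fun f => c^-1 *: H f); have := is_fourierZ (_ : c^-1 != 0) hH.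
rewrite invr_eq0 => /(_ c0); congr is_fourier; apply/funext => x.
by rewrite scalerA mulVf// scale1r.
Qed.

End QuaternionIntegrals.

(** * The monogenic wavelet transform *)

Section WaveletTransform.
Variable R : realType.
Implicit Types (x y b f : plane R) (u v w g psi : plane R -> R) (s : bool).
Local Notation ipp := (ip leb2).

Definition monogenic s u u1 u2 x : quat R := Quat (u x) (sg R s * u1 x) (sg R s * u2 x) 0.

Lemma waveletE s u : wavelet s u = monogenic s u (riesz1 u) (riesz2 u).
Proof.
by apply/funext => x; rewrite /wavelet /monogenic; congr Quat => /=; ring.
Qed.

(** Displays a component as a [wavelet] composed with the rotation that also occurs in [child]. *)
Lemma componentE s theta g :
  component s theta g = (fun x => wavelet s (gtilde theta g) (rmat (- theta) x)).
Proof. by []. Qed.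

Lemma rmatK (theta : R) x : rmat theta (rmat (- theta) x) = x.
Proof.
case: x => x1 x2; rewrite /rmat /= cosN sinN.
have h : cos theta ^+ 2 = 1 - sin theta ^+ 2 by rewrite cos2sin2.
congr pair.
- transitivity ((cos theta ^+ 2 + sin theta ^+ 2) * x1); first by ring.
  by rewrite h; ring.
- transitivity ((cos theta ^+ 2 + sin theta ^+ 2) * x2); first by ring.
  by rewrite h; ring.
Qed.

Lemma L2_gtilde theta g : L2 leb2 g -> L2 leb2 (gtilde theta g).
Proof. exact: scales_L2 (plane_rot theta). Qed.

Lemma L2_monogenic s u u1 u2 : L2 leb2 u -> L2 leb2 u1 -> L2 leb2 u2 ->
  each_part (L2 leb2) (monogenic s u u1 u2).
Proof.
move=> h h1 h2; split => //; [exact: L2Z|exact: L2Z|exact: L20].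
Qed.

Lemma L2_wavelet s u : L2 leb2 u -> each_part (L2 leb2) (wavelet s u).
Proof.
move=> Lu; rewrite waveletE; apply: L2_monogenic => //.
- exact: RT_L2r (riesz1_RT Lu).
- exact: RT_L2r (riesz2_RT Lu).
Qed.

Lemma L2_each_scales (T : plane R -> plane R) (k : R) (h : plane R -> quat R) :
  scales leb2 T k -> each_part (L2 leb2) h -> each_part (L2 leb2) (fun x => h (T x)).
Proof.
by move=> sT [h1 h2 h3 h4]; split;
  [exact: (scales_L2 sT h1)|exact: (scales_L2 sT h2)|exact: (scales_L2 sT h3)|exact: (scales_L2 sT h4)].
Qed.

Lemma L2_component s theta g : L2 leb2 g -> each_part (L2 leb2) (component s theta g).
Proof.
move=> Lg; rewrite componentE; apply: (L2_each_scales (plane_rot (- theta))).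
exact: L2_wavelet (L2_gtilde theta Lg).
Qed.

(** By linearity the rotation can be applied before the dilation and translation, which then act in
    rotated coordinates, with [b] rotated as well. *)
Lemma childE (a theta : R) b (h : plane R -> quat R) x :
  child a theta b h x = a^-1 *: h (dil a^-1 (- (rmat (- theta) b).1 / a, - (rmat (- theta) b).2 / a)
    (rmat (- theta) x)).
Proof.
by rewrite /child; congr (_ *: h _); rewrite /rmat /dil /=; congr pair; ring.
Qed.

Lemma L2_conj_child (a theta : R) b (h : plane R -> quat R) : 0 < a -> each_part (L2 leb2) h ->
  each_part (L2 leb2) (fun x => conjq (child a theta b h x)).
Proof.
move=> a0 Lh; have ai0 : 0 < a^-1 by rewrite invr_gt0.
have sc := scales_comp (scales_dil (- (rmat (- theta) b).1 / a, - (rmat (- theta) b).2 / a) ai0)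
  (plane_rot (- theta)).
have [h1 h2 h3 h4] := L2_each_scales sc Lh.
have E : (fun x => conjq (child a theta b h x)) = (fun x => conjq (a^-1 *: h ((dil a^-1
  (- (rmat (- theta) b).1 / a, - (rmat (- theta) b).2 / a) \o rmat (- theta)) x))).
  by apply/funext => x; rewrite childE.
rewrite E; split; [exact: L2Z|apply: L2N; exact: L2Z|apply: L2N; exact: L2Z|apply: L2N; exact: L2Z].
Qed.

Lemma wt_qintegrable s psi (a theta : R) b (h : plane R -> quat R) : 0 < a -> L2 leb2 psi ->
  each_part (L2 leb2) h ->
  qintegrable (fun x => h x * conjq (child a theta b (wavelet s psi) x)).
Proof.
move=> a0 Lpsi Lh; apply: L2_qintegrable_mul => //.
by apply: L2_conj_child => //; exact: L2_wavelet.
Qed.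

Lemma real_componentE theta g x :
  (g x)%:A = 2^-1 *: component true theta g x + 2^-1 *: component false theta g x.
Proof.
rewrite !componentE !waveletE /monogenic /gtilde rmatK.
by congr Quat; rewrite /= /sg; field.
Qed.

Lemma wt_real_split s psi g (a theta theta' : R) b : 0 < a -> L2 leb2 psi -> L2 leb2 g ->
  wt s psi a theta b (fun x => (g x)%:A) =
    2^-1 *: wt s psi a theta b (component true theta' g) +
    2^-1 *: wt s psi a theta b (component false theta' g).
Proof.
move=> a0 Lpsi Lg; have h2 : 2^-1 != 0 :> R by rewrite invr_neq0.
have i1 := wt_qintegrable s theta b a0 Lpsi (L2_component true theta' Lg).
have i2 := wt_qintegrable s theta b a0 Lpsi (L2_component false theta' Lg).
rewrite /wt -!qintegralZ//; try exact: qintegrable_measurable.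
rewrite -(qintegralD (qintegrableZ _ i1) (qintegrableZ _ i2)).
congr qintegral; apply/funext => x.
by rewrite (real_componentE theta' g x) mulrDl -!scalerAl.
Qed.

(** The Hamilton product multiplied out; [riesz_parseval], [RT_antisym] and [RT_comm] evaluate its
    entries. The factor [c] stands for the [a^-1] of [child]. *)
Lemma qintegral_monogenic (s t : bool) (c : R) u u1 u2 w w1 w2 :
  c != 0 -> L2 leb2 u -> L2 leb2 u1 -> L2 leb2 u2 ->
  L2 leb2 w -> L2 leb2 w1 -> L2 leb2 w2 ->
  qintegral (fun x => monogenic s u u1 u2 x * conjq (c *: monogenic t w w1 w2 x)) =
  c *: Quat (ipp u w + sg R s * sg R t * (ipp u1 w1 + ipp u2 w2))
            (sg R s * ipp u1 w - sg R t * ipp u w1)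
            (sg R s * ipp u2 w - sg R t * ipp u w2)
            (sg R s * sg R t * (ipp u2 w1 - ipp u1 w2)).
Proof.
move=> c0 Lu Lu1 Lu2 Lw Lw1 Lw2.
have M (v z : plane R -> R) (Lv : L2 leb2 v) (Lz : L2 leb2 z) := L2_mul Lv Lz.
pose F x := Quat (u x * w x + sg R s * sg R t * (u1 x * w1 x + u2 x * w2 x))
   (sg R s * (u1 x * w x) - sg R t * (u x * w1 x))
   (sg R s * (u2 x * w x) - sg R t * (u x * w2 x))
   (sg R s * sg R t * (u2 x * w1 x - u1 x * w2 x)).
have iF : qintegrable F.
  split.
  - exact: (intgD (M _ _ Lu Lw) (intgZ _ (intgD (M _ _ Lu1 Lw1) (M _ _ Lu2 Lw2)))).
  - exact: (intgB (intgZ _ (M _ _ Lu1 Lw)) (intgZ _ (M _ _ Lu Lw1))).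
  - exact: (intgB (intgZ _ (M _ _ Lu2 Lw)) (intgZ _ (M _ _ Lu Lw2))).
  - exact: (intgZ _ (intgB (M _ _ Lu2 Lw1) (M _ _ Lu1 Lw2))).
transitivity (qintegral (fun x => c *: F x)).
  by congr qintegral; apply/funext => x; congr Quat => /=; ring.
rewrite qintegralZ//; last exact: qintegrable_measurable.
congr (_ *: _); rewrite /qintegral; congr Quat.
- rewrite (RintD (M _ _ Lu Lw) (intgZ _ (intgD (M _ _ Lu1 Lw1) (M _ _ Lu2 Lw2)))).
  by rewrite (RintZ _ (intgD (M _ _ Lu1 Lw1) (M _ _ Lu2 Lw2))) (RintD (M _ _ Lu1 Lw1) (M _ _ Lu2 Lw2)).
- rewrite (RintB (intgZ _ (M _ _ Lu1 Lw)) (intgZ _ (M _ _ Lu Lw1))).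
  by rewrite (RintZ _ (M _ _ Lu1 Lw)) (RintZ _ (M _ _ Lu Lw1)).
- rewrite (RintB (intgZ _ (M _ _ Lu2 Lw)) (intgZ _ (M _ _ Lu Lw2))).
  by rewrite (RintZ _ (M _ _ Lu2 Lw)) (RintZ _ (M _ _ Lu Lw2)).
- by rewrite (RintZ _ (intgB (M _ _ Lu2 Lw1) (M _ _ Lu1 Lw2))) (RintB (M _ _ Lu2 Lw1) (M _ _ Lu1 Lw2)).
Qed.

Lemma sg_opp s : sg R (~~ s) = - sg R s.
Proof. by case: s; rewrite /sg ?opprK. Qed.

Lemma sg_sqr s : sg R s * sg R s = 1.
Proof. by case: s; rewrite /sg ?mulr1 ?mulrNN ?mulr1. Qed.

Lemma wt_annihilates s psi g (a theta : R) b : 0 < a -> L2 leb2 psi -> L2 leb2 g ->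
  wt s psi a theta b (component (~~ s) theta g) = 0.
Proof.
move=> a0 Lpsi Lg.
pose b' := rmat (- theta) b.
pose D := dil a^-1 (- b'.1 / a, - b'.2 / a).
have ai0 : 0 < a^-1 by rewrite invr_gt0.
have sD := scales_dil (- b'.1 / a, - b'.2 / a) ai0.
pose u := gtilde theta g; have Lu : L2 leb2 u := L2_gtilde theta Lg.
have r1 := riesz1_RT Lu; have r2 := riesz2_RT Lu.
have p1 := RT_dil b' (@riesz_mult1P R) a0 (riesz1_RT Lpsi).
have p2 := RT_dil b' (@riesz_mult2P R) a0 (riesz2_RT Lpsi).
have L1 := RT_L2r r1; have L2_ := RT_L2r r2.
have K0 := RT_L2l p1; have K1 := RT_L2r p1; have K2 := RT_L2r p2.
(* The integrand in coordinates where the common rotation has been removed. *)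
pose G y := monogenic (~~ s) u (riesz1 u) (riesz2 u) y *
  conjq (a^-1 *: monogenic s (fun x => psi (D x)) (fun x => riesz1 psi (D x)) (fun x => riesz2 psi (D x)) y).
transitivity (qintegral G).
  have iG : qintegrable G.
    apply: L2_qintegrable_mul; first exact: L2_monogenic.
    have [m1 m2 m3 m4] := L2_monogenic s K0 K1 K2.
    by split; [exact: L2Z|apply: L2N; exact: L2Z|apply: L2N; exact: L2Z|apply: L2N; exact: L2Z].
  rewrite -(qintegral_scales (plane_rot (- theta)) iG); congr qintegral.
  by apply/funext => x; rewrite childE componentE !waveletE.
rewrite qintegral_monogenic//; last by rewrite invr_neq0// lt0r_neq0.
(* The signs being opposite, the real part is a difference that the Parseval identity cancels, and
   the i and j parts are sums that antisymmetry cancels. *)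
rewrite sg_opp mulNr sg_sqr mulN1r -(riesz_parseval r1 r2 p1 p2) subrr.
rewrite (RT_antisym (@riesz_mult1P R) r1 p1) (RT_antisym (@riesz_mult2P R) r2 p2).
rewrite (RT_comm (@riesz_mult1P R) (@riesz_mult2P R) r1 r2 p1 p2) subrr.
by congr Quat => /=; ring.
Qed.

Lemma wt_real_half s psi g (a theta : R) b : 0 < a -> L2 leb2 psi -> L2 leb2 g ->
  wt s psi a theta b (fun x => (g x)%:A) = 2^-1 *: wt s psi a theta b (component s theta g).
Proof.
move=> a0 Lpsi Lg; rewrite (wt_real_split s theta theta b a0 Lpsi Lg).
have := wt_annihilates s theta b a0 Lpsi Lg.
by case: s => /= ->; rewrite scaler0 ?addr0 ?add0r.
Qed.

End WaveletTransform.

(** The transforms in [b] are compared almost everywhere in general, because [fourier] selects a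
    representative when its integral does not converge absolutely, and everywhere when it does. *)
Theorem corollary3 (R : realType) (psi g : plane R -> R)
    (hpsi : admissible psi) (hg : g \in Lfun leb2 2%:E) :
  let gH : plane R -> quat R := fun x => (g x)%:A in
  [/\ forall (s : bool) (a theta : R) (b : plane R),
        0 < a -> 0 <= theta < 2 * pi ->
        wt s psi a theta b (component (~~ s) theta g) = 0,
      forall (s : bool) (a theta : R) (b : plane R),
        0 < a -> 0 <= theta < 2 * pi ->
        wt s psi a theta b gH =
          2^-1 *: wt s psi a theta b (component s theta g),
      forall (s : bool) (a theta : R),
        0 < a -> 0 <= theta < 2 * pi ->
        {ae leb2, forall fb : plane R,
          Wt s psi a theta fb gH =
            2^-1 *: Wt s psi a theta fb (component s theta g)} /\
        (qintegrable (fun b => wt s psi a theta b gH) ->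
         forall fb : plane R,
           Wt s psi a theta fb gH =
             2^-1 *: Wt s psi a theta fb (component s theta g)) &
      forall (s : bool) (theta theta' : R),
        0 <= theta < 2 * pi ->
        ~ (exists l : int, theta' = theta + l%:~R * pi) ->
        exists cp cm : R, forall (a : R) (b : plane R), 0 < a ->
          wt s psi a theta b gH =
            cp *: wt s psi a theta b (component true theta' g) +
            cm *: wt s psi a theta b (component false theta' g)].
Proof.
have [/L2_LfunP Lpsi _ _] := hpsi; have /L2_LfunP Lg := hg.
have h2 : 2^-1 != 0 :> R by rewrite invr_neq0.
move=> gH; split.
- by move=> s a theta b a0 _; exact: wt_annihilates.
- by move=> s a theta b a0 _; exact: wt_real_half.
- move=> s a theta a0 _.
  have E : (fun b => wt s psi a theta b gH) =
      (fun b => 2^-1 *: wt s psi a theta b (component s theta g)).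
    by apply/funext => b; exact: wt_real_half.
  rewrite /Wt E; split; first exact: fourierZ.
  move=> i1 fb; have i2 := (qintegrableZP _ h2).1 i1.
  (* Both transforms are given by the integral here, so homogeneity holds at every frequency. *)
  rewrite /fourier; case: asboolP => // _; case: asboolP => // _.
  exact: fourier_intZ.
- move=> s theta theta' _ _; exists 2^-1, 2^-1 => a b a0.
  exact: wt_real_split.
Qed.
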